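(* Consider the controlled $N$-particle systems described in the context, suppose the controller uses fixed actions $a_0,\dots,a_{T-1}\in\mathcal{A}$ (action $a_t$ at time $t$), and let $(m_t,c_t)_{0\le t\le T}$ be the corresponding deterministic limit trajectory. Assume: (A1) given the context value $C$ and the action $a$ at time $t$, the particles move independently of each other, each according to the Markov kernel $K(a,C)$; (A2) the action set $\mathcal{A}$ is compact; (A3) the maps $(C,a)\mapsto K(a,C)$, $(C,M,a)\mapsto g(C,M,a)$ and $(M,C)\mapsto r_t(M,C)$ are continuous deterministic functions, uniformly continuous in $a$; (A4-bis) almost surely $(M^N_0,C^N_0)$ converges to the deterministic value $(m_0,c_0)$, there is $B<\infty$ such that almost surely $\|C^N_0\|_\infty\le B$ for all $N$, and there is a Gaussian vector $G_0$ in $\mathbb{R}^{S+d}$ of mean $0$ and covariance $\Gamma_0$ such that $\sqrt N\big((M^N_0,C^N_0)-(m_0,c_0)\big)$ converges in law to $G_0$; (A5-bis) for all $i,j\in\mathcal{S}$ the functions $g$, $K_{ij}$ and $r_t$ are differentiable at the points of the deterministic trajectory: $K_{ij}(a_t,\cdot)$ at $c_t$, $(c,m)\mapsto g(c,m,a_t)$ at $(c_t,m_{t+1})$, and $r_t$ at $(m_t,c_t)$. Let $(G_0,\dots,G_T)$ be the mean-zero Gaussian limit in law, as $N\to\infty$, of $\sqrt N\big((M^N_0,C^N_0)-(m_0,c_0),\dots,(M^N_T,C^N_T)-(m_T,c_T)\big)$, which exists under these assumptions. Then, with $\mathbf{D}r_t(m_t,c_t)$ the differential of $r_t$ at $(m_t,c_t)$,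 $$\sqrt N\Big(R^N_{a_0\dots a_{T-1}}(M^N_0,C^N_0)-r_{a_0\dots a_{T-1}}(m_0,c_0)\Big)\xrightarrow{\ \mathcal{L}\ }\sum_{t=1}^T\mathbf{D}r_t(m_t,c_t)\,G_t .$$
   Context: Fix $S,d,T\ge 1$, $\mathcal{S}=\{1,\dots,S\}$, $\mathcal{P}(\mathcal{S})$ the set of probability measures on $\mathcal{S}$ (a subset of $\mathbb{R}^S$), and $\mathcal{P}_N(\mathcal{S})$ the set of $p\in\mathcal{P}(\mathcal{S})$ with $Np(i)\in\mathbb{N}$ for all $i$. The action set $\mathcal{A}$ is a metric space. For $a\in\mathcal{A}$, $C\in\mathbb{R}^d$, $K(a,C)=(K_{i,j}(a,C))_{i,j\in\mathcal{S}}$ is a stochastic matrix; $g:\mathbb{R}^d\times\mathcal{P}(\mathcal{S})\times\mathcal{A}\to\mathbb{R}^d$; and $r_t:\mathcal{P}(\mathcal{S})\times\mathbb{R}^d\to\mathbb{R}$ are reward functions. None of these depends on $N$. Differentiability in the variable $m\in\mathcal{P}(\mathcal{S})$ is understood for an extension of the function to a neighbourhood of $\mathcal{P}(\mathcal{S})$ in $\mathbb{R}^S$. For each $N$ there are $N$ particles with states $X^N_n(t)\in\mathcal{S}$; $(M^N_t)_i=\frac1N\sum_{n=1}^N\mathbf 1_{X^N_n(t)=i}$, so $M^N_t\in\mathcal{P}_N(\mathcal{S})$. If action $a_t$ is used at time $t$, each particle in state $i$ moves to state $j$ with probability $K_{i,j}(a_t,C^N_t)$, and then $C^N_{t+1}=g(C^N_t,M^N_{t+1},a_t)\in\mathbb{R}^d$.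 The initial states $(M_0^N,C_0^N)$, $N\ge1$, may be random and are defined on a common probability space. $\|C\|_\infty=\sup_i|C_i|$. The deterministic limit trajectory is defined from $(m_0,c_0)$ by $m_{t+1}=m_tK(a_t,c_t)$ (row vector times matrix) and $c_{t+1}=g(c_t,m_{t+1},a_t)$. The (random) total reward is $R^N_{a_0\dots a_{T-1}}(M^N_0,C^N_0)=\sum_{t=1}^T r_t(M^N_t,C^N_t)$ and the deterministic total reward is $r_{a_0\dots a_{T-1}}(m_0,c_0)=\sum_{t=1}^T r_t(m_t,c_t)$. *)

(* Defs.v *)
From HB Require Import structures.
From mathcomp Require Export all_boot all_order all_algebra.
From mathcomp Require Export all_classical all_reals all_analysis.

Set Implicit Arguments.
Unset Strict Implicit.
Unset Printing Implicit Defensive.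

Export Order.TTheory GRing.Theory Num.Theory.
Export numFieldNormedType.Exports.

#[export] Set Implicit Arguments.
#[export] Unset Strict Implicit.
#[export] Unset Printing Implicit Defensive.

#[global] Open Scope classical_set_scope.
#[global] Open Scope ring_scope.

Definition simplex (R : realType) (S : nat) : set 'rV[R]_S :=
  [set p | (forall i, 0 <= p 0 i) /\ \sum_i p 0 i = 1].

Definition stochastic (R : realType) (S : nat) (Q : 'M[R]_S) : Prop :=
  forall i, simplex (row i Q).

(* Random matrices ('M_(m, n), in particular row vectors) are maps with
   measurable entries: the Borel and product sigma-algebras of 'M_(m, n)
   coincide, and the library puts no measurable structure on matrices. *)
Definition random_mx (d : measure_display) (O : measurableType d)
    (R : realType) (m n : nat) (Y : O -> 'M[R]_(m, n)) : Prop :=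
  forall i j, measurable_fun [set: O] (fun w => Y w i j).

(* The convention that N(mu, 0) is the Dirac mass at mu; [normal_prob mu 0]
   is a different (junk) measure. *)
Definition gaussian_law (R : realType) (mu sigma : R) : set R -> \bar R :=
  if sigma == 0 then \d_mu else normal_prob mu sigma.

(* Gaussian vectors, indexed by 'I_m * 'I_n: every linear form of Y has a
   (possibly degenerate) normal law. *)
Definition gaussian_mx (d : measure_display) (O : measurableType d)
    (R : realType) (P : probability O R) (m n : nat)
    (Y : O -> 'M[R]_(m, n)) : Prop :=
  random_mx Y /\
  forall U : 'M[R]_(m, n), exists mu sigma : R,
    forall B : set R, measurable B ->
      P ((fun w => \sum_i \sum_j U i j * Y w i j) @^-1` B) =
      gaussian_law mu sigma B.

Definition mean_zero (d : measure_display) (O : measurableType d)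
    (R : realType) (P : probability O R) (m n : nat)
    (Y : O -> 'M[R]_(m, n)) : Prop :=
  forall i j, ('E_P[fun w => Y w i j] = 0)%E.

Definition has_covariance (d : measure_display) (O : measurableType d)
    (R : realType) (P : probability O R) (n : nat)
    (Y : O -> 'rV[R]_n) (Gamma : 'M[R]_n) : Prop :=
  forall i j,
    covariance P (fun w => Y w 0 i) (fun w => Y w 0 j) = (Gamma i j)%:E.

(* Only the laws of the Z N and of Y matter, so Y may live on another
   probability space. *)
Definition cvg_in_law (d d' : measure_display) (O : measurableType d)
    (O' : measurableType d') (R : realType) (P : probability O R)
    (P' : probability O' R) (V : topologicalType)
    (Z : nat -> O -> V) (Y : O' -> V) : Prop :=
  forall f : V -> R, continuous f -> (exists B : R, forall x, `|f x| <= B) ->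
    ('E_P[f \o Z N] @[N --> \oo] --> 'E_P'[f \o Y])%E.

Definition cond_prob_version (d : measure_display) (O : measurableType d)
    (R : realType) (P : probability O R) (F : set (set O)) (A : set O)
    (f : O -> R) : Prop :=
  (forall B : set R, measurable B -> F (f @^-1` B)) /\
  (forall E : set O, F E -> P (E `&` A) = (\int[P]_(w in E) (f w)%:E)%E).

Definition history (O : Type) (R : realType) (N S d : nat)
    (X : 'I_N -> nat -> O -> 'I_S) (C : nat -> O -> 'rV[R]_d) (t : nat) :
    set (set O) :=
  <<s [set E | exists2 s, (s <= t)%N &
        (exists n i, E = X n s @^-1` [set i]) \/
        (exists j (B : set R),
           measurable B /\ E = (fun w => C s w 0 j) @^-1` B)] >>.

Definition empirical (R : realType) (N S : nat) (x : 'I_N -> 'I_S) :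
    'rV[R]_S :=
  \row_i (N%:R^-1 * \sum_(n < N) (x n == i)%:R).

Definition total_reward (R : realType) (S d : nat)
    (r : nat -> 'rV[R]_S -> 'rV[R]_d -> R) (T : nat)
    (m : nat -> 'rV[R]_S) (c : nat -> 'rV[R]_d) : R :=
  \sum_(1 <= t < T.+1) r t (m t) (c t).

Definition fluctuation (R : realType) (S d N : nat)
    (M m : 'rV[R]_S) (C c : 'rV[R]_d) : 'rV[R]_(S + d) :=
  Num.sqrt N%:R *: (row_mx M C - row_mx m c).

(* Vectors of R^(S + d) are split as R^S * R^d.  Functions of a probability
   vector are total on R^S: outside the simplex they are the extension through
   which differentiability is understood. *)
Definition reward_differential (R : realType) (S d : nat)
    (r : 'rV[R]_S -> 'rV[R]_d -> R) (m : 'rV[R]_S) (c : 'rV[R]_d)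
    (v : 'rV[R]_(S + d)) : R :=
  'd (fun z : 'rV[R]_S * 'rV[R]_d => r z.1 z.2) (m, c) (lsubmx v, rsubmx v).

(* Main.v *)
(* The scaled deviations D_t = sqrt N ((M_t, C_t) - (m_t, c_t)) satisfy
   D_{t+1} = D_t A_t + W_t B_t + o(1) in probability, where W_t is the centred
   and scaled transition noise of the particles and A_t, B_t come from the
   differentials of K and g at the limit trajectory.  Given the history, W_t
   is a normalised sum of independent bounded vectors, whose conditional
   characteristic function is within O(1 / sqrt N) of that of a Gaussian with
   covariance depending continuously on (M_t, C_t), hence asymptotically
   deterministic.  By induction on t the characteristic functions of
   (D_0, ..., D_t) converge to Gaussian ones, and Levy's continuity theorem
   (tightness, then approximation of a continuous function by trigonometric
   polynomials: Bernstein polynomials in sin (x_ij / 2K)) yields the limit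
   (G_0, ..., G_T).  The limit is realised by G_{t+1} = G_t A_t + H_t B_t with
   H_t a fresh combination of independent standard normal variables.  The
   reward is then handled by the delta method: up to a vanishing error,
   sqrt N (R^N - r) is the continuous linear image sum_t Dr_t D_t. *)
Require Import Defs.
From mathcomp Require Import ring lra measurable_realfun.

(** * Bounded expectations and tightness *)

(** Differentiability holds only at the points of the limit trajectory, so a linearisation error is
    small only uniformly over bounded sets of deviations. Tightness of every [D_t] is therefore
    propagated before any error is declared negligible; it serves again in the continuity theorem.
    Conditional expectations are never constructed: [cond_prob_version] is tested against bounded
    functions measurable for the history, and since the states are finite in number, a mean over the
    next configuration is a finite sum against a product measure ([prodE]). Cosines with an
    arbitrary phase replace complex exponentials. The induction on t closes because a linear form in
    [(D_0, ..., D_{t+1})] is, up to a vanishing error, a linear form in [(D_0, ..., D_t)], which the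
    history determines, plus a linear form in [W_t]. That a linear form of the limit is normal is
    read off its characteristic function by a uniqueness theorem, itself the continuity theorem for
    a constant sequence; the characteristic function of a normal law comes from Stein's identity.
    Properties along N are often required only eventually, the context being measurable for N >=
    1. *)

Section expectation.
Context (d : measure_display) (O : measurableType d) (R : realType)
  (P : probability O R).
Implicit Types (X Y : O -> R) (B e : R).

Lemma bounded_integrable X B : measurable_fun setT X ->
  (forall w, `|X w| <= B) -> P.-integrable setT (EFin \o X).
Proof.
move=> mX XB; apply: measurable_bounded_integrable => //.
  by rewrite (le_lt_trans (probability_le1 P measurableT)) ?ltry.
exists B; split; first by rewrite num_real.
by move=> x Bx w _; exact: le_trans (XB w) (ltW Bx).
Qed.

Lemma Rintegral_cst_prob (a : R) : \int[P]_w a = a.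
Proof.
rewrite Rintegral_cst// -[RHS]mulr1; congr (_ * _).
exact: (congr1 fine (probability_setT P)).
Qed.

Lemma integrable_sumR (I : Type) (r : seq I) (F : I -> O -> R) :
  (forall i, P.-integrable setT (EFin \o F i)) ->
  P.-integrable setT (EFin \o (fun w => \sum_(i <- r) F i w)).
Proof.
move=> iF.
have : P.-integrable setT (fun w => \sum_(i <- r) (F i w)%:E)%E.
  by apply: integrable_sum => // i _; exact: iF.
by apply: eq_integrable => // w _; rewrite /= sumEFin.
Qed.

Lemma Rintegral_sum (I : Type) (r : seq I) (F : I -> O -> R) :
  (forall i, P.-integrable setT (EFin \o F i)) ->
  \int[P]_w (\sum_(i <- r) F i w) = \sum_(i <- r) \int[P]_w F i w.
Proof.
move=> iF; elim: r => [|i r IH].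
  by rewrite big_nil; under eq_Rintegral do rewrite big_nil; rewrite Rintegral_cst_prob.
under eq_Rintegral do rewrite big_cons.
by rewrite big_cons -IH RintegralD//; exact: integrable_sumR.
Qed.

Lemma normr_mean_le X B : measurable_fun setT X -> (forall w, `|X w| <= B) ->
  `|\int[P]_w X w| <= B.
Proof.
move=> mX XB.
apply: (le_trans (le_normr_Rintegral measurableT (bounded_integrable mX XB))).
rewrite -[leRHS]Rintegral_cst_prob; apply: le_Rintegral => //.
- apply: (@bounded_integrable _ B); first exact: measurableT_comp.
  by move=> w; rewrite normr_id.
- by apply: (@bounded_integrable _ `|B|) => //; exact: measurable_cst.
Qed.

(** On the exceptional event [E] the variables differ by at most [2 * B], elsewhere by [delta]. This
    converts closeness in probability into closeness of means. *)
Lemma mean_near X Y B e delta (E : set O) :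
  measurable_fun setT X -> measurable_fun setT Y ->
  (forall w, `|X w| <= B) -> (forall w, `|Y w| <= B) ->
  measurable E -> (P E <= e%:E)%E -> 0 <= delta ->
  (forall w, ~ E w -> `|X w - Y w| <= delta) ->
  `|\int[P]_w X w - \int[P]_w Y w| <= delta + 2 * B * e.
Proof.
move=> mX mY XB YB mE PE d0 XY.
have B0 : 0 <= B by exact: le_trans (normr_ge0 _) (XB point).
have iX := bounded_integrable mX XB; have iY := bounded_integrable mY YB.
rewrite -RintegralB//.
have XY2 w : `|X w - Y w| <= 2 * B.
  by rewrite (le_trans (ler_normB _ _))// mulr_natl mulr2n lerD.
have mXY : measurable_fun setT (fun w => X w - Y w) by exact: measurable_funB.
apply: (le_trans (le_normr_Rintegral measurableT (bounded_integrable mXY XY2))).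
have m1 : measurable_fun setT (\1_E : O -> R) by exact: measurable_indic.
have i1 : P.-integrable setT (EFin \o (fun w => 2 * B * \1_E w)).
  apply: (@bounded_integrable _ (2 * B)).
    by apply: measurable_funM => //; exact: measurable_cst.
  move=> w; rewrite indicE; case: (_ \in _); rewrite ?mulr1 ?mulr0 ?normr0 ?mulr_ge0//.
  by rewrite ger0_norm// mulr_ge0.
apply: (@le_trans _ _ (\int[P]_w (delta + 2 * B * \1_E w))).
  apply: le_Rintegral => //.
  - apply: (@bounded_integrable _ (2 * B)); first exact: measurableT_comp.
    by move=> w; rewrite normr_id.
  - rewrite (_ : _ \o _ = fun w => (delta%:E + (2 * B * \1_E w)%:E)%E)//.
    apply: integrableD => //; apply: (@bounded_integrable (cst delta) `|delta|) => //.
  - move=> w _; rewrite indicE; case: (boolP (w \in E)) => wE.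
      by rewrite mulr1 (le_trans (XY2 w))// lerDr.
    by rewrite mulr0 addr0 XY//; rewrite notin_setE in wE.
rewrite RintegralD//; last by apply: (@bounded_integrable (cst delta) `|delta|).
rewrite Rintegral_cst_prob lerD2l RintegralZl//; last first.
  apply: (@bounded_integrable _ 1) => // w.
  by rewrite indicE; case: (_ \in _); rewrite ?normr0 ?normr1.
rewrite ler_wpM2l ?mulr_ge0// /Rintegral integral_indic// setIT.
rewrite -lee_fin fineK//; exact: fin_num_measure.
Qed.

(* Eventually, [Q N] holds outside an event of probability at most [e]. *)
Definition whp e (Q : nat -> set O) := \forall N \near \oo,
  exists E, [/\ measurable E, (P E <= e%:E)%E & forall w, ~ E w -> Q N w].

Lemma whpI e1 e2 Q1 Q2 : whp e1 Q1 -> whp e2 Q2 ->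
  whp (e1 + e2) (fun N => Q1 N `&` Q2 N).
Proof.
move=> h1 h2; near=> N.
have [E1 [mE1 P1 q1]] : exists E, [/\ measurable E, (P E <= e1%:E)%E & forall w, ~ E w -> Q1 N w].
  by near: N.
have [E2 [mE2 P2 q2]] : exists E, [/\ measurable E, (P E <= e2%:E)%E & forall w, ~ E w -> Q2 N w].
  by near: N.
exists (E1 `|` E2); split; first exact: measurableU.
  by rewrite (le_trans (measureU2 _ _ _))// EFinD leeD.
by move=> w /not_orP[w1 w2]; split; [exact: q1|exact: q2].
Unshelve. all: by end_near. Qed.

Lemma whpS e Q1 Q2 : (\forall N \near \oo, Q1 N `<=` Q2 N) ->
  whp e Q1 -> whp e Q2.
Proof.
move=> q h; near=> N.
have [E [mE PE q1]] : exists E, [/\ measurable E, (P E <= e%:E)%E & forall w, ~ E w -> Q1 N w].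
  by near: N.
exists E; split=> // w /q1; have : Q1 N `<=` Q2 N by near: N.
exact.
Unshelve. all: by end_near. Qed.

Lemma whpT e Q : 0 <= e -> (\forall N \near \oo, forall w, Q N w) -> whp e Q.
Proof.
move=> e0 q; near=> N; exists set0; split; rewrite ?measure0 ?lee_fin//.
by move=> w _; move: w; near: N.
Unshelve. all: by end_near. Qed.

Definition tight (V : normedModType R) (Z : nat -> O -> V) :=
  forall e, 0 < e -> exists K, whp e (fun N w => `|Z N w| <= K).

Definition vanishing (V : normedModType R) (Z : nat -> O -> V) :=
  forall e delta, 0 < e -> 0 < delta -> whp e (fun N w => `|Z N w| <= delta).

Lemma mean_vanishing (X Y : nat -> O -> R) B :
  (\forall N \near \oo, measurable_fun setT (X N)) ->
  (\forall N \near \oo, measurable_fun setT (Y N)) ->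
  (forall N w, `|X N w| <= B) -> (forall N w, `|Y N w| <= B) ->
  vanishing (fun N w => X N w - Y N w) ->
  \int[P]_w X N w - \int[P]_w Y N w @[N --> \oo] --> 0.
Proof.
move=> mX mY XB YB XY; apply/cvgr0Pnorm_le => e e0.
have B0 : 0 <= B by exact: le_trans (normr_ge0 _) (XB 0%N point).
have e2 : 0 < e / 2 by rewrite divr_gt0.
(* Chosen so that the term [2 * B * e] of [mean_near] is at most half of the error; [B + 1] avoids
   dividing by 0. *)
have e4 : 0 < e / (4 * (B + 1)) by rewrite divr_gt0// mulr_gt0// ltr_wpDl.
have H := XY _ _ e4 e2.
near=> N.
have [E [mE PE q]] : exists E, [/\ measurable E, (P E <= (e / (4 * (B + 1)))%:E)%E &
    forall w, ~ E w -> `|X N w - Y N w| <= e / 2].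
  by near: N.
apply: (le_trans (mean_near _ _ (XB N) (YB N) mE PE (ltW e2) q)).
- by near: N.
- by near: N.
rewrite [leRHS](splitr e) lerD2l.
have B1 : 0 < B + 1 by rewrite ltr_wpDl.
have -> : 2 * B * (e / (4 * (B + 1))) = e / 2 * (B / (B + 1)).
  by field; rewrite gt_eqF.
by apply: ler_piMr; [exact: ltW|rewrite ler_pdivrMr// mul1r lerDl].
Unshelve. all: by end_near. Qed.

End expectation.

(** * Random matrices: entrywise norm, measurability, convergence in law *)

Section matrix_norm.
Context (R : realType) (m n : nat).
Implicit Types A : 'M[R]_(m, n).

Lemma mx_entry_le A i j : `|A i j| <= `|A|.
Proof.
rewrite [leRHS]/Num.norm/= mx_normrE.
exact: (le_bigmax_cond 0 (fun ij : 'I_m * 'I_n => `|A ij.1 ij.2|) (j := (i, j))).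
Qed.

Lemma mx_norm_le A K : 0 <= K -> (forall i j, `|A i j| <= K) -> `|A| <= K.
Proof.
move=> K0 AK; rewrite [leLHS]/Num.norm/= mx_normrE.
by apply/bigmax_leP; split.
Qed.

End matrix_norm.

Section random_matrix.
Context (d : measure_display) (O : measurableType d) (R : realType) (m n : nat).
Implicit Types Y : O -> 'M[R]_(m, n).

Lemma measurable_fun_countable (U : countType) (h : O -> U) (F : U -> R) :
  (forall u, measurable (h @^-1` [set u])) -> measurable_fun setT (F \o h).
Proof.
move=> mh _ B mB; rewrite setTI.
rewrite (_ : _ @^-1` B =
  \bigcup_u (if F u \in B then h @^-1` [set u] else set0)); last first.
  apply/seteqP; split=> [w Bw|w [u _]].
    by exists (h w) => //; rewrite mem_set.
  by case: ifPn => // /set_mem Fu /= ->.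
apply: countable_bigcupT_measurable; first exact: countableP.
by move=> u; case: ifP.
Qed.

(** Rounding each entry of [Y] down to a multiple of 1/(k+1) leaves countably many values, so [f] of
    the rounded matrix is measurable; by continuity it converges pointwise to [f \o Y]. *)
Lemma measurable_comp_continuous Y (f : 'M[R]_(m, n) -> R) :
  random_mx Y -> continuous f -> measurable_fun setT (f \o Y).
Proof.
move=> mY cf.
pose fl (k : nat) w : 'M[int]_(m, n) := \matrix_(i, j) Num.floor (k.+1%:R * Y w i j).
pose F (k : nat) (z : 'M[int]_(m, n)) := f (\matrix_(i, j) ((z i j)%:~R / k.+1%:R)).
apply: (@measurable_fun_cvg _ _ _ _ (fun k => F k \o fl k)).
  move=> k; apply: measurable_fun_countable => z.
  rewrite (_ : _ @^-1` _ = \bigcap_ij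
     ((fun w => k.+1%:R * Y w ij.1 ij.2) @^-1` `[(z ij.1 ij.2)%:~R, (z ij.1 ij.2 + 1)%:~R[)).
    apply: fin_bigcap_measurable; first exact: finite_finset.
    move=> [i j] _ /=; rewrite -[X in measurable X]setTI.
    have : measurable_fun setT (fun w => k.+1%:R * Y w i j).
      by apply: measurable_funM; [exact: measurable_cst|exact: mY].
    by apply.
  apply/seteqP; split=> [w /= zw [i j] _ /=|w /= zw].
    by rewrite in_itv/= -zw mxE floor_itv.
  apply/matrixP => i j; rewrite mxE; apply/eqP; rewrite floor_eq.
  by have := zw (i, j) Logic.I; rewrite /= in_itv.
move=> w _ /=.
rewrite /F; apply: continuous_cvg; first exact: cf.
apply/cvgrPdist_le => e e0.
near=> k; apply: mx_norm_le; first exact: ltW.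
move=> i j; rewrite !mxE.
set x := Y w i j; have k0 : 0 < k.+1%:R :> R by [].
have /andP[f1 f2] := floor_itv (k.+1%:R * x).
have -> : x - (Num.floor (k.+1%:R * x))%:~R / k.+1%:R =
   (k.+1%:R * x - (Num.floor (k.+1%:R * x))%:~R) / k.+1%:R.
  by field; rewrite addrC natr1 gt_eqF.
rewrite normrM [`|_^-1|]ger0_norm ?invr_ge0// ler_pdivrMr//.
rewrite ger0_norm ?subr_ge0//.
apply: (@le_trans _ _ 1).
  by move: f2; rewrite intrD mulr1z; lra.
rewrite -ler_pdivrMl// mulr1 -[leRHS]invrK lef_pV2 ?posrE ?invr_gt0//; apply: ltW; near: k.
exact: (near_infty_natSinv_lt (PosNum e0)).
Unshelve. all: by end_near. Qed.

End random_matrix.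

Section convergence_in_law.
Context (d d' : measure_display) (O : measurableType d) (O' : measurableType d')
  (R : realType) (P : probability O R) (P' : probability O' R).
Context (V : topologicalType) (Z : nat -> O -> V) (Y : O' -> V).

Lemma mean_EFin (e : measure_display) (U : measurableType e)
  (Q : probability U R) (X : U -> R) B :
  measurable_fun setT X -> (forall w, `|X w| <= B) ->
  ('E_Q[X] = (\int[Q]_w X w)%:E)%E.
Proof.
move=> mX XB; rewrite unlock /Rintegral fineK//.
by apply: integrable_fin_num => //; exact: bounded_integrable XB.
Qed.

(** Bounded test functions have finite means, so the convergence of extended expectations is one of
    real integrals. Measurability for large [N] is enough, as only the limit is concerned. *)
Lemma cvg_in_lawP :
  (forall f : V -> R, continuous f ->
     \forall N \near \oo, measurable_fun setT (f \o Z N)) ->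
  (forall f : V -> R, continuous f -> measurable_fun setT (f \o Y)) ->
  cvg_in_law P P' Z Y <->
  (forall (f : V -> R) B, continuous f -> (forall x, `|f x| <= B) ->
     \int[P]_w f (Z N w) @[N --> \oo] --> \int[P']_w f (Y w)).
Proof.
move=> mZ mY; split=> [ZY f B cf fB|ZY f cf [B fB]].
  have := ZY f cf (ex_intro _ B fB).
  rewrite (@mean_EFin _ _ P' (f \o Y) B); [|exact: mY|by move=> w; exact: fB].
  by move=> /fine_cvg; rewrite unlock.
have := ZY f B cf fB.
rewrite (@mean_EFin _ _ P' (f \o Y) B); [|exact: mY|by move=> w; exact: fB].
move=> H; have mfZ := mZ f cf.
have EZ : \forall N \near \oo, ('E_P[f \o Z N] = (\int[P]_w f (Z N w))%:E)%E.
  near=> N; rewrite (@mean_EFin _ _ P (f \o Z N) B)//.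
    by near: N.
  by move=> w; exact: fB.
apply: cvg_EFin; first by near=> N; rewrite (near EZ N).
by apply: cvg_trans H; apply: near_eq_cvg; near=> N; rewrite /= (near EZ N).
Unshelve. all: by end_near. Qed.

End convergence_in_law.

(** * Product measures and trigonometric bounds *)

Section product_expectation.
Context (R : realType) (I T : finType) (p : I -> T -> R).
Hypothesis p_ge0 : forall i t, 0 <= p i t.
Hypothesis p_sum1 : forall i, \sum_t p i t = 1.
Implicit Types (G : {ffun I -> T} -> R) (y : {ffun I -> T}).

(** Expectation under the product of the laws [p i]. It serves twice: for the next states of the
    particles given the history, and for the Bernoulli variables behind Bernstein polynomials. *)
Definition prodE G : R := \sum_(y : {ffun I -> T}) (\prod_i p i (y i)) * G y.

Definition upd y i t : {ffun I -> T} := [ffun j => if j == i then t else y j].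

Lemma eq_prodE G1 G2 : G1 =1 G2 -> prodE G1 = prodE G2.
Proof. by move=> G12; apply: eq_bigr => y _; rewrite G12. Qed.

Lemma prodE_cst (a : R) : prodE (fun=> a) = a.
Proof.
rewrite /prodE -big_distrl/= -(bigA_distr_bigA p) big1 ?mul1r//.
Qed.

Lemma prodED G1 G2 : prodE (fun y => G1 y + G2 y) = prodE G1 + prodE G2.
Proof. by rewrite /prodE -big_split; apply: eq_bigr => y _; rewrite mulrDr. Qed.

Lemma prodEZ (a : R) G : prodE (fun y => a * G y) = a * prodE G.
Proof. by rewrite /prodE big_distrr; apply: eq_bigr => y _; rewrite /= mulrCA. Qed.

Lemma prodE_sum (J : Type) (r : seq J) (G : J -> {ffun I -> T} -> R) :
  prodE (fun y => \sum_(j <- r) G j y) = \sum_(j <- r) prodE (G j).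
Proof.
elim: r => [|j r IH]; first by under eq_prodE do rewrite big_nil; rewrite prodE_cst big_nil.
by under eq_prodE do rewrite big_cons; rewrite prodED IH big_cons.
Qed.

Lemma weight_ge0 y : 0 <= \prod_i p i (y i).
Proof. by apply: prodr_ge0 => i _; exact: p_ge0. Qed.

Lemma le_prodE G1 G2 : (forall y, G1 y <= G2 y) -> prodE G1 <= prodE G2.
Proof.
by move=> G12; apply: ler_sum => y _; rewrite ler_wpM2l ?weight_ge0.
Qed.

Lemma normr_prodE G : `|prodE G| <= prodE (fun y => `|G y|).
Proof.
apply: (le_trans (ler_norm_sum _ _ _)); apply: ler_sum => y _.
by rewrite normrM ger0_norm ?weight_ge0.
Qed.

(** Fubini for coordinate [i]: since [G t] ignores that coordinate, the value [y i] can be replaced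
    by an independent copy. *)
Lemma prodE_indep i (G : T -> {ffun I -> T} -> R) :
  (forall t y t', G t (upd y i t') = G t y) ->
  prodE (fun y => G (y i) y) = \sum_t p i t * prodE (G t).
Proof.
move=> Gi.
pose w y := \prod_(j | j != i) p j (y j).
have wE y : \prod_j p j (y j) = p i (y i) * w y by rewrite (bigD1 i).
have w_upd y t : w (upd y i t) = w y.
  by apply: eq_bigr => j ji; rewrite ffunE (negbTE ji).
transitivity (\sum_(y : {ffun I -> T}) \sum_t p i t * (p i (y i) * w y * G (y i) y)).
  by apply: eq_bigr => y _; rewrite -big_distrl/= p_sum1 mul1r wE.
transitivity (\sum_(ty : T * {ffun I -> T})
    p i ty.1 * (p i (ty.2 i) * w ty.2 * G (ty.2 i) ty.2)).
  by rewrite exchange_big pair_bigA.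
(* Exchanging the coordinate [i] with its independent copy is an involution preserving the total
   weight. *)
pose sw (ty : T * {ffun I -> T}) := (ty.2 i, upd ty.2 i ty.1).
have swK : involutive sw.
  move=> [t y]; rewrite /sw/= ffunE eqxx; congr (_, _).
  by apply/ffunP => j; rewrite !ffunE; case: eqP => [->|].
rewrite (reindex_inj (inv_inj swK))/=.
under [RHS]eq_bigr do rewrite /prodE big_distrr/=.
rewrite [RHS]pair_bigA/=; apply: eq_bigr => -[t y] _ /=.
by rewrite ffunE eqxx w_upd Gi wE; ring.
Qed.

Lemma sum_upd (v : I -> T -> R) r y i t : i \notin r ->
  \sum_(j <- r) v j (upd y i t j) = \sum_(j <- r) v j (y j).
Proof.
move=> ir; apply: eq_big_seq => j jr; rewrite ffunE; case: eqP => // ji.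
by rewrite ji (negbTE ir) in jr.
Qed.

Variable v : I -> T -> R.
Hypothesis v_mean0 : forall i, \sum_t p i t * v i t = 0.
Local Notation var i := (\sum_t p i t * v i t ^+ 2).

(** The offset [s] absorbs the coordinates already integrated out, which makes the induction go
    through; cross terms vanish because the summands are centred. *)
Lemma prodE_sqr_seq r s : uniq r ->
  prodE (fun y => (s + \sum_(i <- r) v i (y i)) ^+ 2) =
  s ^+ 2 + \sum_(i <- r) var i.
Proof.
elim: r s => [|i r IH] s /=.
  by move=> _; under eq_prodE do rewrite big_nil; rewrite prodE_cst big_nil !addr0.
move=> /andP[ir ur].
under eq_prodE do rewrite big_cons addrA.
rewrite (prodE_indep (G := fun t y => (s + v i t + \sum_(j <- r) v j (y j)) ^+ 2)).
  under [LHS]eq_bigr do rewrite IH// sqrrD.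
  rewrite (eq_bigr (fun t => (s ^+ 2 + \sum_(i <- r) var i) * p i t +
     (s *+ 2 * (p i t * v i t) + p i t * v i t ^+ 2))); last by move=> t _; ring.
  rewrite big_split/= big_split/= -!big_distrr/= p_sum1 v_mean0 big_cons; ring.
by move=> t y t'; rewrite sum_upd.
Qed.

Lemma prodE_sqr s :
  prodE (fun y => (s + \sum_i v i (y i)) ^+ 2) = s ^+ 2 + \sum_i var i.
Proof. exact: prodE_sqr_seq (index_enum_uniq I). Qed.

End product_expectation.

Section trig_bounds.
Context (R : realType).
Implicit Types u s b : R.

Lemma normr_sin_le u : `|sin u| <= 1.
Proof. by rewrite ler_norml sin_geN1 sin_le1. Qed.

Lemma normr_cos_le u : `|cos u| <= 1.
Proof. by rewrite ler_norml cos_geN1 cos_le1. Qed.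

(** Applied repeatedly, it gives the Taylor remainders of sin and cos: the derivative of each
    remainder is the previous one. The constants obtained are 1 instead of inverse factorials, which
    is all that is needed. *)
Lemma MVT0_bound (f f' : R -> R) u (K : R) :
  (forall x : R, is_derive x 1 f (f' x)) -> f 0 = 0 ->
  (forall x, `|x| <= `|u| -> `|f' x| <= K) -> `|f u| <= K * `|u|.
Proof.
move=> df f0 f'K.
have cf x : {for x, continuous f}.
  by apply/differentiable_continuous/derivable1_diffP; case: (df x).
have [u0|u0|->] := ltgtP u 0; last by rewrite f0 !normr0 mulr0.
- have [|c cu] := @MVT _ f f' u 0 u0 (fun x _ => df x).
    by apply: continuous_subspaceT => x; exact: cf.
  rewrite f0 !sub0r => fE; rewrite -normrN fE normrM normrN ler_wpM2r//.
  move: cu; rewrite in_itv/= => /andP[c1 c2]; apply: f'K.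
  by rewrite !ltr0_norm// lerN2 ltW.
- have [|c cu] := @MVT _ f f' 0 u u0 (fun x _ => df x).
    by apply: continuous_subspaceT => x; exact: cf.
  rewrite f0 !subr0 => fE; rewrite fE normrM ler_wpM2r//.
  move: cu; rewrite in_itv/= => /andP[c1 c2]; apply: f'K.
  by rewrite !gtr0_norm// ltW.
Qed.

Lemma normr_sin_le_id u : `|sin u| <= `|u|.
Proof.
have := @MVT0_bound sin cos u 1 _ (@sin0 R) (fun x _ => normr_cos_le x).
by rewrite mul1r; apply=> x; exact: is_derive_sin.
Qed.

Lemma normr_cosB u s : `|cos u - cos s| <= `|u - s|.
Proof.
pose f x : R := cos (x + s) - cos s.
have := @MVT0_bound f (fun x => - sin (x + s)) (u - s) 1.
rewrite /f subrK mul1r; apply.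
- move=> x; apply: is_derive_eq; rewrite /GRing.scale/=; ring.
- by rewrite add0r subrr.
- by move=> x _; rewrite normrN normr_sin_le.
Qed.

Lemma cosB1_bound u : `|cos u - 1| <= `|u| ^+ 2.
Proof.
rewrite expr2; apply: (@MVT0_bound (fun x => cos x - 1) (fun x => - sin x)).
- move=> x; apply: is_derive_eq; rewrite /GRing.scale/=; ring.
- by rewrite cos0 subrr.
- by move=> x xu; rewrite normrN (le_trans (normr_sin_le_id x)).
Qed.

Lemma sinB_bound u : `|sin u - u| <= `|u| ^+ 3.
Proof.
rewrite exprSr; apply: (@MVT0_bound (fun x => sin x - x) (fun x => cos x - 1)).
- by rewrite sin0 subrr.
- by move=> x xu; rewrite (le_trans (cosB1_bound x))// lerXn2r ?nnegrE.
Qed.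

Lemma cosB2_bound u : `|cos u - 1 + u ^+ 2 / 2| <= `|u| ^+ 4.
Proof.
rewrite [leRHS]exprSr.
apply: (@MVT0_bound (fun x => cos x - 1 + x ^+ 2 / 2) (fun x => x - sin x)).
- move=> x; apply: is_derive_eq; rewrite /GRing.scale/=; by field.
- by rewrite cos0 subrr expr0n/= mul0r addr0.
- by move=> x xu; rewrite distrC (le_trans (sinB_bound x))// lerXn2r ?nnegrE.
Qed.

(** Both sides come from [1 + x <= expR x], taken at [- u] and, after inversion, at [u]. *)
Lemma expRN_bound u : 0 <= u -> `|expR (- u) - (1 - u)| <= u ^+ 2.
Proof.
move=> u0; have h1 := expR_ge1Dx (- u); have h2 := expR_ge1Dx u.
rewrite ger0_norm; last by lra.
have e0 : 0 < 1 + u by lra.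
have : expR (- u) <= (1 + u)^-1.
  by rewrite expRN lef_pV2// posrE ?expR_gt0.
suff : (1 + u)^-1 <= 1 - u + u ^+ 2 by lra.
rewrite -[leLHS]mul1r ler_pdivrMr//.
have -> : (1 - u + u ^+ 2) * (1 + u) = 1 + u ^+ 3 by ring.
by rewrite lerDl exprn_ge0.
Qed.

(** The addition formula leaves a fourth-order error from cos and a third-order error from sin;
    [b <= 1] lets the former count as third order. *)
Lemma cos_taylor_bound s u b : `|u| <= b -> b <= 1 ->
  `|cos (s + u) - (cos s * (1 - u ^+ 2 / 2) - sin s * u)| <= 2 * b ^+ 3.
Proof.
move=> ub b1; have b0 : 0 <= b by exact: le_trans ub.
rewrite cosD.
have -> : cos s * cos u - sin s * sin u - (cos s * (1 - u ^+ 2 / 2) - sin s * u) =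
  cos s * (cos u - 1 + u ^+ 2 / 2) - sin s * (sin u - u) by ring.
apply: (le_trans (ler_normB _ _)); rewrite !normrM mulr_natl mulr2n.
have u3 : `|u| ^+ 3 <= b ^+ 3 by rewrite lerXn2r// nnegrE.
apply: lerD; rewrite -[leRHS]mul1r; apply: ler_pM => //.
- exact: normr_cos_le.
- apply: (le_trans (cosB2_bound u)); rewrite exprS.
  apply: le_trans u3; rewrite ler_piMl ?exprn_ge0//; exact: le_trans b1.
- exact: normr_sin_le.
- exact: le_trans (sinB_bound u) u3.
Qed.

End trig_bounds.

Section product_cos.
Context (R : realType) (I T : finType) (p : I -> T -> R).
Hypothesis p_ge0 : forall i t, 0 <= p i t.
Hypothesis p_sum1 : forall i, \sum_t p i t = 1.
Context (v : I -> T -> R) (b : R).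
Hypothesis v_mean0 : forall i, \sum_t p i t * v i t = 0.
Hypothesis v_le : forall i t, `|v i t| <= b.
Hypothesis b_le1 : b <= 1.
Local Notation var i := (\sum_t p i t * v i t ^+ 2).

Lemma var_ge0 i : 0 <= var i.
Proof. by apply: sumr_ge0 => t _; rewrite mulr_ge0 ?sqr_ge0. Qed.

Lemma var_le i : 0 <= b -> var i <= b ^+ 2.
Proof.
move=> b0; rewrite -[leRHS]mul1r -[X in _ <= X * _](p_sum1 i) mulr_suml; apply: ler_sum => t _.
by rewrite ler_wpM2l// -real_normK ?num_real// lerXn2r ?nnegrE.
Qed.

(** Replacement of one summand by a centred normal variable of equal variance: both agree up to
    second order. The third-order error of cos contributes 2, the expansion of the exponential 1. *)
Lemma cos_step_bound i s : 0 <= b ->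
  `|\sum_t p i t * cos (s + v i t) - cos s * expR (- (var i / 2))| <= 3 * b ^+ 3.
Proof.
move=> b0.
have h1 : `|\sum_t p i t * cos (s + v i t) - cos s * (1 - var i / 2)| <= 2 * b ^+ 3.
  have -> : cos s * (1 - var i / 2) =
      \sum_t p i t * (cos s * (1 - v i t ^+ 2 / 2) - sin s * v i t).
    rewrite [RHS](eq_bigr (fun t => cos s * p i t - (cos s / 2 * (p i t * v i t ^+ 2)
      + sin s * (p i t * v i t)))); last by move=> t _; field.
    rewrite sumrB big_split/= -!big_distrr/= p_sum1 v_mean0; by field.
  rewrite -sumrB; apply: (le_trans (ler_norm_sum _ _ _)).
  rewrite -[leRHS]mul1r -[X in _ <= X * _](p_sum1 i) mulr_suml; apply: ler_sum => t _.
  by rewrite -mulrBr normrM ger0_norm// ler_wpM2l// cos_taylor_bound.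
have v0 := var_ge0 i; have v1 := var_le i b0.
have h2 : `|cos s * (1 - var i / 2) - cos s * expR (- (var i / 2))| <= b ^+ 3.
  rewrite -mulrBr normrM -[leRHS]mul1r; apply: ler_pM => //; first exact: normr_cos_le.
  rewrite distrC; apply: (le_trans (expRN_bound _)); first by rewrite divr_ge0.
  have b3 : 0 <= b ^+ 3 by rewrite exprn_ge0.
  apply: (@le_trans _ _ ((b ^+ 2) ^+ 2)).
    by rewrite lerXn2r ?nnegrE ?exprn_ge0 ?divr_ge0//; lra.
  have -> : (b ^+ 2) ^+ 2 = b * b ^+ 3 by ring.
  by rewrite ler_piMl.
by apply: (le_trans (ler_distD (cos s * (1 - var i / 2)) _ _)); lra.
Qed.

(** One summand at a time is replaced by its Gaussian factor. The factors are at most 1, so the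
    errors add up without amplification. With N summands of size O(1 / sqrt N) the total is O(1 /
    sqrt N). *)
Lemma prodE_cos_seq r s : 0 <= b -> uniq r ->
  `|prodE p (fun y => cos (s + \sum_(i <- r) v i (y i))) -
    cos s * expR (- (\sum_(i <- r) var i) / 2)| <= (size r)%:R * (3 * b ^+ 3).
Proof.
move=> b0; elim: r s => [|i r IH] s /=.
  move=> _; under eq_prodE do rewrite big_nil.
  by rewrite prodE_cst// big_nil oppr0 mul0r expR0 mulr1 addr0 subrr normr0 mul0r.
move=> /andP[ir ur].
under eq_prodE do rewrite big_cons addrA.
rewrite (prodE_indep p_sum1 (G := fun t y => cos (s + v i t + \sum_(j <- r) v j (y j)))).
  set q := \sum_(j <- r) var j.
  have q0 : 0 <= q by apply: sumr_ge0 => j _; exact: var_ge0.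
  rewrite big_cons -/q.
  have -> : - (var i + q) / 2 = - (var i / 2) + - q / 2 by field.
  rewrite expRD mulrA.
  have -> : (size r).+1%:R * (3 * b ^+ 3) =
    (size r)%:R * (3 * b ^+ 3) + 3 * b ^+ 3 by rewrite -natr1; ring.
  apply: (le_trans (ler_distD (\sum_t p i t * (cos (s + v i t) * expR (- q / 2))) _ _)).
  apply: lerD.
    rewrite -sumrB; apply: (le_trans (ler_norm_sum _ _ _)).
    rewrite -[leRHS]mul1r -[X in _ <= X * _](p_sum1 i) mulr_suml; apply: ler_sum => t _.
    by rewrite -mulrBr normrM ger0_norm// ler_wpM2l// IH.
  have -> : \sum_t p i t * (cos (s + v i t) * expR (- q / 2)) =
     (\sum_t p i t * cos (s + v i t)) * expR (- q / 2).
    by rewrite mulr_suml; apply: eq_bigr => t _; rewrite mulrA.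
  rewrite -mulrBl normrM -[leRHS]mulr1; apply: ler_pM => //.
    exact: cos_step_bound.
  by rewrite ger0_norm ?expR_ge0// -[leRHS]expR0 ler_expR; lra.
by move=> t y t'; rewrite sum_upd.
Qed.

Lemma prodE_cos s : 0 <= b ->
  `|prodE p (fun y => cos (s + \sum_i v i (y i))) -
    cos s * expR (- (\sum_i var i) / 2)| <= #|I|%:R * (3 * b ^+ 3).
Proof.
move=> b0; have := prodE_cos_seq s b0 (index_enum_uniq I).
by rewrite /index_enum -enumT -cardE.
Qed.

End product_cos.

(** * Trigonometric approximation and Levy continuity *)

Lemma near_norm_lt (R : realType) (V : normedModType R) (x : V) (e : R) :
  0 < e -> \forall y \near x, `|x - y| < e.
Proof.
move=> e0; apply/nbhs_ballP; exists e => // y.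
by rewrite -ball_normE.
Qed.

Lemma cvg_finsum (R : realType) (V : normedModType R) (J T : Type) (r : seq J)
  (F : set_system T) (FF : Filter F) (h : J -> T -> V) (l : J -> V) :
  (forall j, h j x @[x --> F] --> l j) ->
  \sum_(j <- r) h j x @[x --> F] --> \sum_(j <- r) l j.
Proof.
move=> hl; elim: r => [|j r IH].
  by rewrite big_nil; under eq_cvg do rewrite big_nil; exact: cvg_cst.
by rewrite big_cons; under eq_cvg do rewrite big_cons; exact: cvgD.
Qed.

Lemma continuous_finsum (R : realType) (U : topologicalType)
  (V : normedModType R) (J : Type) (r : seq J) (h : J -> U -> V) :
  (forall j, continuous (h j)) -> continuous (fun x => \sum_(j <- r) h j x).
Proof. by move=> ch x; apply: cvg_finsum => j; exact: ch. Qed.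

Lemma continuousM_fun (R : realType) (U : topologicalType) (f g : U -> R) :
  continuous f -> continuous g -> continuous (fun x => f x * g x).
Proof. by move=> cf cg x; apply: cvgM; [exact: cf|exact: cg]. Qed.

Lemma continuousD_fun (R : realType) (U : topologicalType) (V : normedModType R)
  (f g : U -> V) :
  continuous f -> continuous g -> continuous (fun x => f x + g x).
Proof. by move=> cf cg x; apply: cvgD; [exact: cf|exact: cg]. Qed.

Section matrix_topology.
Context (R : realType) (m n : nat).

Lemma vec_mx_continuous : continuous (@vec_mx R m n).
Proof.
move=> v; apply/(@cvgrPdist_le _ _ _ (nbhs v)) => e e0; near=> u.
apply: mx_norm_le => [|i j]; first exact: ltW.
rewrite !mxE -[u 0 _]opprK.
have := mx_entry_le (v - u) 0 (mxvec_index i j); rewrite !mxE opprK => /le_trans; apply.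
apply: ltW; near: u; exact: (@near_norm_lt R 'rV[R]_(m * n) v e e0).
Unshelve. all: by end_near. Qed.

Lemma continuous_matrix (U : topologicalType) (h : U -> 'M[R]_(m, n)) :
  (forall i j, continuous (fun x => h x i j)) -> continuous h.
Proof.
move=> ch x; apply/(@cvgrPdist_le _ _ _ (nbhs x)) => e e0.
have H : \forall y \near x, forall ij : 'I_m * 'I_n,
    `|h x ij.1 ij.2 - h y ij.1 ij.2| <= e.
  apply: filter_forall => -[i j] /=.
  by have /cvgrPdist_le/(_ _ e0) := ch i j x.
near=> y; apply: mx_norm_le => [|i j]; first exact: ltW.
rewrite !mxE; have : forall ij : 'I_m * 'I_n, `|h x ij.1 ij.2 - h y ij.1 ij.2| <= e by near: y.
by move=> /(_ (i, j)).
Unshelve. all: by end_near. Qed.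

(** Heine's argument by compactness of the box of radius [K]. Only [x] is confined to the box: [y]
    may lie outside, which spares a bound on the second variable in applications. *)
Lemma unif_continuous_bounded (f : 'M[R]_(m, n) -> R) (K e : R) :
  continuous f -> 0 < e ->
  exists2 delta, 0 < delta &
    forall x y, `|x| <= K -> `|x - y| <= delta -> `|f x - f y| <= e.
Proof.
move=> cf e0.
pose A := [set v : 'rV[R]_(m * n) | forall i, `[(- K), K]%classic (v ord0 i)].
have cA : compact A.
  by apply: (@rV_compact _ _ (fun=> `[(- K), K]%classic)) => _; exact: segment_compact.
have cvA : compact [set vec_mx v | v in A].
  apply: continuous_compact => //; apply: continuous_subspaceT.
  exact: vec_mx_continuous.
have [|delta /= d0 H] := (compact_near_coveringP _).1 cvA R 0^'+
  (fun delta x => forall y, `|x - y| <= delta -> `|f x - f y| <= e) _ _.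
  move=> x _.
  have e2 : 0 < e / 2 by rewrite divr_gt0.
  have /cvgrPdist_le/(_ _ e2)/nbhs_ballP[r /= r0 rf] := cf x.
  near=> z delta => /= y zy.
  have xz : `|x - z| < r / 2.
    by near: z; apply: (@near_norm_lt R 'M[R]_(m, n) x); rewrite divr_gt0.
  have dr : delta < r / 2 by near: delta; apply: nbhs_right_lt; rewrite divr_gt0.
  have h1 : `|f x - f z| <= e / 2.
    by apply: rf; rewrite -ball_normE /ball_/= (lt_trans xz)// ltr_pdivrMr// ltr_pMr// ltr1n.
  have h2 : `|f x - f y| <= e / 2.
    apply: rf; rewrite -ball_normE /ball_/= [r]splitr.
    by rewrite (le_lt_trans (ler_distD z _ _))// ltrD// (le_lt_trans zy).
  rewrite (le_trans (ler_distD (f x) _ _))// [e]splitr lerD//.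
  by rewrite distrC.
exists (delta / 2); first by rewrite divr_gt0.
move=> x y xK xy; have d2 : 0 < delta / 2 by rewrite divr_gt0.
have bd : `|0 - delta / 2| < delta.
  by rewrite sub0r normrN gtr0_norm// ltr_pdivrMr// ltr_pMr// ltr1n.
have Ax : [set vec_mx v | v in A] x.
  exists (mxvec x); last exact: mxvecK.
  move=> k /=; case/mxvec_indexP: k => i j; rewrite mxvecE in_itv/= -ler_norml.
  exact: le_trans (mx_entry_le x i j) xK.
exact: (H (delta / 2) bd d2 x Ax y xy).
Unshelve. all: by end_near. Qed.

End matrix_topology.

Section pairing.
Context (R : realType) (m n : nat).
Implicit Types U V x : 'M[R]_(m, n).

(** The Frobenius inner product, in the very form of the linear forms of [gaussian_mx]. *)
Definition pairing U x : R := \sum_i \sum_j U i j * x i j.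

Lemma pairingDl U V x : pairing (U + V) x = pairing U x + pairing V x.
Proof.
rewrite -big_split; apply: eq_bigr => i _; rewrite -big_split; apply: eq_bigr => j _.
by rewrite mxE mulrDl.
Qed.

Lemma pairingZl (a : R) U x : pairing (a *: U) x = a * pairing U x.
Proof.
rewrite big_distrr; apply: eq_bigr => i _; rewrite /= big_distrr; apply: eq_bigr => j _.
by rewrite /= mxE mulrA.
Qed.

Lemma pairingBl U V x : pairing (U - V) x = pairing U x - pairing V x.
Proof. by rewrite pairingDl -scaleN1r pairingZl mulN1r. Qed.

Lemma pairing0l x : pairing 0 x = 0.
Proof. by apply: big1 => i _; apply: big1 => j _; rewrite mxE mul0r. Qed.

Lemma pairingC U x : pairing U x = pairing x U.
Proof. by apply: eq_bigr => i _; apply: eq_bigr => j _; rewrite mulrC. Qed.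

Lemma pairing_delta i j x : pairing (delta_mx i j) x = x i j.
Proof.
rewrite /pairing (bigD1 i)//= (bigD1 j)//= mxE !eqxx mul1r.
rewrite big1 ?addr0 => [|j' jj']; last by rewrite mxE (negbTE jj') andbF mul0r.
rewrite big1 ?addr0// => i' ii'; apply: big1 => j' _.
by rewrite mxE (negbTE ii') mul0r.
Qed.

Lemma pairing_continuous U : continuous (pairing U).
Proof.
apply: continuous_finsum => i; apply: continuous_finsum => j.
apply: continuousM_fun; [exact: cst_continuous|exact: coord_continuous].
Qed.

End pairing.

Section trig_polynomials.
Context (R : realType) (m n : nat).
Implicit Types (f g h : 'M[R]_(m, n) -> R) (U V : 'M[R]_(m, n)).

(** The phase [s] makes sines available, so cosines generate everything. Only linear operations are
    constructors: convergence of means passes through them, and products are recovered in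
    [trig_mul]. *)
Inductive trig_poly : ('M[R]_(m, n) -> R) -> Prop :=
| trig_cos s U : trig_poly (fun x => cos (s + pairing U x))
| trig_add f g : trig_poly f -> trig_poly g -> trig_poly (fun x => f x + g x)
| trig_scale a f : trig_poly f -> trig_poly (fun x => a * f x).

(** The product-to-sum formula: cos a cos b is the half-sum of cos (a + b) and cos (a - b). *)
Lemma trig_mul f g : trig_poly f -> trig_poly g -> trig_poly (fun x => f x * g x).
Proof.
move=> tf; elim: tf g => [s U|f1 f2 _ IH1 _ IH2|a f1 _ IH1] g tg.
- elim: tg => [s' V|g1 g2 _ IH1 _ IH2|a g1 _ IH1].
  + have := trig_scale 2^-1 (trig_add (trig_cos (s + s') (U + V))
      (trig_cos (s - s') (U - V))).
    congr trig_poly; apply/funext => x; rewrite pairingDl pairingBl.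
    have -> : s + s' + (pairing U x + pairing V x) = (s + pairing U x) + (s' + pairing V x) by ring.
    have -> : s - s' + (pairing U x - pairing V x) = (s + pairing U x) - (s' + pairing V x) by ring.
    rewrite cosD cosB; by field.
  + by have := trig_add IH1 IH2; congr trig_poly; apply/funext => x; rewrite mulrDr.
  + by have := trig_scale a IH1; congr trig_poly; apply/funext => x; rewrite mulrCA.
- by have := trig_add (IH1 _ tg) (IH2 _ tg); congr trig_poly; apply/funext => x; rewrite mulrDl.
- by have := trig_scale a (IH1 _ tg); congr trig_poly; apply/funext => x; rewrite mulrA.
Qed.

Lemma trig_cst (a : R) : trig_poly (fun=> a).
Proof.
have := trig_scale a (trig_cos 0 0); congr trig_poly; apply/funext => x.
by rewrite pairing0l addr0 cos0 mulr1.
Qed.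

Lemma trig_sum (J : Type) (r : seq J) (F : J -> 'M[R]_(m, n) -> R) :
  (forall j, trig_poly (F j)) -> trig_poly (fun x => \sum_(j <- r) F j x).
Proof.
move=> tF; elim: r => [|j r IH].
  by have := trig_cst 0; congr trig_poly; apply/funext => x; rewrite big_nil.
have := trig_add (tF j) IH; congr trig_poly.
by apply/funext => x; rewrite big_cons.
Qed.

Lemma trig_prod (J : Type) (r : seq J) (F : J -> 'M[R]_(m, n) -> R) :
  (forall j, trig_poly (F j)) -> trig_poly (fun x => \prod_(j <- r) F j x).
Proof.
move=> tF; elim: r => [|j r IH].
  by have := trig_cst 1; congr trig_poly; apply/funext => x; rewrite big_nil.
have := trig_mul (tF j) IH; congr trig_poly.
by apply/funext => x; rewrite big_cons.
Qed.

Lemma trig_sin_coord i j (L : R) : trig_poly (fun x => sin (x i j / L)).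
Proof.
have := trig_cos (- (pi / 2)) (L^-1 *: delta_mx i j).
congr trig_poly; apply/funext => x.
by rewrite pairingZl pairing_delta [L^-1 * _]mulrC addrC cosBpihalf.
Qed.

Lemma trig_poly_continuous f : trig_poly f -> continuous f.
Proof.
elim=> [s U|f1 f2 _ IH1 _ IH2|a f1 _ IH1].
- move=> x; apply: (continuous_comp (f := fun x => s + pairing U x));
    last exact: continuous_cos.
  apply: (continuousD_fun (f := cst s)); first exact: cst_continuous.
  exact: pairing_continuous.
- exact: continuousD_fun.
- by apply: continuousM_fun => //; exact: cst_continuous.
Qed.

Lemma trig_poly_bounded f : trig_poly f -> exists B, forall x, `|f x| <= B.
Proof.
elim=> [s U|f1 f2 _ [B1 IH1] _ [B2 IH2]|a f1 _ [B IH]].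
- by exists 1 => x; exact: normr_cos_le.
- by exists (B1 + B2) => x; rewrite (le_trans (ler_normD _ _))// lerD.
- by exists (`|a| * B) => x; rewrite normrM ler_wpM2l.
Qed.

End trig_polynomials.

Section clamped_asin.
Context (R : realType).
Implicit Types v y : R.

Let c : R := sin (1 / 2).

(** The projection onto [-c, c] with c = sin (1/2) < 1. It keeps the argument of [asin] inside the
    open interval where [asin] is continuous, and fixes sin y for |y| <= 1/2. *)
Definition clamp v := (`|v + c| - `|v - c|) / 2.

Lemma clamp_id v : `|v| <= c -> clamp v = v.
Proof.
rewrite ler_norml => /andP[v1 v2]; rewrite /clamp ger0_norm ?ler0_norm; lra.
Qed.

Lemma sin_half_ge0 : 0 <= c.
Proof. by apply: sin_ge0_pi; have := @pi_ge2 R; lra. Qed.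

Lemma sin_half_lt1 : c < 1.
Proof.
rewrite lt_neqAle sin_le1 andbT; apply/eqP => c1.
have := @sin_inj R (1 / 2) (pi / 2).
rewrite sin_pihalf => /(_ _ _ c1); rewrite !in_itv/= => H.
have := @pi_ge2 R => p2; have : 1 / 2 = pi / 2 :> R by apply: H; lra.
by lra.
Qed.

Lemma clamp_norm_le v : `|clamp v| <= c.
Proof.
have c0 := sin_half_ge0.
rewrite /clamp normrM [`|2^-1|]ger0_norm ?invr_ge0// ler_pdivrMr//.
apply: (le_trans (ler_dist_dist _ _)).
by rewrite (_ : _ - _ = c * 2); [rewrite ger0_norm ?mulr_ge0|ring].
Qed.

(** With a the midpoint and h the half-distance of y and 1/2, the difference sin (a + h) - sin (a -
    h) is 2 cos a sin h, a product of nonnegative factors. *)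
Lemma sin_le_half y : - (1 / 2) <= y <= 1 / 2 -> sin y <= c.
Proof.
move=> /andP[y1 y2]; have p2 := @pi_ge2 R.
pose a := (1 / 2 + y) / 2; pose h := (1 / 2 - y) / 2.
have -> : y = a - h by rewrite /a /h; field.
rewrite /c (_ : 1 / 2 = a + h); last by rewrite /a /h; field.
rewrite sinB sinD.
have sh : 0 <= sin h by apply: sin_ge0_pi; rewrite /h; lra.
have ca : 0 <= cos a by apply: cos_ge0_pihalf; rewrite /a; lra.
by have := mulr_ge0 ca sh; lra.
Qed.

Definition casin v := asin (clamp v).

Lemma casinK y : `|y| <= 1 / 2 -> casin (sin y) = y.
Proof.
move=> y2; have := y2; rewrite ler_norml => /andP[h1 h2].
have p2 := @pi_ge2 R.
rewrite /casin clamp_id ?sinK//.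
  by rewrite in_itv/=; lra.
rewrite ler_norml sin_le_half ?andbT; last lra.
by rewrite lerNl -sinN sin_le_half//; lra.
Qed.

Lemma casin_continuous : continuous casin.
Proof.
move=> v; apply: continuous_comp; last first.
  apply: continuous_asin; rewrite -ltr_norml.
  by rewrite (le_lt_trans (clamp_norm_le v))// sin_half_lt1.
apply: cvgM; last exact: cvg_cst.
apply: cvgB; apply: cvg_norm.
  by apply: cvgD; [exact: cvg_id|exact: cvg_cst].
by apply: cvgB; [exact: cvg_id|exact: cvg_cst].
Qed.

End clamped_asin.

Section trig_approximation.
Context (R : realType) (m n : nat).
Variables (f : 'M[R]_(m, n) -> R) (B K : R).
Hypotheses (cf : continuous f) (fB : forall x, `|f x| <= B) (K0 : 0 < K).

(* [f] read in the coordinate u = (1 + sin (x / 2K)) / 2, which has a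
   continuous inverse on the box of radius [K]. *)
Let F (u : 'M[R]_(m, n)) := f (\matrix_(i, j) (2 * K * casin (2 * u i j - 1))).
Let u (x : 'M[R]_(m, n)) : 'M[R]_(m, n) :=
  \matrix_(i, j) ((1 + sin (x i j / (2 * K))) / 2).

Let F_continuous : continuous F.
Proof.
move=> x; apply: (continuous_comp
  (f := fun v : 'M[R]_(m, n) => \matrix_(i, j) (2 * K * casin (2 * v i j - 1)) : 'M[R]_(m, n)));
  last exact: cf.
apply: continuous_matrix => i j.
under eq_fun do rewrite mxE.
apply: (continuousM_fun (f := cst (2 * K))); first exact: cst_continuous.
have cg : continuous (fun v : 'M[R]_(m, n) => 2 * v i j - 1).
  apply: (continuousD_fun (g := cst (- 1 : R))); last exact: cst_continuous.
  apply: (continuousM_fun (f := cst 2)); first exact: cst_continuous.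
  exact: coord_continuous.
by move=> y; apply: (continuous_comp (cg y)); exact: casin_continuous.
Qed.

Let F_u x : `|x| <= K -> F (u x) = f x.
Proof.
move=> xK; rewrite /F; congr f; apply/matrixP => i j; rewrite !mxE.
set y := x i j / (2 * K).
have -> : 2 * ((1 + sin y) / 2) - 1 = sin y by field.
have K20 : 0 < 2 * K by rewrite mulr_gt0.
rewrite casinK; first by rewrite /y; field; rewrite gt_eqF.
rewrite /y normrM [`|(2 * K)^-1|]gtr0_norm ?invr_gt0// ler_pdivrMr//.
by rewrite (le_trans (mx_entry_le x i j))// mulrA mulfVK// mul1r.
Qed.

Let u_ge0 x i j : 0 <= u x i j.
Proof. by rewrite mxE; have := sin_geN1 (x i j / (2 * K)); lra. Qed.

Let u_le1 x i j : u x i j <= 1.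
Proof. by rewrite mxE; have := sin_le1 (x i j / (2 * K)); lra. Qed.

Section bernstein.
Variable k : nat.
Hypothesis k0 : (0 < k)%N.
Let I : finType := ('I_m * 'I_n * 'I_k)%type.

Let p (x : 'M[R]_(m, n)) (i : I) (b : bool) : R :=
  if b then u x i.1.1 i.1.2 else 1 - u x i.1.1 i.1.2.

Let p_ge0 x i b : 0 <= p x i b.
Proof. by rewrite /p; case: b; rewrite ?subr_ge0 ?u_ge0 ?u_le1. Qed.

Let p_sum1 x i : \sum_b p x i b = 1.
Proof. by rewrite big_bool/= /p addrC subrK. Qed.

Let avg (z : {ffun I -> bool}) : 'M[R]_(m, n) :=
  \matrix_(i, j) (k%:R^-1 * \sum_(l < k) (z (i, j, l))%:R).

(* Bernstein polynomial of [F] in the coordinate [u]: the mean of [F] at the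
   averages of k independent Bernoulli variables per entry. *)
Let h x := prodE (p x) (fun z => F (avg z)).

Let h_trig : trig_poly h.
Proof.
apply: trig_sum => z; under eq_fun do rewrite mulrC; apply: trig_scale.
apply: trig_prod => i.
have tu : trig_poly (fun x => u x i.1.1 i.1.2).
  have := trig_scale 2^-1 (trig_add (trig_cst m n 1) (trig_sin_coord i.1.1 i.1.2 (2 * K))).
  by congr trig_poly; apply/funext => x; rewrite mxE mulrC.
rewrite /p; case: (z i) => //.
have := trig_add (trig_cst m n 1) (trig_scale (-1) tu).
by congr trig_poly; apply/funext => x; rewrite mulN1r.
Qed.

Let h_le x : `|h x| <= B.
Proof.
apply: (le_trans (normr_prodE (p_ge0 x) _)).
rewrite -[leRHS](prodE_cst (p_sum1 x)); apply: le_prodE => // z; exact: fB.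
Qed.

(** The variance of an average of k Bernoulli variables is u (1 - u) / k. Variables attached to
    other entries enter [prodE_sqr] with summand 0. *)
Let avg_var x i j : prodE (p x) (fun z => (avg z i j - u x i j) ^+ 2) <= k%:R^-1.
Proof.
pose v (l : I) (b : bool) : R :=
  if l.1 == (i, j) then (b%:R - u x i j) / k%:R else 0.
have kR0 : k%:R != 0 :> R by rewrite pnatr_eq0 -lt0n.
have v0 l : \sum_b p x l b * v l b = 0.
  rewrite big_bool/= /p /v; case: eqP => [->|_] /=; last by rewrite !mulr0 addr0.
  by field.
have pairE (g : I -> R) : \sum_l g l = \sum_ij \sum_l g (ij, l).
  by rewrite pair_bigA; apply: eq_bigr => -[].
have vE z : avg z i j - u x i j = 0 + \sum_l v l (z l).
  rewrite add0r pairE.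
  rewrite (bigD1 (i, j))//= [X in _ = _ + X]big1 ?addr0; last first.
    by move=> ij /negbTE ijE; apply: big1 => l _; rewrite /v/= ijE.
  rewrite /v/= eqxx -mulr_suml sumrB sumr_const card_ord mxE -mulr_natr.
  by field.
under eq_prodE do rewrite vE.
rewrite (prodE_sqr (p_sum1 x) v0) expr0n add0r.
rewrite pairE.
rewrite (bigD1 (i, j))//= [X in _ + X]big1 ?addr0; last first.
  move=> ij /negbTE ijE; apply: big1 => l _; apply: big1 => b _.
  by rewrite /v/= ijE expr0n mulr0.
have -> : \sum_(l < k) \sum_t p x (i, j, l) t * v (i, j, l) t ^+ 2 =
    k%:R^-1 * (u x i j * (1 - u x i j)).
  under eq_bigr => l _ do rewrite big_bool /p /v/= eqxx.
  by rewrite sumr_const card_ord -[LHS]mulr_natr; field.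
rewrite ler_piMr ?invr_ge0//.
by have := u_ge0 x i j; have := u_le1 x i j; move=> u1 u0; rewrite mulr_ile1 ?subr_ge0//; lra.
Qed.

(** Chebyshev's argument: when [avg z] is farther than [delta] from [u x], the trivial bound [2 * B]
    is at most [2 * B / delta ^+ 2] times the sum of squared errors, whose mean is controlled by
    [avg_var]. *)
Let h_error delta e x : 0 < delta -> 0 <= e ->
  (forall v w, `|v| <= 1 -> `|v - w| <= delta -> `|F v - F w| <= e) ->
  `|x| <= K ->
  `|h x - f x| <= e + 2 * B / delta ^+ 2 * ((m * n)%:R / k%:R).
Proof.
move=> d0 e0 Fe xK; rewrite -F_u//.
have B0 : 0 <= B by exact: le_trans (fB 0).
have c0 : 0 <= 2 * B / delta ^+ 2 by rewrite divr_ge0 ?mulr_ge0 ?exprn_ge0// ltW.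
have -> : h x - F (u x) = prodE (p x) (fun z => F (avg z) + - F (u x)).
  by rewrite prodED// prodE_cst.
apply: (le_trans (normr_prodE (p_ge0 x) _)).
apply: (@le_trans _ _ (prodE (p x) (fun z => e + 2 * B / delta ^+ 2 *
    \sum_ij (avg z ij.1 ij.2 - u x ij.1 ij.2) ^+ 2))).
  apply: le_prodE => // z.
  have S0 : 0 <= \sum_ij (avg z ij.1 ij.2 - u x ij.1 ij.2) ^+ 2.
    by apply: sumr_ge0 => ij _; rewrite sqr_ge0.
  have [near_avg|far_avg] := leP `|u x - avg z| delta.
    have u1 : `|u x| <= 1 by apply: mx_norm_le => // i j; rewrite ger0_norm ?u_le1 ?u_ge0.
    rewrite distrC (le_trans (Fe _ _ u1 near_avg))// lerDl.
    by rewrite mulr_ge0.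
  have [[i j] /= ij_far] : exists ij : 'I_m * 'I_n, delta < `|(u x - avg z) ij.1 ij.2|.
    apply: contrapT => /forallNP H; move: far_avg; rewrite ltNge => /negP; apply.
    by apply: mx_norm_le => [|i j]; [exact: ltW|rewrite leNgt; apply/negP; exact: (H (i, j))].
  have d2 : delta ^+ 2 <= \sum_ij (avg z ij.1 ij.2 - u x ij.1 ij.2) ^+ 2.
    rewrite (bigD1 (i, j))//= -[leLHS]addr0 lerD//; last first.
      by apply: sumr_ge0 => ij _; rewrite sqr_ge0.
    rewrite -[leRHS]real_normK ?num_real// lerXn2r ?nnegrE//; first exact: ltW.
    by rewrite distrC ltW//; move: ij_far; rewrite 2!mxE [X in _ + X]mxE.
  apply: (@le_trans _ _ (2 * B)).
    by rewrite (le_trans (ler_normB _ _))// mulr_natl mulr2n lerD// fB.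
  rewrite -[leLHS]add0r lerD// -mulrA -[leLHS]mulr1 ler_wpM2l ?mulr_ge0//.
  by rewrite mulrC ler_pdivlMr ?exprn_gt0// mul1r.
rewrite prodED prodE_cst// prodEZ lerD2l ler_wpM2l// prodE_sum//.
apply: (@le_trans _ _ (\sum_(ij : 'I_m * 'I_n) k%:R^-1)).
  by apply: ler_sum => ij _; exact: avg_var.
by rewrite sumr_const card_prod !card_ord -[leLHS]mulr_natl lexx.
Qed.

Lemma bernstein_trig : exists h', [/\ trig_poly h', forall x, `|h' x| <= B &
  forall delta e x, 0 < delta -> 0 <= e ->
  (forall v w, `|v| <= 1 -> `|v - w| <= delta -> `|F v - F w| <= e) ->
  `|x| <= K ->
  `|h' x - f x| <= e + 2 * B / delta ^+ 2 * ((m * n)%:R / k%:R)].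
Proof. by exists h; split => //; exact: h_error. Qed.

End bernstein.

(** A Bernstein polynomial averages values of [f], so it keeps the bound [B] everywhere. This
    controls it outside the box, where it no longer approximates [f]. *)
Lemma trig_approx e : 0 < e -> exists h, [/\ trig_poly h,
  forall x, `|h x| <= B & forall x, `|x| <= K -> `|h x - f x| <= e].
Proof.
move=> e0; have e2 : 0 < e / 2 by rewrite divr_gt0.
have [delta d0 Fd] := unif_continuous_bounded 1 F_continuous e2.
pose c := 2 * B / delta ^+ 2 * (m * n)%:R.
have B0 : 0 <= B by exact: le_trans (fB 0).
have c0 : 0 <= c by rewrite !mulr_ge0 ?invr_ge0 ?exprn_ge0// ltW.
(* Large enough for the Chebyshev term [c / k] to be at most [e / 2]. *)
pose k := (Num.truncn (c / (e / 2))).+1.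
have ck : c / (e / 2) < k%:R by exact: truncnS_gt.
have [h [th hB hE]] := bernstein_trig (ltn0Sn (Num.truncn (c / (e / 2)))).
exists h; split => // x xK.
apply: (le_trans (hE _ _ x d0 (ltW e2) Fd xK)).
rewrite [leRHS]splitr lerD2l mulrA -/c -/k ler_pdivrMr ?ltr0n//.
by rewrite mulrC -ler_pdivrMr// ltW.
Qed.

End trig_approximation.

Section tightness.
Context (d : measure_display) (O : measurableType d) (R : realType)
  (P : probability O R) (m n : nat).

Lemma measurable_normr_mx (Y : O -> 'M[R]_(m, n)) :
  random_mx Y -> measurable_fun setT (fun w => `|Y w|).
Proof.
move=> mY; apply: (measurable_comp_continuous (f := fun x => `|x|) mY).
by move=> x; apply: norm_continuous.
Qed.

(** The events where the norm exceeds k + 1 decrease to the empty set, so their probabilities tend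
    to 0. *)
Lemma tight_random_mx (Y : O -> 'M[R]_(m, n)) e : random_mx Y -> 0 < e ->
  exists K, 0 < K /\ exists E, [/\ measurable E, (P E <= e%:E)%E &
    forall w, ~ E w -> `|Y w| <= K].
Proof.
move=> mY e0; pose E (k : nat) := [set w | k.+1%:R < `|Y w|].
have mE k : measurable (E k).
  have := measurable_normr_mx mY measurableT (measurable_itv `]k.+1%:R, +oo[).
  rewrite setTI; congr measurable; apply/seteqP; split => w /=; rewrite in_itv/= ?andbT//.
have E0 : \bigcap_k E k = set0.
  apply/seteqP; split => // w wE; have := wE (Num.truncn `|Y w|) Logic.I.
  by rewrite /E/= ltNge (ltW (truncnS_gt _)).
have := @nonincreasing_cvg_mu _ _ _ P E.
rewrite E0 measure0 => /(_ _ mE measurable0 _) H.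
have /fine_cvgP[_ /cvgrPdist_le/(_ _ e0)[k _ /(_ k (leqnn k))]] :
    P (E k) @[k --> \oo] --> (0%R)%:E.
  apply: H; first by rewrite (le_lt_trans (probability_le1 P _)) ?ltry.
  move=> i j ij; apply/subsetPset => w; rewrite /E/=; apply: le_lt_trans.
  by rewrite ler_nat.
rewrite /= sub0r normrN => PE; exists k.+1%:R; split => //; exists (E k); split => //.
  rewrite -[leLHS]fineK ?fin_num_measure// lee_fin.
  exact: le_trans (ler_norm _) PE.
by move=> w /negP; rewrite -leNgt.
Qed.

End tightness.

Section levy_continuity.
Context (d d' : measure_display) (O : measurableType d) (O' : measurableType d')
  (R : realType) (P : probability O R) (P' : probability O' R) (m n : nat).
Context (Z : nat -> O -> 'M[R]_(m, n)) (G : O' -> 'M[R]_(m, n)).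
Hypothesis Z_random : \forall N \near \oo, random_mx (Z N).
Hypothesis G_random : random_mx G.

Lemma cvg_in_law_mxP :
  cvg_in_law P P' Z G <->
  (forall (f : 'M[R]_(m, n) -> R) B, continuous f -> (forall x, `|f x| <= B) ->
     \int[P]_w f (Z N w) @[N --> \oo] --> \int[P']_w f (G w)).
Proof.
apply: cvg_in_lawP => f cf; last exact: measurable_comp_continuous.
by near=> N; apply: measurable_comp_continuous => //; near: N.
Unshelve. all: by end_near. Qed.

Hypothesis Z_tight : tight P Z.
Hypothesis ZG_cos : forall s U,
  \int[P]_w cos (s + pairing U (Z N w)) @[N --> \oo] -->
  \int[P']_w cos (s + pairing U (G w)).

Lemma integrable_comp (e : measure_display) (U : measurableType e)
  (Q : probability U R) (Y : U -> 'M[R]_(m, n)) f :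
  random_mx Y -> trig_poly f -> Q.-integrable setT (EFin \o (fun w => f (Y w))).
Proof.
move=> mY tf; have [B fB] := trig_poly_bounded tf.
apply: (@bounded_integrable _ _ _ _ _ B) => //.
exact: measurable_comp_continuous (trig_poly_continuous tf).
Qed.

Lemma trig_poly_cvg f : trig_poly f ->
  \int[P]_w f (Z N w) @[N --> \oo] --> \int[P']_w f (G w).
Proof.
elim=> [s U|f1 f2 t1 IH1 t2 IH2|a f1 t1 IH1]; first exact: ZG_cos.
- rewrite RintegralD//; [|exact: integrable_comp..].
  apply: cvg_trans; last exact: cvgD IH1 IH2.
  apply: near_eq_cvg; near=> N; rewrite /= RintegralD//.
    by apply: integrable_comp => //; near: N.
  by apply: integrable_comp => //; near: N.
- rewrite RintegralZl//; [|exact: integrable_comp..].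
  apply: cvg_trans; last exact: cvgM (cvg_cst a) IH1.
  apply: near_eq_cvg; near=> N; rewrite /= RintegralZl//.
  by apply: integrable_comp => //; near: N.
Unshelve. all: by end_near. Qed.

Theorem levy_continuity : cvg_in_law P P' Z G.
Proof.
apply/cvg_in_law_mxP => f B cf fB; apply/cvgrPdist_le => e e0.
have B0 : 0 <= B by exact: le_trans (fB 0).
have B1 : 0 < B + 1 by rewrite ltr_wpDl.
(* Five terms of size e/6 occur: on each side, the approximation error on the box and the tail
   [2 * B * r], and once the convergence of the means of [h]. *)
have e6 : 0 < e / 6 by rewrite divr_gt0.
pose r := e / (12 * (B + 1)).
have r0 : 0 < r by rewrite divr_gt0// mulr_gt0.
have Br : 2 * B * r <= e / 6.
  have -> : 2 * B * r = e / 6 * (B / (B + 1)) by rewrite /r; field; rewrite gt_eqF.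
  by apply: ler_piMr; [exact: ltW|rewrite ler_pdivrMr// mul1r lerDl].
have [K1 HK1] := Z_tight r0.
have [K2 [K20 [E2 [mE2 PE2 E2K]]]] := tight_random_mx P' G_random r0.
pose K := Num.max K1 K2.
have K0 : 0 < K by rewrite lt_max K20 orbT.
have [h [th hB hf]] := trig_approx cf fB K0 e6.
have ch := trig_poly_continuous th.
have /cvgrPdist_le/(_ _ e6) hcvg := trig_poly_cvg th.
near=> N.
have rZ : random_mx (Z N) by near: N.
have [E1 [mE1 PE1 E1K]] : exists E, [/\ measurable E, (P E <= r%:E)%E &
  forall w, ~ E w -> `|Z N w| <= K1] by near: N.
have h1 : `|\int[P]_w h (Z N w) - \int[P]_w f (Z N w)| <= e / 6 + 2 * B * r.
  apply: (mean_near _ _ _ _ mE1 PE1 (ltW e6)) => //.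
  - exact: (measurable_comp_continuous rZ ch).
  - exact: (measurable_comp_continuous rZ cf).
  - by move=> w /E1K ZK; apply: hf; rewrite le_max ZK.
have h2 : `|\int[P']_w h (G w) - \int[P']_w f (G w)| <= e / 6 + 2 * B * r.
  apply: (mean_near _ _ _ _ mE2 PE2 (ltW e6)) => //.
  - exact: (measurable_comp_continuous G_random ch).
  - exact: (measurable_comp_continuous G_random cf).
  - by move=> w /E2K GK; apply: hf; rewrite le_max GK orbT.
have h3 : `|\int[P']_w h (G w) - \int[P]_w h (Z N w)| <= e / 6 by near: N.
rewrite distrC in h2.
have /le_trans := ler_distD (\int[P']_w h (G w)) (\int[P']_w f (G w)) (\int[P]_w f (Z N w)).
apply; have /le_trans := ler_distD (\int[P]_w h (Z N w)) (\int[P']_w h (G w)) (\int[P]_w f (Z N w)).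
move=> /(_ (e / 6 + (e / 6 + 2 * B * r))) h4.
have := h4 (lerD h3 h1); lra.
Unshelve. all: by end_near. Qed.

End levy_continuity.

(** * Normal laws *)

Section normal_integral.
Context (R : realType) (m sigma : R).
Hypothesis sigma0 : sigma != 0.
Local Notation mu := (@lebesgue_measure R).
Local Notation N := (normal_prob m sigma).
Local Notation pdf := (normal_pdf m sigma).

Let measurable_pdfE : measurable_fun setT (fun x => (pdf x)%:E).
Proof. by apply/measurable_EFinP; exact: measurable_normal_pdf. Qed.

(** The Radon-Nikodym derivative of the normal law and [pdf] have the same integral over every
    measurable set, hence agree almost everywhere. *)
Lemma ge0_integral_normal (f : R -> \bar R) : (forall x, 0 <= f x)%E ->
  measurable_fun setT f ->
  (\int[N]_x f x = \int[mu]_x (f x * (pdf x)%:E))%E.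
Proof.
move=> f0 mf.
have dom := normal_prob_dominates m sigma.
rewrite -(Radon_Nikodym_SigmaFinite.change_of_variables dom)//.
have mRN : measurable_fun setT (Radon_Nikodym_SigmaFinite.f N mu).
  exact: measurable_int (Radon_Nikodym_SigmaFinite.f_integrable dom).
apply: ae_eq_integral => //.
- exact: emeasurable_funM.
- exact: emeasurable_funM.
- apply: ae_eqe_mul2l; apply: integral_ae_eq => //.
  + exact: Radon_Nikodym_SigmaFinite.f_integrable.
  + by move=> E _ mE; rewrite -Radon_Nikodym_SigmaFinite.f_integral.
Qed.

Lemma integrable_normal (f : R -> R) : measurable_fun setT f ->
  mu.-integrable setT (fun x => (f x * pdf x)%:E) ->
  N.-integrable setT (EFin \o f).
Proof.
move=> mf /integrableP[_ fi]; apply/integrableP; split; first exact/measurable_EFinP.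
rewrite ge0_integral_normal//.
  apply: le_lt_trans fi; rewrite le_eqVlt; apply/orP; left; apply/eqP.
  by apply: eq_integral => x _; rewrite /= normrM EFinM (ger0_norm (normal_pdf_ge0 _ _ _)).
by apply: measurableT_comp => //; exact/measurable_EFinP.
Qed.

Lemma integral_normal (f : R -> R) : measurable_fun setT f ->
  mu.-integrable setT (fun x => (f x * pdf x)%:E) ->
  \int[N]_x f x = \int[mu]_x (f x * pdf x).
Proof.
move=> mf fi; have iN := integrable_normal mf fi.
have mfE : measurable_fun setT (fun x => (f x)%:E) by exact/measurable_EFinP.
rewrite /Rintegral; congr fine; rewrite [LHS]integralE [RHS]integralE.
have p0 x : (0 <= (pdf x)%:E)%E by rewrite lee_fin normal_pdf_ge0.
congr (_ - _)%E.
  rewrite ge0_integral_normal//; last exact: measurable_funepos.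
  apply: eq_integral => x _; rewrite !funeposE EFinM muleC maxe_pMr// mule0.
  by rewrite (muleC (pdf x)%:E).
rewrite ge0_integral_normal//; last exact: measurable_funeneg.
apply: eq_integral => x _; rewrite !funenegE EFinM muleC maxe_pMr// mule0.
by rewrite muleN (muleC (pdf x)%:E).
Qed.

(** A linear factor is absorbed by doubling the standard deviation. First moments are thereby
    dominated by an integrable normal density, and the boundary terms in Stein's identity decay. *)
Lemma normal_fun_moment_le x :
  `|x - m| * normal_fun m sigma x <= `|sigma| * normal_fun m (2 * sigma) x.
Proof.
rewrite /normal_fun; set y := x - m.
have s2 : sigma ^+ 2 != 0 by rewrite expf_neq0.
(* The gap between the exponents for [sigma] and [2 * sigma]: 1/2 - 1/8 = 3/8. *)
pose q := 3 / 8 * (y / sigma) ^+ 2.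
have -> : - y ^+ 2 / (sigma ^+ 2 *+ 2) = - y ^+ 2 / ((2 * sigma) ^+ 2 *+ 2) - q.
  by rewrite /q -[sigma ^+ 2 *+ 2]mulr_natl -[(2 * sigma) ^+ 2 *+ 2]mulr_natl; field.
rewrite expRD mulrCA mulrA [leRHS]mulrC -mulrA ler_wpM2l ?expR_ge0//.
have sg : 0 < `|sigma| by rewrite normr_gt0.
suff : `|y| <= `|sigma| * expR q.
  move=> h; rewrite expRN -ler_pdivlMr ?invr_gt0 ?expR_gt0// invrK//.
have h1 := expR_ge1Dx q.
rewrite -ler_pdivrMl//; apply: le_trans h1.
have -> : q = 3 / 8 * (`|sigma|^-1 * `|y|) ^+ 2.
  rewrite /q; congr (_ * _); rewrite -normfV -normrM real_normK ?num_real//.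
  by rewrite mulrC.
set z := `|sigma|^-1 * `|y|.
(* Completing the square shows z <= 1 + 3/8 z^2 for every z. *)
have -> : 1 + 3 / 8 * z ^+ 2 = z + (3 / 8 * (z - 4 / 3) ^+ 2 + 1 / 3) by field.
by have := sqr_ge0 (z - 4 / 3); set q2 := (z - 4 / 3) ^+ 2; lra.
Qed.

Lemma integrable_moment_pdf (g : R -> R) B : measurable_fun setT g ->
  (forall x, `|g x| <= B * `|x - m|) ->
  mu.-integrable setT (fun x => (g x * pdf x)%:E).
Proof.
move=> mg gB.
have s20 : 2 * sigma != 0 by rewrite mulf_neq0.
pose c := `|B| * (normal_peak sigma * `|sigma| / normal_peak (2 * sigma)).
have iC : mu.-integrable setT (fun x => (c * normal_pdf m (2 * sigma) x)%:E).
  have := @integrableZl _ _ _ mu _ measurableT c _ (integrable_normal_pdf m (2 * sigma)).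
  by apply: eq_integrable => // x _; rewrite EFinM.
apply: (le_integrable measurableT _ _ iC).
- by apply/measurable_EFinP; apply: measurable_funM => //; exact: measurable_normal_pdf.
- move=> x _ /=; rewrite lee_fin !normrM !(ger0_norm (normal_pdf_ge0 _ _ _)).
  rewrite !normal_pdfE// /c.
  have pk0 : 0 < normal_peak (2 * sigma) by exact: normal_peak_gt0.
  have pk1 : 0 < normal_peak sigma by exact: normal_peak_gt0.
  have H := normal_fun_moment_le x.
  have f0 : 0 <= normal_fun m sigma x by exact: expR_ge0.
  have gB' : `|g x| <= `|B| * `|x - m|.
    by rewrite (le_trans (gB x))// ler_wpM2r// ler_norm.
  apply: (@le_trans _ _ (`|B| * `|x - m| * (normal_peak sigma * normal_fun m sigma x))).
    by rewrite ler_wpM2r// mulr_ge0// ltW.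
  have pk0V : 0 < (normal_peak (2 * sigma))^-1 by rewrite invr_gt0.
  rewrite !normr_id (gtr0_norm pk0V) (gtr0_norm pk1).
  have -> : `|B| * (normal_peak sigma * `|sigma| / normal_peak (2 * sigma)) *
    (normal_peak (2 * sigma) * normal_fun m (2 * sigma) x) =
    `|B| * normal_peak sigma * (`|sigma| * normal_fun m (2 * sigma) x).
    by field; rewrite gt_eqF.
  have -> : `|B| * `|x - m| * (normal_peak sigma * normal_fun m sigma x) =
    `|B| * normal_peak sigma * (`|x - m| * normal_fun m sigma x) by ring.
  by rewrite ler_wpM2l// mulr_ge0// ltW.
Qed.

Lemma integrable_bounded_pdf (g : R -> R) B : measurable_fun setT g ->
  (forall x, `|g x| <= B) -> mu.-integrable setT (fun x => (g x * pdf x)%:E).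
Proof.
move=> mg gB.
have iC : mu.-integrable setT (fun x => (B * pdf x)%:E).
  have := @integrableZl _ _ _ mu _ measurableT B _ (integrable_normal_pdf m sigma).
  by apply: eq_integrable => // x _; rewrite EFinM.
apply: (le_integrable measurableT _ _ iC).
- by apply/measurable_EFinP; apply: measurable_funM => //; exact: measurable_normal_pdf.
- move=> x _ /=; rewrite lee_fin !normrM ler_wpM2r//.
  exact: le_trans (gB x) (ler_norm _).
Qed.

End normal_integral.

Section integral_derivative.
Context (R : realType).
Local Notation mu := (@lebesgue_measure R).

(** Over the interval of radius n + 1 around [m], the integral is a difference of boundary values of
    [F], which is O(1/n); dominated convergence identifies its limit with the full integral. *)
Lemma integral_derivative_decay (F f : R -> R) (m C : R) :
  (forall x : R, is_derive x 1 F (f x)) -> continuous f ->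
  mu.-integrable setT (EFin \o f) ->
  (forall x, `|F x| * `|x - m| <= C) -> \int[mu]_x f x = 0.
Proof.
move=> dF cf fi FC.
have mf : measurable_fun setT f by exact: continuous_measurable_fun.
have cF : continuous F.
  by move=> x; apply/differentiable_continuous/derivable1_diffP; case: (dF x).
pose I (n : nat) : set R := `[m - n.+1%:R, m + n.+1%:R]%classic.
have intI n : (\int[mu]_(x in I n) (f x)%:E =
    (F (m + n.+1%:R) - F (m - n.+1%:R))%:E)%E.
  rewrite EFinB; apply: continuous_FTC2.
  - by rewrite ltrD2l gtrN.
  - exact: continuous_subspaceT.
  - split.
    + by move=> x _; case: (dF x).
    + exact/cvg_at_right_filter/cF.
    + exact/cvg_at_left_filter/cF.
  - by move=> x _; rewrite derive1E; case: (dF x).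
have lim_f : (\int[mu]_(x in I n) (f x)%:E @[n --> \oo] --> \int[mu]_x (f x)%:E)%E.
  under eq_cvg do rewrite integral_mkcond/=.
  apply: (@dominated_cvg _ _ _ mu _ measurableT _ _ (fun x => `|(f x)%:E|%E)) => //.
  - move=> n; apply/(measurable_restrictT (fun x => (f x)%:E) (measurable_itv _)).
    by apply: measurable_funTS; apply/measurable_EFinP.
  - move=> x _; apply: cvg_near_cst; near=> n.
    rewrite patchE ifT//; rewrite inE /I/= in_itv/=.
    rewrite -ler_distlC -normrN opprB; apply/ltW.
    rewrite (lt_le_trans (truncnS_gt _))// ler_nat ltnS.
    by near: n; exact: nbhs_infty_ge.
  - by apply/integrable_abse.
  - by move=> n x _; rewrite patchE; case: ifPn => // _; rewrite abse0.
have lim_0 : (F (m + n.+1%:R) - F (m - n.+1%:R)) @[n --> \oo] --> 0.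
  apply/cvgr0Pnorm_le => e e0; near=> n.
  have n0 : 0 < n.+1%:R :> R by [].
  have h1 : `|F (m + n.+1%:R)| <= C / n.+1%:R.
    rewrite ler_pdivlMr//; have := FC (m + n.+1%:R).
    by rewrite addrAC subrr add0r [`|n.+1%:R|]ger0_norm.
  have h2 : `|F (m - n.+1%:R)| <= C / n.+1%:R.
    rewrite ler_pdivlMr//; have := FC (m - n.+1%:R).
    by rewrite addrAC subrr add0r normrN [`|n.+1%:R|]ger0_norm.
  rewrite (le_trans (ler_normB _ _))// (le_trans (lerD h1 h2))//.
  rewrite -mulrDl ler_pdivrMr// mulrC -ler_pdivrMr//.
  apply/ltW; rewrite (lt_le_trans (truncnS_gt _))// ler_nat ltnS.
  by near: n; exact: nbhs_infty_ge.
apply: (@cvg_unique _ (@Rhausdorff R) (fine (\int[mu]_(x in I n) (f x)%:E)%E @[n --> \oo])).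
  apply: fine_cvg; rewrite fineK//; exact: integrable_fin_num.
by apply: cvg_trans lim_0; under eq_cvg do rewrite intI.
Unshelve. all: by end_near. Qed.

End integral_derivative.

Section normal_stein.
Context (R : realType) (m sigma : R).
Hypothesis sigma0 : sigma != 0.
Local Notation mu := (@lebesgue_measure R).
Local Notation N := (normal_prob m sigma).
Local Notation pdf := (normal_pdf m sigma).

Lemma is_derive_normal_pdf (x : R) :
  is_derive x 1 pdf (- (x - m) / sigma ^+ 2 * pdf x).
Proof.
rewrite normal_pdfE//.
have s2 : sigma ^+ 2 *+ 2 != 0 by rewrite mulrn_eq0/= expf_neq0.
rewrite /normal_fun; apply: is_derive_eq.
rewrite /GRing.scale/= -[sigma ^+ 2 *+ 2]mulr_natl; field.
by rewrite sigma0.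
Qed.

Lemma normal_pdf_decay x : pdf x * `|x - m| <=
  normal_peak sigma * `|sigma| .
Proof.
rewrite normal_pdfE// -mulrA ler_wpM2l ?normal_peak_ge0// mulrC.
apply: (le_trans (normal_fun_moment_le _ sigma0 x)).
rewrite ler_piMr// /normal_fun -[leRHS]expR0 ler_expR mulNr oppr_le0.
by rewrite divr_ge0 ?sqr_ge0// mulrn_wge0// sqr_ge0.
Qed.

(** Stein's identity: after multiplication by the density, the difference of the two integrands is
    the derivative of [- sigma ^+ 2 * (g x * pdf x)], which decays at infinity. *)
Lemma normal_stein (g g' : R -> R) B :
  (forall x : R, is_derive x 1 g (g' x)) -> continuous g' ->
  (forall x, `|g x| <= B) -> (forall x, `|g' x| <= B) ->
  \int[N]_x ((x - m) * g x) = sigma ^+ 2 * \int[N]_x g' x.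
Proof.
move=> dg cg' gB g'B.
have B0 : 0 <= B by exact: le_trans (gB 0).
have cg : continuous g.
  by move=> x; apply/differentiable_continuous/derivable1_diffP; case: (dg x).
have mg : measurable_fun setT g by exact: continuous_measurable_fun.
have mg' : measurable_fun setT g' by exact: continuous_measurable_fun.
have mxg : measurable_fun setT (fun x : R => (x - m) * g x).
  by apply: measurable_funM => //; exact: measurable_funB.
have xgB x : `|(x - m) * g x| <= B * `|x - m|.
  by rewrite normrM mulrC ler_wpM2r.
have i1 := integrable_moment_pdf sigma0 mxg xgB.
have i2 := integrable_bounded_pdf m sigma mg' g'B.
rewrite !integral_normal// -RintegralZl//.
apply/eqP; rewrite -subr_eq0 -RintegralB//; last first.
  by have := integrableZl measurableT (sigma ^+ 2) i2; apply: eq_integrable.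
apply/eqP; apply: (@integral_derivative_decay _
  (fun x => - sigma ^+ 2 * (g x * pdf x))
  (fun x => (x - m) * g x * pdf x - sigma ^+ 2 * (g' x * pdf x)) m (sigma ^+ 2 * (B * (normal_peak sigma * `|sigma|)))).
- move=> x; have dp := is_derive_normal_pdf x; have dgx := dg x.
  apply: is_derive_eq; rewrite /GRing.scale/=; field.
  by rewrite sigma0.
- move=> x; apply: cvgB.
    apply: cvgM; last exact: continuous_normal_pdf.
    by apply: cvgM; [apply: cvgB; [exact: cvg_id|exact: cvg_cst]|exact: cg].
  apply: cvgM; first exact: cvg_cst.
  by apply: cvgM; [exact: cg'|exact: continuous_normal_pdf].
- rewrite (_ : _ \o _ = (fun x => ((x - m) * g x * pdf x)%:E - (sigma ^+ 2 * (g' x * pdf x))%:E)%E)//.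
  apply: integrableB => //.
  by have := integrableZl measurableT (sigma ^+ 2) i2; apply: eq_integrable.
- move=> x; rewrite !normrM normrN (ger0_norm (sqr_ge0 sigma)).
  rewrite (ger0_norm (normal_pdf_ge0 _ _ _)).
  rewrite -[X in X <= _]mulrA ler_wpM2l ?sqr_ge0// -[X in X <= _]mulrA.
  apply: ler_pM => //; last exact: normal_pdf_decay.
  by rewrite mulr_ge0 ?normal_pdf_ge0.
Qed.

Lemma normal_mean0 : \int[N]_x (x - m) = 0.
Proof.
have := @normal_stein (cst 1) (cst 0) 1 (fun x => is_derive_cst _ _ _)
  (@cst_continuous _ _ 0).
rewrite (_ : (fun x => _) = (fun x => x - m)); last by apply/funext => x; rewrite mulr1.
rewrite Rintegral_cst// !mul0r mulr0; apply => x; by rewrite ?normr1 ?normr0.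
Qed.

Lemma integrable_normal_id : N.-integrable setT (fun x : R => x%:E).
Proof.
have h : N.-integrable setT (EFin \o (fun x : R => x - m)).
  apply: integrable_normal => //; first exact: measurable_funB.
  by apply: (@integrable_moment_pdf _ _ _ _ _ 1) => // [|x]; [exact: measurable_funB|rewrite mul1r].
have hc : N.-integrable setT (EFin \o (cst m)).
  by apply: (@bounded_integrable _ _ _ _ _ `|m|) => //; exact: measurable_cst.
have := integrableD measurableT h hc; apply: eq_integrable => // x _.
by rewrite /= -EFinD subrK.
Qed.

Let phi s (t : R) := \int[N]_x cos (s + t * (x - m)).

Let measurable_trig s t : measurable_fun setT (fun x : R => cos (s + t * (x - m))).
Proof.
apply: measurableT_comp; first exact: continuous_measurable_fun (@continuous_cos R).
apply: measurable_funD => //; apply: measurable_funM => //; exact: measurable_funB.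
Qed.

(** Differentiation under the integral, dominated by |x - m|, produces the mean of (x - m) sin;
    Stein's identity turns it back into [phi], giving a linear differential equation. *)
Let phi_derive s (t : R) : is_derive t 1 (phi s) (- (sigma ^+ 2 * t * phi s t)).
Proof.
pose f (t x : R) := cos (s + t * (x - m)).
have df (x r : R) : is_derive r 1 (f ^~ x) (- ((x - m) * sin (s + r * (x - m)))).
  by rewrite /f; apply: is_derive_eq; rewrite /GRing.scale/=; ring.
have df1 x r : partial1of2 f r x = - ((x - m) * sin (s + r * (x - m))).
  by rewrite partial1of2E; have [_ ->] := df x r.
have tI : `]t - 1, t + 1[%classic t by rewrite /= in_itv/=; lra.
have intf r : `]t - 1, t + 1[%classic r -> N.-integrable setT (EFin \o f r).
  move=> _; apply: (@bounded_integrable _ _ _ _ _ 1); first exact: measurable_trig.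
  by move=> x; exact: normr_cos_le.
have der r y : `]t - 1, t + 1[%classic r -> setT y -> derivable (f ^~ y) r 1.
  by move=> _ _; case: (df y r).
have iG : N.-integrable setT (EFin \o (fun x : R => `|x - m|)).
  apply: integrable_normal => //.
    by apply: measurableT_comp => //; exact: measurable_funB.
  apply: (@integrable_moment_pdf _ _ _ _ _ 1) => // [|x]; last by rewrite mul1r normr_id.
  by apply: measurableT_comp => //; exact: measurable_funB.
have ub r y : `]t - 1, t + 1[%classic r -> setT y -> `|partial1of2 f r y| <= `|y - m|.
  by move=> _ _; rewrite df1 normrN normrM ler_piMr// normr_sin_le.
have D := derivable_under_integral measurableT tI intf der (fun y => normr_ge0 _) iG ub.
have E := differentiation_under_integral measurableT tI intf der (fun y => normr_ge0 _) iG ub.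
apply: DeriveDef => //; rewrite -derive1E [LHS]E.
under eq_Rintegral do rewrite df1.
have msin : measurable_fun setT (fun x : R => sin (s + t * (x - m))).
  apply: measurableT_comp; first exact: continuous_measurable_fun (@continuous_sin R).
  by apply: measurable_funD => //; apply: measurable_funM => //; exact: measurable_funB.
have isin : N.-integrable setT (EFin \o (fun x : R => (x - m) * sin (s + t * (x - m)))).
  have mm : measurable_fun setT (fun x : R => (x - m) * sin (s + t * (x - m))).
    by apply: measurable_funM => //; exact: measurable_funB.
  apply: integrable_normal => //.
  apply: (@integrable_moment_pdf _ _ _ _ _ 1) => // x.
  by rewrite mul1r normrM ler_piMr// normr_sin_le.
under eq_Rintegral do rewrite -mulN1r.
have St : \int[N]_x ((x - m) * sin (s + t * (x - m))) =
    sigma ^+ 2 * \int[N]_x (t * cos (s + t * (x - m))).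
  apply: (@normal_stein (fun x => sin (s + t * (x - m)))
    (fun x => t * cos (s + t * (x - m))) (1 + `|t|)).
  - by move=> x; apply: is_derive_eq; rewrite /GRing.scale/=; ring.
  - move=> x; apply: cvgM; first exact: cvg_cst.
    apply: continuous_comp; last exact: continuous_cos.
    apply: cvgD; first exact: cvg_cst.
    by apply: cvgM; [exact: cvg_cst|apply: cvgB; [exact: cvg_id|exact: cvg_cst]].
  - by move=> x; rewrite (le_trans (normr_sin_le _))// lerDl.
  - by move=> x; rewrite normrM (le_trans (ler_piMr _ (normr_cos_le _)))// lerDr.
rewrite RintegralZl// St RintegralZl//; first by rewrite /phi; ring.
apply: (@bounded_integrable _ _ _ _ _ 1); first exact: measurable_trig.
by move=> x; exact: normr_cos_le.
Qed.

(** The equation of [phi_derive] says that [phi] times [expR (sigma ^+ 2 * u ^+ 2 / 2)] has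
    derivative 0, so its value at t equals its value at 0. The phase is shifted by [t * m] because
    [phi] is centred at [m]. *)
Lemma normal_cos_scale s t :
  \int[N]_x cos (s + t * x) = cos (s + t * m) * expR (- (sigma * t) ^+ 2 / 2).
Proof.
pose h u := phi (s + t * m) u * expR (sigma ^+ 2 * u ^+ 2 / 2).
have dh (u : R) : is_derive u 1 h 0.
  have dp := phi_derive (s + t * m) u.
  by apply: is_derive_eq; rewrite /GRing.scale/=; field.
have := @is_derive_0_is_cst R h t 0 dh.
rewrite /h expr0n/= mulr0 mul0r expR0 mulr1 => ht0.
have phi0 : phi (s + t * m) 0 = cos (s + t * m).
  rewrite /phi; under eq_Rintegral do rewrite mul0r addr0.
  exact: Rintegral_cst_prob.
rewrite -phi0 -ht0 -[RHS]mulrA -expRD exprMn mulNr subrr expR0 mulr1 /phi.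
by apply: eq_Rintegral => x _; rewrite mulrBr addrA addrAC addrK.
Qed.

End normal_stein.

Section law_transfer.
Context (d : measure_display) (O : measurableType d) (R : realType)
  (P : probability O R) (X : O -> R) (Q : probability (measurableTypeR R) R).
Hypothesis mX : measurable_fun setT X.
Hypothesis lawX : forall B : set R, measurable B -> P (X @^-1` B) = Q B.

Let X' : {RV P >-> measurableTypeR R} := @mfun_Sub _ _ _ (measurableTypeR R) _ (mem_set mX).

Lemma integrable_law (f : R -> R) : Q.-integrable setT (EFin \o f) ->
  P.-integrable setT (EFin \o (f \o X)).
Proof.
move=> /integrableP[mf fi]; apply/integrableP; split.
  apply/measurable_EFinP/(measurableT_comp _ mX).
  exact/measurable_EFinP.
apply: le_lt_trans fi; rewrite le_eqVlt; apply/orP; left; apply/eqP.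
rewrite [RHS](eq_measure_integral (distribution P X')); last first.
  by move=> A mA _; apply/esym; exact: (lawX mA).
rewrite ge0_integral_distribution//.
by apply: measurableT_comp.
Qed.

Lemma integral_law (f : R -> R) : Q.-integrable setT (EFin \o f) ->
  \int[P]_w f (X w) = \int[Q]_x f x.
Proof.
move=> fi; rewrite /Rintegral [in RHS](eq_measure_integral (distribution P X')); last first.
  by move=> A mA _; apply/esym; exact: (lawX mA).
rewrite integral_distribution//; last exact: integrable_law.
exact: measurable_int fi.
Qed.

End law_transfer.

Section gaussian_law.
Context (R : realType).

(** One interface for the Dirac and the nondegenerate case: the formula for the mean of the cosine
    remains correct at [sigma = 0]. *)
Lemma gaussian_lawP (mu sigma : R) : exists Q : probability (measurableTypeR R) R,
  [/\ forall B, measurable B -> gaussian_law mu sigma B = Q B,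
      Q.-integrable setT (fun x : R => x%:E), \int[Q]_x x = mu &
      forall s u, \int[Q]_x cos (s + u * x) =
        cos (s + u * mu) * expR (- (sigma * u) ^+ 2 / 2)].
Proof.
rewrite /gaussian_law; have [->|s0] := eqVneq sigma 0.
  pose Q : probability (measurableTypeR R) R := \d_(mu : measurableTypeR R).
  have QE (f : R -> \bar R) : measurable_fun setT f -> (\int[Q]_x f x = f mu)%E.
    move=> mf; have := @integral_dirac _ (measurableTypeR R) mu R _ measurableT f mf.
    by rewrite diracT mul1e.
  exists Q; split => //.
  - apply/integrableP; split; first exact/measurable_EFinP.
    by rewrite QE ?ltry//; apply: measurableT_comp => //; exact/measurable_EFinP.
  - by rewrite /Rintegral QE//; exact/measurable_EFinP.
  - move=> s u; rewrite /Rintegral QE/=.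
      by rewrite mul0r expr0n/= oppr0 mul0r expR0 mulr1.
    apply/measurable_EFinP; apply: continuous_measurable_fun => x.
    apply: (continuous_comp (f := fun y : R => s + u * y)); last exact: continuous_cos.
    by apply: cvgD; [exact: cvg_cst|apply: cvgM; [exact: cvg_cst|exact: cvg_id]].
exists (normal_prob mu sigma); split => //.
- exact: integrable_normal_id.
- have := normal_mean0 mu s0; rewrite RintegralB//.
  + by rewrite Rintegral_cst_prob => /eqP; rewrite subr_eq0 => /eqP.
  + exact: integrable_normal_id.
  + by apply: (@bounded_integrable _ _ _ _ _ `|mu|) => //; exact: measurable_cst.
- by move=> s u; rewrite normal_cos_scale.
Qed.

End gaussian_law.

(** * Uniqueness of laws and adjunction of independent normal variables *)

Section law_unique.
Context (d d' : measure_display) (O : measurableType d) (O' : measurableType d')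
  (R : realType) (P : probability O R) (P' : probability O' R).
Context (X : O -> R) (Y : O' -> R).
Hypothesis mX : measurable_fun setT X.
Hypothesis mY : measurable_fun setT Y.

(** The projection onto [0, 1], written with absolute values so that continuity is immediate. *)
Let clip (y : R) : R := (`|y| - `|y - 1| + 1) / 2.

Let clip_ge y : 1 <= y -> clip y = 1.
Proof. by move=> y1; rewrite /clip !ger0_norm ?subr_ge0//; lra. Qed.

Let clip_le y : y <= 0 -> clip y = 0.
Proof. by move=> y0; rewrite /clip !ler0_norm//; lra. Qed.

Let clip_bound y : 0 <= clip y <= 1.
Proof.
have [y0|y0] := leP y 0; first by rewrite clip_le// lexx ler01.
have [y1|y1] := leP 1 y; first by rewrite clip_ge// lexx ler01.
by rewrite /clip ger0_norm ?ltW// ler0_norm ?subr_le0 ?ltW//; lra.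
Qed.

Let clip_continuous : continuous clip.
Proof.
move=> y; apply: cvgM; last exact: cvg_cst.
apply: cvgD; last exact: cvg_cst.
apply: cvgB; apply: cvg_norm; first exact: cvg_id.
by apply: cvgB; [exact: cvg_id|exact: cvg_cst].
Qed.

(* Continuous approximation of the indicator of ]a, b]. *)
Let ramp (a b : R) (n : nat) (x : R) : R := clip (n.+1%:R * (x - a)) - clip (n.+1%:R * (x - b)).

Let ramp_continuous a b n : continuous (ramp a b n).
Proof.
have cc (c : R) : continuous (fun x : R => clip (n.+1%:R * (x - c))).
  move=> x; apply: (continuous_comp (f := fun x : R => n.+1%:R * (x - c)));
    last exact: clip_continuous.
  apply: cvgM; first exact: cvg_cst.
  by apply: cvgB; [exact: cvg_id|exact: cvg_cst].
by move=> x; apply: cvgB; exact: cc.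
Qed.

Let ramp_bound a b n x : `|ramp a b n x| <= 1.
Proof.
rewrite /ramp ler_norml.
have := clip_bound (n.+1%:R * (x - a)); have := clip_bound (n.+1%:R * (x - b)).
by lra.
Qed.

Let ramp_cvg a b x : a <= b ->
  ramp a b n x @[n --> \oo] --> (\1_(`]a, b]%classic) x : R).
Proof.
move=> ab.
have clipE c : clip (n.+1%:R * (x - c)) @[n --> \oo] --> ((c < x)%R%:R : R).
  have [cx|xc] := ltP c x; last first.
    apply: cvg_near_cst; near=> n; rewrite clip_le//.
    by rewrite pmulr_rle0// subr_le0.
  apply: cvg_near_cst; near=> n; rewrite clip_ge//.
  have xc : 0 < x - c by rewrite subr_gt0.
  rewrite -ler_pdivrMr// div1r; apply/ltW.
  rewrite (lt_le_trans (truncnS_gt _))// ler_nat ltnS.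
  by near: n; exact: nbhs_infty_ge.
have -> : \1_(`]a, b]%classic) x = (a < x)%R%:R - (b < x)%R%:R :> R.
  rewrite indicE; have -> : (x \in `]a, b]%classic) = (a < x <= b)%R.
    by apply/idP/idP; rewrite inE/= in_itv.
  have [xb|bx] := leP x b; first by rewrite andbT subr0.
  by rewrite (le_lt_trans ab bx) subrr.
exact: cvgB.
Unshelve. all: by end_near. Qed.

Let measure_itv (e : measure_display) (U : measurableType e)
    (Q : probability U R) (Z : U -> R) a b : measurable_fun setT Z -> a <= b ->
  \int[Q]_w ramp a b n (Z w) @[n --> \oo] --> fine (Q (Z @^-1` `]a, b]%classic)).
Proof.
move=> mZ ab.
have mI : measurable (Z @^-1` `]a, b]%classic).
  by rewrite -[X in measurable X]setTI; exact: mZ.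
have mr n : measurable_fun setT (fun w => ramp a b n (Z w)).
  apply: (measurableT_comp _ mZ); exact: continuous_measurable_fun.
apply: fine_cvg; rewrite fineK ?fin_num_measure//.
have -> : Q (Z @^-1` `]a, b]%classic) = (\int[Q]_w (\1_(Z @^-1` `]a, b]%classic) w)%:E)%E.
  by rewrite integral_indic// setIT.
apply: (@dominated_cvg _ _ _ Q _ measurableT _ _ (cst 1%E)) => //.
- by move=> n; apply/measurable_EFinP.
- move=> w _; apply: cvg_EFin; first exact: nearW.
  by have := @ramp_cvg a b (Z w) ab; rewrite !indicE.
- by apply: (@bounded_integrable _ _ _ _ (cst 1) 1) => // w; rewrite normr1.
- by move=> n w _; rewrite lee_fin ramp_bound.
Qed.

(** The constant sequence [X] converges in law to [Y] by [levy_continuity], hence both give the same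
    mean to bounded continuous functions. Ramps carry this to half-open intervals, which form a
    generating pi-system. *)
Lemma law_unique :
  (forall s u : R, \int[P]_w cos (s + u * X w) = \int[P']_w cos (s + u * Y w)) ->
  forall B : set R, measurable B -> P (X @^-1` B) = P' (Y @^-1` B).
Proof.
move=> XY.
(* Real variables are seen as 1 x 1 matrices, the setting of the continuity theorem. *)
pose X1 w : 'M[R]_(1, 1) := const_mx (X w).
pose Y1 w : 'M[R]_(1, 1) := const_mx (Y w).
have rX : random_mx X1 by move=> i j; under eq_fun do rewrite mxE.
have rY : random_mx Y1 by move=> i j; under eq_fun do rewrite mxE.
have tX : tight P (fun=> X1).
  move=> e e0; have [K [_ [E HE]]] := tight_random_mx P rX e0.
  by exists K; apply: nearW => _; exists E.
have pE (U : 'M[R]_(1, 1)) x : pairing U (const_mx x : 'M[R]_(1,1)) = U ord0 ord0 * x.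
  by rewrite /pairing !big_ord1 mxE.
have cvgXY : cvg_in_law P P' (fun=> X1) Y1.
  apply: levy_continuity => //; first exact: nearW.
  move=> s U; apply: cvg_near_cst; apply: nearW => _.
  under eq_Rintegral do rewrite pE.
  under [RHS]eq_Rintegral do rewrite pE.
  exact: XY.
have fXY (f : R -> R) B : continuous f -> (forall x, `|f x| <= B) ->
    \int[P]_w f (X w) = \int[P']_w f (Y w).
  move=> cf fB.
  have cf1 : continuous (fun A : 'M[R]_(1, 1) => f (A ord0 ord0)).
    by move=> A; apply: continuous_comp; [exact: coord_continuous|exact: cf].
  have nX : \forall N \near \oo, random_mx ((fun=> X1 : O -> 'M[R]_(1, 1)) N).
    exact: nearW.
  have := (cvg_in_law_mxP P P' nX rY).1 cvgXY _ B cf1 (fun A => fB _).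
  have -> : \int[P]_w f (X w) = \int[P]_w f (X1 w ord0 ord0).
    by apply: eq_Rintegral => w _; rewrite mxE.
  have -> : \int[P']_w f (Y w) = \int[P']_w f (Y1 w ord0 ord0).
    by apply: eq_Rintegral => w _; rewrite mxE.
  exact: (cvg_unique _ (cvg_cst _)).
pose X' : {RV P >-> measurableTypeR R} := @mfun_Sub _ _ _ (measurableTypeR R) _ (mem_set mX).
pose Y' : {RV P' >-> measurableTypeR R} := @mfun_Sub _ _ _ (measurableTypeR R) _ (mem_set mY).
move=> B mB.
apply: (@measure_unique _ R (measurableTypeR R) (@ocitv R)
  (fun k => `](- k%:R), k%:R]%classic) _ _ _ _ (distribution P X') (distribution P' Y')) => //.
- exact: ocitvI.
- by move=> k; exact: is_ocitv.
- apply/seteqP; split => // x _; exists (Num.truncn `|x|).+1 => //=.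
  rewrite in_itv/=; have := truncnS_gt `|x|; rewrite ltr_norml => /andP[-> /ltW].
  by [].
- move=> _ [[a b] _ <-] /=; have [ab|ba] := leP a b; last first.
    by rewrite set_itv_ge ?measure0// bnd_simp -leNgt ltW.
  have h1 := measure_itv (Q := P) mX ab; have h2 := measure_itv (Q := P') mY ab.
  have h : fine (P (X @^-1` `]a, b]%classic)) = fine (P' (Y @^-1` `]a, b]%classic)).
    apply: (cvg_unique (@Rhausdorff R) h1); apply: cvg_trans h2; apply: near_eq_cvg.
    by apply: nearW => n; apply/esym/(fXY _ 1).
  have mIX : measurable (X @^-1` `]a, b]%classic) by rewrite -[X in measurable X]setTI; exact: mX.
  have mIY : measurable (Y @^-1` `]a, b]%classic) by rewrite -[X in measurable X]setTI; exact: mY.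
  rewrite /distribution/= /pushforward/= -[LHS]fineK ?fin_num_measure// h fineK//.
  exact: fin_num_measure.
- by move=> k; rewrite (le_lt_trans (probability_le1 _ _)) ?ltry.
Qed.

End law_unique.

Section normal_extension.
Context (R : realType).

Lemma measurable_cos_comp (d : measure_display) (O : measurableType d) (X : O -> R) :
  measurable_fun setT X -> measurable_fun setT (fun w => cos (X w)).
Proof.
move=> mX; apply: (measurableT_comp _ mX); apply: continuous_measurable_fun.
exact: continuous_cos.
Qed.

Lemma integrable_cos (d : measure_display) (O : measurableType d)
  (P : probability O R) (X : O -> R) :
  measurable_fun setT X -> P.-integrable setT (EFin \o (fun w => cos (X w))).
Proof.
move=> mX; apply: (@bounded_integrable _ _ _ _ _ 1); first exact: measurable_cos_comp.
by move=> w; exact: normr_cos_le.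
Qed.

Lemma product_normal_cos (d : measure_display) (O : measurableType d)
  (P : probability O R) (X : O -> R) (v : R) : measurable_fun setT X ->
  \int[(P \x normal_prob 0 1)%E]_z cos (X z.1 + v * z.2) =
  expR (- v ^+ 2 / 2) * \int[P]_w cos (X w).
Proof.
move=> mX.
have mXv : measurable_fun setT (fun z : O * measurableTypeR R => X z.1 + v * z.2).
  apply: measurable_funD; first exact: measurableT_comp.
  by apply: measurable_funM.
have iXv := integrable_cos (P \x normal_prob 0 1)%E mXv.
rewrite -RintegralZl//; last exact: integrable_cos.
rewrite /Rintegral -(integral12_prod_meas1 iXv); congr fine; apply: eq_integral => w _.
rewrite /fubini_F/=.
have mw : measurable_fun setT (fun x : measurableTypeR R => X w + v * x).
  by apply: measurable_funD => //; apply: measurable_funM.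
have := integrable_fin_num measurableT (integrable_cos (normal_prob 0 1) mw).
move=> /fineK <-; congr EFin.
rewrite -[LHS]/(\int[normal_prob 0 1]_x cos (X w + v * x)) normal_cos_scale ?oner_neq0//.
by rewrite mulr0 addr0 mul1r mulrC.
Qed.

(** The space is multiplied k times by the real line with its standard normal law. Independence from
    everything on [O] is expressed by the factorisation of the mean cosine, the only form in which
    it is used. *)
Lemma normal_extension (k : nat) (d : measure_display) (O : measurableType d)
    (P : probability O R) :
  exists (d' : measure_display) (O' : measurableType d') (P' : probability O' R)
    (p : O' -> O) (xi : 'I_k -> O' -> R),
  [/\ measurable_fun setT p, forall j, measurable_fun setT (xi j) &
    forall (X : O -> R) (v : 'I_k -> R), measurable_fun setT X ->
    \int[P']_w cos (X (p w) + \sum_j v j * xi j w) =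
    expR (- (\sum_j v j ^+ 2) / 2) * \int[P]_w cos (X w)].
Proof.
elim: k => [|k [e [U [Q [p [xi [mp mxi H]]]]]]].
  exists d, O, P, id, (fun _ => cst 0); split => // X v mX.
  rewrite big_ord0 oppr0 mul0r expR0 mul1r.
  by apply: eq_Rintegral => w _; rewrite big_ord0 addr0.
(* The last index [ord_max] receives the new coordinate; the others are pulled back from [U]. *)
exists _, (U * measurableTypeR R)%type, (Q \x normal_prob 0 1)%E, (p \o fst),
  (fun j z => if unlift ord_max j is Some j' then xi j' z.1 else z.2).
split.
- exact: measurableT_comp.
- move=> j; case: (unlift _ _) => [j'|]; last exact: measurable_snd.
  exact: measurableT_comp.
move=> X v mX.
have E z : X ((p \o fst) z) + \sum_j v j *
      (if unlift ord_max j is Some j' then xi j' z.1 else z.2) =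
    (X (p z.1) + \sum_j v (widen_ord (leqnSn k) j) * xi j z.1) + v ord_max * z.2.
  rewrite big_ord_recr/= unlift_none addrA; congr (_ + _ + _).
  apply: eq_bigr => j _.
  have -> : widen_ord (leqnSn k) j = lift ord_max j by apply: val_inj; rewrite /= /bump leqNgt ltn_ord.
  by rewrite liftK.
under eq_Rintegral do rewrite E.
rewrite (product_normal_cos Q (X := fun w => X (p w) + \sum_j v (widen_ord (leqnSn k) j) * xi j w)).
  rewrite H// mulrA -expRD; congr (expR _ * _).
  by rewrite big_ord_recr/= opprD mulrDl addrC.
apply: measurable_funD; first exact: measurableT_comp.
by apply: measurable_sum => j; apply: measurable_funM.
Qed.

Lemma normal_extension_fin (I : finType) (d : measure_display)
    (O : measurableType d) (P : probability O R) :
  exists (d' : measure_display) (O' : measurableType d') (P' : probability O' R)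
    (p : O' -> O) (xi : I -> O' -> R),
  [/\ measurable_fun setT p, forall i, measurable_fun setT (xi i) &
    forall (X : O -> R) (v : I -> R), measurable_fun setT X ->
    \int[P']_w cos (X (p w) + \sum_i v i * xi i w) =
    expR (- (\sum_i v i ^+ 2) / 2) * \int[P]_w cos (X w)].
Proof.
have [d' [U [Q [p [xi [mp mxi H]]]]]] := normal_extension #|I| P.
exists d', U, Q, p, (fun i => xi (enum_rank i)); split => // X v mX.
have reE (h : I -> R) : \sum_i h i = \sum_(j < #|I|) h (enum_val j).
  apply: (reindex (fun j : 'I_#|I| => enum_val j : I)).
  by exists enum_rank => i _; [exact: enum_valK|exact: enum_rankK].
rewrite reE -(H X (fun j => v (enum_val j)) mX); apply: eq_Rintegral => w _.
by rewrite reE; under eq_bigr do rewrite enum_valK.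
Qed.

End normal_extension.

(** * One transition of the particles *)

Section conditional_mean.
Context (d : measure_display) (O : measurableType d) (R : realType)
  (P : probability O R) (Gen : set (set O)).
Hypothesis Gen_sub : Gen `<=` measurable.
Local Notation OF := (g_sigma_algebraType Gen).
Context (A : set O) (f : O -> R).
Hypothesis mA : measurable A.
Hypothesis f01 : forall w, 0 <= f w <= 1.
Hypothesis fA : cond_prob_version P <<s Gen >> A f.

Lemma sigma_sub E : <<s Gen >> E -> measurable E.
Proof.
move: E; apply: (smallest_sub _ Gen_sub); exact: sigma_algebra_measurable.
Qed.

Lemma sigma_measurable_fun (psi : O -> R) :
  @measurable_fun _ _ OF R setT psi -> measurable_fun setT psi.
Proof.
move=> mpsi _ B mB; rewrite setTI; apply: sigma_sub.
by have := mpsi measurableT B mB; rewrite setTI.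
Qed.

Lemma cond_prob_measurable : measurable_fun setT f.
Proof.
by move=> _ B mB; rewrite setTI; apply: sigma_sub; apply: fA.1.
Qed.

Let f_abs w : `|f w| <= 1.
Proof. by have /andP[f0 f1] := f01 w; rewrite ger0_norm. Qed.

Lemma cond_mean_indic E : <<s Gen >> E ->
  \int[P]_w (\1_A w * \1_E w) = \int[P]_w (f w * \1_E w).
Proof.
move=> GE; have mE := sigma_sub GE.
have mf := cond_prob_measurable.
rewrite /Rintegral; congr fine.
have -> : (\int[P]_w (\1_A w * \1_E w)%:E = P (E `&` A))%E.
  rewrite -[in RHS](setIT (E `&` A)) -integral_indic//; last exact: measurableI.
  by apply: eq_integral => w _; rewrite setIC indicI.
rewrite fA.2// [LHS]integral_mkcond; apply: eq_integral => w _.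
by rewrite patchE indicE; case: ifPn => _; rewrite ?mulr1 ?mulr0.
Qed.

(** The definition of a conditional probability settles indicators of history events; linearity and
    uniform approximation extend it to every bounded [psi] known from the history. *)
Lemma cond_mean (psi : O -> R) B :
  @measurable_fun _ _ OF R setT psi -> (forall w, `|psi w| <= B) ->
  \int[P]_w (\1_A w * psi w) = \int[P]_w (f w * psi w).
Proof.
move=> mpsi psiB.
have mf := cond_prob_measurable.
have mpsiO := sigma_measurable_fun mpsi.
have B0 : 0 <= B by exact: le_trans (psiB point).
have m1 (E : set O) : measurable E -> measurable_fun setT (\1_E : O -> R).
  by move=> mE; exact: measurable_indic.
have ind_le (E : set O) w : `|\1_E w : R| <= 1.
  by rewrite indicE; case: (_ \in _); rewrite ?normr1 ?normr0.
apply/eqP; rewrite -subr_eq0 -normr_le0; apply/ler_addgt0Pl => e e0; rewrite addr0.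
(* [psi] is uniformly within [1 / n] of the step function floor(n psi) / n. *)
pose n := (Num.truncn (2 / e)).+1.
have n0 : 0 < n%:R :> R by rewrite ltr0n.
have ne : 2 / n%:R <= e.
  rewrite ler_pdivrMr// mulrC -ler_pdivrMr//; apply/ltW; exact: truncnS_gt.
(* Since [n * B < M], the integer part of [n * psi] lies in [-M, M); the index [z] is that integer
   shifted by [M]. *)
pose M := (Num.truncn (n%:R * B)).+1.
pose c (z : 'I_(M + M)) : int := (z : nat)%:Z - M%:Z.
pose E z := [set w | Num.floor (n%:R * psi w) = c z].
pose step w : R := \sum_z (c z)%:~R / n%:R * \1_(E z) w.
have GE z : <<s Gen >> (E z).
  have -> : E z = (fun w => n%:R * psi w) @^-1` `[(c z)%:~R, (c z + 1)%:~R[.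
    apply/seteqP; split => w /=; rewrite in_itv/=.
      by move=> <-; exact: floor_itv.
    by move=> h; apply/eqP; rewrite floor_eq.
  have mn : @measurable_fun _ _ OF R setT (fun w => n%:R * psi w) by exact: measurable_funM.
  by have := mn measurableT _ (measurable_itv `[(c z)%:~R, (c z + 1)%:~R[); rewrite setTI.
have mE z := sigma_sub (GE z).
have stepE w : step w = (Num.floor (n%:R * psi w))%:~R / n%:R.
  set u := Num.floor _.
  have /andP[u1 u2] := floor_itv (n%:R * psi w); rewrite -/u in u1 u2.
  have := psiB w; rewrite ler_norml => /andP[p1 p2].
  have nB : n%:R * B < M%:R by exact: truncnS_gt.
  have uM : u < M%:Z.
    rewrite -(ltr_int R); apply: (le_lt_trans u1); apply: le_lt_trans nB.
    by rewrite ler_pM2l.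
  have uN : - M%:Z <= u.
    rewrite -ltzD1 -(ltr_int R); apply: lt_trans u2.
    rewrite mulrNz ltrNl (le_lt_trans _ nB)// -mulrN ler_pM2l//.
    by rewrite lerNl.
  have uM0 : 0 <= u + M%:Z by rewrite -lerBlDr sub0r.
  have zlt : (absz (u + M%:Z)%R < M + M)%N.
    by rewrite -ltz_nat gez0_abs// PoszD ltrD2r.
  pose z0 := Ordinal zlt.
  have cz0 : c z0 = u by rewrite /c/= gez0_abs// addrK.
  rewrite /step (bigD1 z0)//= big1 ?addr0 => [|z zz0].
    by rewrite cz0 indicE mem_set ?mulr1// /E/= cz0.
  rewrite indicE memNset ?mulr0// /E/= -/u -cz0 => /eqP.
  rewrite /c (inj_eq (addIr _)) eqz_nat => /eqP zE.
  by move/eqP: zz0; apply; apply: val_inj.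
have step_near w : `|psi w - step w| <= n%:R^-1.
  have /andP[u1 u2] := floor_itv (n%:R * psi w).
  rewrite stepE; have -> : psi w - (Num.floor (n%:R * psi w))%:~R / n%:R =
     (n%:R * psi w - (Num.floor (n%:R * psi w))%:~R) / n%:R by field; rewrite gt_eqF.
  have ni : 0 <= n%:R^-1 :> R by rewrite invr_ge0 ltW.
  rewrite normrM [`|n%:R^-1|]ger0_norm// ler_piMl//.
  rewrite ger0_norm ?subr_ge0//; move: u2; rewrite intrD mulr1z; lra.
have mstep : measurable_fun setT step.
  by apply: measurable_sum => z; apply: measurable_funM => //; exact: m1.
have step_le w : `|step w| <= B + n%:R^-1.
  rewrite -[step w](subrK (psi w)) addrC (le_trans (ler_normD _ _))// lerD//.
  by rewrite distrC.
have step_mean (g : O -> R) : measurable_fun setT g -> (forall w, `|g w| <= 1) ->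
    \int[P]_w (g w * step w) =
    \sum_z (c z)%:~R / n%:R * \int[P]_w (g w * \1_(E z) w).
  move=> mg g1.
  have iz z : P.-integrable setT (EFin \o (fun w => g w * \1_(E z) w)).
    apply: (@bounded_integrable _ _ _ _ _ 1); first by apply: measurable_funM => //; exact: m1.
    by move=> w; rewrite normrM mulr_ile1.
  have -> : \int[P]_w (g w * step w) =
      \int[P]_w (\sum_z (c z)%:~R / n%:R * (g w * \1_(E z) w)).
    by apply: eq_Rintegral => w _; rewrite /step mulr_sumr; apply: eq_bigr => z _; rewrite mulrCA.
  rewrite Rintegral_sum => [|z]; last exact: (integrableZl measurableT _ (iz z)).
  by apply: eq_bigr => z _; rewrite RintegralZl.
have key (g : O -> R) : measurable_fun setT g -> (forall w, `|g w| <= 1) ->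
    `|\int[P]_w (g w * psi w) - \int[P]_w (g w * step w)| <= n%:R^-1.
  move=> mg g1.
  have mgp : measurable_fun setT (fun w => g w * psi w) by exact: measurable_funM.
  have mgs : measurable_fun setT (fun w => g w * step w) by exact: measurable_funM.
  have := @mean_near _ _ _ P (fun w => g w * psi w) (fun w => g w * step w)
    (B + n%:R^-1) 0 n%:R^-1 set0 mgp mgs.
  rewrite mulr0 addr0; apply => //.
  - move=> w; rewrite normrM -[leRHS]mul1r ler_pM// (le_trans (psiB w))// lerDl invr_ge0.
    exact: ltW.
  - by move=> w; rewrite normrM -[leRHS]mul1r ler_pM.
  - by rewrite measure0.
  - by move=> w _; rewrite -mulrBr normrM -[leRHS]mul1r ler_pM.
have k1 := key _ (m1 _ mA) (ind_le A).
have k2 := key _ mf f_abs.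
have e1 : \int[P]_w (\1_A w * step w) = \int[P]_w (f w * step w).
  rewrite (step_mean _ (m1 _ mA) (ind_le A)) (step_mean _ mf f_abs).
  by apply: eq_bigr => z _; rewrite cond_mean_indic.
rewrite e1 in k1; rewrite distrC in k2.
apply: (le_trans (ler_distD (\int[P]_w (f w * step w)) _ _)).
apply: le_trans ne; rewrite mulrDl mul1r; exact: lerD.
Qed.

End conditional_mean.

Section empirical_measure.
Context (R : realType) (N S : nat).
Hypothesis N0 : (0 < N)%N.

Lemma empirical_sum (x : 'I_N -> 'I_S) (h : 'I_S -> R) :
  \sum_i empirical R x 0 i * h i = N%:R^-1 * \sum_n h (x n).
Proof.
under eq_bigr do rewrite mxE -mulrA mulr_suml.
rewrite -mulr_sumr exchange_big; congr (_ * _); apply: eq_bigr => n _.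
rewrite (bigD1 (x n))//= eqxx mul1r big1 ?addr0// => i xi.
by rewrite eq_sym (negbTE xi) mul0r.
Qed.

Lemma empirical_simplex (x : 'I_N -> 'I_S) : simplex (empirical R x).
Proof.
split=> [i|]; first by rewrite mxE mulr_ge0 ?invr_ge0// sumr_ge0.
have := empirical_sum x (fun=> 1).
rewrite sumr_const card_ord mulVf ?pnatr_eq0 -?lt0n// => h; rewrite -[RHS]h.
by apply: eq_bigr => i _; rewrite mulr1.
Qed.

End empirical_measure.

Section finite_states.
Context (d : measure_display) (O : measurableType d) (R : realType) (N S : nat).
Context (y : 'I_N -> O -> 'I_S).
Hypothesis y_meas : forall n i, measurable (y n @^-1` [set i]).

Lemma state_measurable (z : 'I_N -> 'I_S) : measurable [set w | forall n, y n w = z n].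
Proof.
rewrite (_ : mkset _ = \bigcap_n (y n @^-1` [set z n])).
  by apply: fin_bigcap_measurable => //; exact: finite_finset.
by apply/seteqP; split => w /= h n; [move=> _; exact: h|exact: (h n Logic.I)].
Qed.

(** Exactly one configuration is realised at [w]. A function of the particle states thus becomes a
    finite sum of indicators, for measurability as well as for conditional means. *)
Lemma sum_state_indicator (h : {ffun 'I_N -> 'I_S} -> R) w :
  \sum_(z : {ffun 'I_N -> 'I_S}) \1_[set w | forall n, y n w = z n] w * h z =
  h [ffun n => y n w].
Proof.
rewrite (bigD1 [ffun n => y n w])//= [X in _ + X]big1 ?addr0 => [|z zy].
  by rewrite indicE mem_set ?mul1r//= => n; rewrite ffunE.
rewrite indicE memNset ?mul0r//= => yz; move/eqP: zy; apply.
by apply/ffunP => n; rewrite ffunE yz.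
Qed.

Lemma measurable_fun_state (h : {ffun 'I_N -> 'I_S} -> O -> R) :
  (forall z, measurable_fun setT (h z)) ->
  measurable_fun setT (fun w => h [ffun n => y n w] w).
Proof.
move=> mh; under eq_fun do rewrite -(sum_state_indicator (h ^~ _)).
apply: measurable_sum => z; apply: measurable_funM => //.
by apply: measurable_indic; exact: state_measurable.
Qed.

End finite_states.

Section particle_step.
Context (d : measure_display) (O : measurableType d) (R : realType)
  (P : probability O R) (N S k : nat).
Hypothesis N0 : (0 < N)%N.
Context (K : 'rV[R]_k -> 'M[R]_S).
Hypothesis K_stochastic : forall c, stochastic (K c).
Hypothesis K_continuous : forall i j, continuous (fun c => K c i j).
Context (Gen : set (set O)).
Hypothesis Gen_sub : Gen `<=` measurable.
Local Notation OF := (g_sigma_algebraType Gen).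
Context (x y : 'I_N -> O -> 'I_S) (C : O -> 'rV[R]_k).
Hypothesis x_meas : forall n i, <<s Gen >> (x n @^-1` [set i]).
Hypothesis C_meas : @random_mx _ OF R _ _ C.
Hypothesis y_meas : forall n i, measurable (y n @^-1` [set i]).
Hypothesis y_cond : forall z : 'I_N -> 'I_S,
  cond_prob_version P <<s Gen >> [set w | forall n, y n w = z n]
    (fun w => \prod_(n < N) K (C w) (x n w) (z n)).

Let p w (n : 'I_N) (j : 'I_S) : R := K (C w) (x n w) j.

Let p_ge0 w n j : 0 <= p w n j.
Proof. by have [/(_ j)] := K_stochastic (C w) (x n w); rewrite mxE. Qed.

Let p_sum1 w n : \sum_j p w n j = 1.
Proof. by have [_ <-] := K_stochastic (C w) (x n w); apply: eq_bigr => j _; rewrite mxE. Qed.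

Let p_le1 w n j : p w n j <= 1.
Proof.
rewrite -(p_sum1 w n) (bigD1 j)//= lerDl; apply: sumr_ge0 => i _; exact: p_ge0.
Qed.

Lemma state_indicator_measurable (n : 'I_N) i :
  @measurable_fun _ _ OF R setT (fun w => (x n w == i)%:R).
Proof.
rewrite (_ : (fun w => _) = \1_(x n @^-1` [set i])); last first.
  apply/funext => w; rewrite indicE; congr (_%:R); congr nat_of_bool.
  by apply/eqP/idP; rewrite inE.
by apply: measurable_indic; exact: x_meas.
Qed.

Lemma kernel_measurable n j : @measurable_fun _ _ OF R setT (fun w => p w n j).
Proof.
rewrite (_ : (fun w => _) = fun w => \sum_i (x n w == i)%:R * K (C w) i j); last first.
  apply/funext => w; rewrite (bigD1 (x n w))//= eqxx mul1r big1 ?addr0// => i xi.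
  by rewrite eq_sym (negbTE xi) mul0r.
apply: measurable_sum => i; apply: measurable_funM; first exact: state_indicator_measurable.
exact: (@measurable_comp_continuous _ OF _ _ _ C (fun c => K c i j)).
Qed.

(** Given the history, the new configuration follows the product measure of [p w], while [Phi] may
    itself depend on the history. After splitting over configurations, [cond_mean] applies to each
    term. *)
Lemma particle_mean (Phi : O -> {ffun 'I_N -> 'I_S} -> R) B :
  (forall z, @measurable_fun _ _ OF R setT (Phi ^~ z)) ->
  (forall w z, `|Phi w z| <= B) ->
  \int[P]_w Phi w [ffun n => y n w] = \int[P]_w prodE (p w) (Phi w).
Proof.
move=> mPhi PhiB.
have mPhiO z : measurable_fun setT (Phi ^~ z) by exact: (sigma_measurable_fun Gen_sub).
have mp (z : {ffun 'I_N -> 'I_S}) : measurable_fun setT (fun w => \prod_n p w n (z n)).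
  by apply: (sigma_measurable_fun Gen_sub); apply: measurable_prod => n _; exact: kernel_measurable.
have p01 (z : {ffun 'I_N -> 'I_S}) w : 0 <= \prod_n p w n (z n) <= 1.
  apply/andP; split; first exact: prodr_ge0.
  by apply: prodr_ile1 => n _; rewrite p_ge0 p_le1.
pose A (z : {ffun 'I_N -> 'I_S}) := [set w | forall n, y n w = z n].
have mA z : measurable (A z) by exact: state_measurable.
have i1 (z : {ffun 'I_N -> 'I_S}) : P.-integrable setT (EFin \o (fun w => \1_(A z) w * Phi w z)).
  apply: (@bounded_integrable _ _ _ _ _ B); first by apply: measurable_funM => //; exact: measurable_indic.
  move=> w; rewrite indicE; case: (_ \in _); rewrite ?mul1r ?mul0r ?normr0//.
  exact: le_trans (PhiB w z).
have i2 (z : {ffun 'I_N -> 'I_S}) : P.-integrable setT (EFin \o (fun w => (\prod_n p w n (z n)) * Phi w z)).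
  apply: (@bounded_integrable _ _ _ _ _ B); first by apply: measurable_funM.
  move=> w; rewrite normrM; have /andP[p0 p1] := p01 z w.
  by rewrite (ger0_norm p0) (le_trans _ (PhiB w z))// ler_piMl.
transitivity (\sum_(z : {ffun 'I_N -> 'I_S}) \int[P]_w (\1_(A z) w * Phi w z)).
  rewrite -Rintegral_sum//; apply: eq_Rintegral => w _.
  by rewrite -(sum_state_indicator _ (Phi w)).
rewrite -[RHS]/(\int[P]_w \sum_(z : {ffun 'I_N -> 'I_S}) ((\prod_n p w n (z n)) * Phi w z)) Rintegral_sum//.
apply: eq_bigr => z _.
exact: (cond_mean Gen_sub (mA z) (p01 z) (y_cond z) (mPhi z) (PhiB ^~ z)).
Qed.

Variable v : 'rV[R]_S.

Let sqN : R := Num.sqrt N%:R.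

Let sqN0 : 0 < sqN. Proof. by rewrite sqrtr_gt0 ltr0n. Qed.

Let sqN2 : sqN ^+ 2 = N%:R. Proof. by rewrite sqr_sqrtr. Qed.

(* [sqrt N] times the fluctuation of the next empirical measure around its
   conditional mean, in direction [v]. *)
Definition noise w : R := sqN * \sum_j v 0 j *
  (empirical R (y ^~ w) 0 j - (empirical R (x ^~ w) *m K (C w)) 0 j).

(** The variance of [v] under each row of the kernel, averaged over [M]. At the empirical measure it
    is the conditional variance of [noise]. *)
Definition kernel_var (M : 'rV[R]_S) (c : 'rV[R]_k) : R :=
  \sum_i M 0 i * \sum_j K c i j * (v 0 j - \sum_l K c i l * v 0 l) ^+ 2.

(** The centred contribution of particle [n] when it jumps to [j]; the factors sqrt N and 1/N
    combine into 1 / sqrt N. *)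
Let u w (n : 'I_N) (j : 'I_S) : R := (v 0 j - \sum_l p w n l * v 0 l) / sqN.

Let u_mean0 w n : \sum_j p w n j * u w n j = 0.
Proof.
rewrite /u; under eq_bigr do rewrite mulrA mulrBr.
by rewrite -mulr_suml sumrB -[X in _ - X]mulr_suml p_sum1 mul1r subrr mul0r.
Qed.

Let u_le w n j : `|u w n j| <= 2 * `|v| / sqN.
Proof.
rewrite /u normrM [`|sqN^-1|]gtr0_norm ?invr_gt0// ler_wpM2r ?invr_ge0 ?(ltW sqN0)//.
rewrite (le_trans (ler_normB _ _))// mulr_natl mulr2n lerD ?mx_entry_le//.
rewrite (le_trans (ler_norm_sum _ _ _))// -[leRHS]mul1r -(p_sum1 w n) mulr_suml.
by apply: ler_sum => l _; rewrite normrM (ger0_norm (p_ge0 _ _ _)) ler_wpM2l// mx_entry_le.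
Qed.

Let noiseE w : noise w = \sum_n u w n ([ffun n => y n w] n).
Proof.
rewrite /noise; under eq_bigr do rewrite mulrBr mulrC [X in _ - X]mulrC.
rewrite sumrB empirical_sum.
have -> : \sum_j (empirical R (x^~ w) *m K (C w)) 0 j * v 0 j =
    N%:R^-1 * \sum_n \sum_l p w n l * v 0 l.
  rewrite -(empirical_sum (x ^~ w) (fun i => \sum_l K (C w) i l * v 0 l)).
  under eq_bigr do rewrite mxE mulr_suml.
  rewrite exchange_big; apply: eq_bigr => i _; rewrite /= mulr_sumr.
  by apply: eq_bigr => l _; rewrite mulrA.
rewrite -mulrBr mulrA -sumrB -sqN2 mulr_sumr; apply: eq_bigr => n _.
by rewrite /u ffunE; field; rewrite gt_eqF.
Qed.

Let varE w : \sum_n \sum_j p w n j * u w n j ^+ 2 =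
  kernel_var (empirical R (x ^~ w)) (C w).
Proof.
rewrite /kernel_var empirical_sum mulr_sumr; apply: eq_bigr => n _.
rewrite mulr_sumr; apply: eq_bigr => j _.
by rewrite /u /p -sqN2; field; rewrite gt_eqF.
Qed.

Let u_meas n j : @measurable_fun _ _ OF R setT (fun w => u w n j).
Proof.
apply: measurable_funM => //; apply: measurable_funB => //.
apply: measurable_sum => l; apply: measurable_funM => //; exact: kernel_measurable.
Qed.

Let usum_meas (z : {ffun 'I_N -> 'I_S}) :
  @measurable_fun _ _ OF R setT (fun w => \sum_n u w n (z n)).
Proof. by apply: measurable_sum => n; exact: u_meas. Qed.

Lemma kernel_var_ge0 w : 0 <= kernel_var (empirical R (x ^~ w)) (C w).
Proof.
by rewrite -varE; apply: sumr_ge0 => n _; apply: sumr_ge0 => j _; rewrite mulr_ge0 ?sqr_ge0.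
Qed.

Lemma kernel_var_le w : kernel_var (empirical R (x ^~ w)) (C w) <= 4 * `|v| ^+ 2.
Proof.
rewrite -varE.
apply: (@le_trans _ _ (\sum_(n < N) (2 * `|v| / sqN) ^+ 2)).
  apply: ler_sum => n _; apply: (var_le (p_ge0 w) (p_sum1 w) (u_le w) n).
  by rewrite divr_ge0 ?mulr_ge0 ?(ltW sqN0).
rewrite sumr_const card_ord -[leLHS]mulr_natl -sqN2 le_eqVlt; apply/orP; left; apply/eqP.
by field; rewrite gt_eqF.
Qed.

Lemma kernel_var_measurable :
  measurable_fun setT (fun w => kernel_var (empirical R (x ^~ w)) (C w)).
Proof.
apply: (sigma_measurable_fun Gen_sub).
under eq_fun do rewrite -varE.
apply: measurable_sum => n; apply: measurable_sum => j; apply: measurable_funM.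
  exact: kernel_measurable.
by apply: measurable_funX; exact: u_meas.
Qed.

Lemma noise_measurable : measurable_fun setT noise.
Proof.
rewrite (_ : noise = fun w => \sum_n u w n ([ffun n => y n w] n)); last first.
  by apply/funext => w; rewrite noiseE.
apply: (measurable_fun_state y_meas (h := fun z w => \sum_n u w n (z n))) => z.
exact: (sigma_measurable_fun Gen_sub).
Qed.

Let usum_le w (z : {ffun 'I_N -> 'I_S}) :
  `|\sum_n u w n (z n)| <= N%:R * (2 * `|v| / sqN).
Proof.
rewrite (le_trans (ler_norm_sum _ _ _))//.
apply: (@le_trans _ _ (\sum_(n < N) (2 * `|v| / sqN))).
  by apply: ler_sum => n _; exact: u_le.
by rewrite sumr_const card_ord [leRHS]mulr_natl lexx.
Qed.

(** Conditional independence removes the cross terms, so the second moment is the mean of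
    [kernel_var], bounded uniformly in N. *)
Lemma noise_sqr_mean_le : \int[P]_w (noise w ^+ 2) <= 4 * `|v| ^+ 2.
Proof.
under eq_Rintegral do rewrite noiseE.
rewrite (@particle_mean (fun w z => (\sum_n u w n (z n)) ^+ 2) ((N%:R * (2 * `|v| / sqN)) ^+ 2)).
- have -> : \int[P]_w prodE (p w) (fun z => (\sum_n u w n (z n)) ^+ 2) =
      \int[P]_w kernel_var (empirical R (x ^~ w)) (C w).
    apply: eq_Rintegral => w _; rewrite -varE.
    rewrite -[RHS]add0r -[X in X + _](expr0n R 2) -(prodE_sqr (p_sum1 w) (u_mean0 w)).
    by apply: eq_prodE => z; rewrite add0r.
  apply: (le_trans (ler_norm _)); apply: normr_mean_le.
    exact: kernel_var_measurable.
  by move=> w; rewrite ger0_norm ?kernel_var_ge0 ?kernel_var_le.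
- by move=> z; apply: measurable_funX; exact: usum_meas.
- move=> w z; rewrite normrX lerXn2r ?nnegrE ?usum_le//.
  by rewrite mulr_ge0// divr_ge0 ?mulr_ge0// ltW.
Qed.

Lemma noise_tail (e : R) : 0 < e ->
  exists E, [/\ measurable E, (P E <= e%:E)%E &
    forall w, ~ E w -> noise w ^+ 2 <= (4 * `|v| ^+ 2 + 1) / e].
Proof.
(* Chebyshev's threshold; the summand 1 keeps it positive when [v] is 0. *)
move=> e0; set kappa := _ / e.
have mn2 : measurable_fun setT (fun w => noise w ^+ 2).
  by apply: measurable_funX; exact: noise_measurable.
have v0 : 0 <= 4 * `|v| ^+ 2 by rewrite mulr_ge0 ?exprn_ge0.
have kappa0 : 0 < kappa by rewrite divr_gt0// ltr_wpDl.
exists [set w | kappa < noise w ^+ 2].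
set E := [set w | _].
have mE : measurable E.
  have := mn2 measurableT _ (measurable_itv `]kappa, +oo[); rewrite setTI.
  by congr measurable; apply/seteqP; split => w /=; rewrite in_itv/= andbT.
split => //; last by move=> w /negP; rewrite -leNgt.
have m1 : measurable_fun setT (\1_E : O -> R) by exact: measurable_indic.
have i1 : P.-integrable setT (EFin \o (\1_E : O -> R)).
  apply: (@bounded_integrable _ _ _ _ _ 1) => // w.
  by rewrite indicE; case: (_ \in _); rewrite ?normr1 ?normr0.
have h : kappa * \int[P]_w \1_E w <= 4 * `|v| ^+ 2.
  apply: le_trans noise_sqr_mean_le; rewrite -RintegralZl//; apply: le_Rintegral => //.
  - exact: (integrableZl measurableT kappa i1).
  - apply: (@bounded_integrable _ _ _ _ _ ((N%:R * (2 * `|v| / sqN)) ^+ 2)) => // w.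
    rewrite normrX lerXn2r ?nnegrE ?noiseE ?usum_le//.
    by rewrite mulr_ge0// divr_ge0 ?mulr_ge0// ltW.
  - move=> w _; rewrite indicE; case: (boolP (w \in E)) => [|_].
      by rewrite inE mulr1 => /ltW.
    by rewrite mulr0 sqr_ge0.
have -> : (P E = (\int[P]_w \1_E w)%:E)%E.
  by rewrite /Rintegral integral_indic// setIT fineK// fin_num_measure.
rewrite lee_fin -(ler_pM2l kappa0) (le_trans h)//.
by rewrite /kappa mulfVK ?gt_eqF// lerDl.
Qed.

(** [prodE_cos] holds for every history, with [A w] as phase and summands bounded by
    [2 * |v| / sqrt N]. The error equals 24 |v|^3 / sqrt N. *)
Lemma noise_cos (A : O -> R) : @measurable_fun _ _ OF R setT A ->
  2 * `|v| / sqN <= 1 ->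
  `|\int[P]_w cos (A w + noise w) -
    \int[P]_w (cos (A w) * expR (- kernel_var (empirical R (x ^~ w)) (C w) / 2))| <=
  N%:R * (3 * (2 * `|v| / sqN) ^+ 3).
Proof.
move=> mA b1.
have b0 : 0 <= 2 * `|v| / sqN by rewrite divr_ge0 ?mulr_ge0// ltW.
under eq_Rintegral do rewrite noiseE.
rewrite (@particle_mean (fun w z => cos (A w + \sum_n u w n (z n))) 1); last 2 first.
- move=> z; apply: measurable_cos_comp; apply: measurable_funD => //; exact: usum_meas.
- by move=> w z; exact: normr_cos_le.
have mAO := sigma_measurable_fun Gen_sub mA.
have mG : measurable_fun setT (fun w => cos (A w) *
    expR (- kernel_var (empirical R (x ^~ w)) (C w) / 2)).
  apply: measurable_funM; first exact: measurable_cos_comp.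
  apply: measurableT_comp => //; apply: measurable_funM => //.
  by apply: measurableT_comp => //; exact: kernel_var_measurable.
have mF : measurable_fun setT (fun w => prodE (p w) (fun z => cos (A w + \sum_n u w n (z n)))).
  apply: (sigma_measurable_fun Gen_sub).
  apply: measurable_sum => z; apply: measurable_funM.
    by apply: measurable_prod => n _; exact: kernel_measurable.
  apply: measurable_cos_comp; apply: measurable_funD => //; exact: usum_meas.
have := @mean_near _ _ _ P _ _ 1 0 (N%:R * (3 * (2 * `|v| / sqN) ^+ 3)) set0 mF mG.
rewrite mulr0 addr0; apply => //.
- move=> w; rewrite (le_trans (normr_prodE (p_ge0 w) _))//.
  rewrite -[leRHS](prodE_cst (p_sum1 w)); apply: le_prodE => // z; exact: normr_cos_le.
- move=> w; rewrite normrM mulr_ile1 ?normr_cos_le//.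
  rewrite ger0_norm ?expR_ge0// -[leRHS]expR0 ler_expR.
  by have := kernel_var_ge0 w; lra.
- by rewrite measure0.
- by rewrite mulr_ge0// mulr_ge0// exprn_ge0.
- move=> w _; rewrite -varE.
  have := prodE_cos (p_ge0 w) (p_sum1 w) (u_mean0 w) (u_le w) b1 (A w) b0.
  by rewrite card_ord.
Qed.

End particle_step.

(** * Linearisation of one step *)

Section delta_method.
Context (R : realType).

Lemma sqrtn_large (a : R) : \forall N \near \oo, a < Num.sqrt N%:R :> R.
Proof.
near=> N.
apply: (@le_lt_trans _ _ `|a|); first exact: ler_norm.
rewrite -[ltLHS]ger0_norm// -sqrtr_sqr ltr_sqrt; last first.
  rewrite ltr0n; near: N; exact: nbhs_infty_gt.
apply: lt_le_trans (truncnS_gt _) _; rewrite ler_nat.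
by near: N; exact: nbhs_infty_ge.
Unshelve. all: by end_near. Qed.

Lemma sqrtn_gt0 : \forall N \near \oo, 0 < Num.sqrt N%:R :> R.
Proof. exact: sqrtn_large. Qed.

(** The displacement is at most [K / sqrt N], so the little-o of the differential is uniform over
    the ball of radius [K]. This uniformity allows random [xi], outcome by outcome. *)
Lemma delta_method (V W : normedModType R) (f : V -> W) (x : V) (K e : R) :
  differentiable f x -> 0 < e ->
  \forall N \near \oo, forall xi : V, `|xi| <= K ->
  `|Num.sqrt N%:R *: (f (x + (Num.sqrt N%:R)^-1 *: xi) - f x) - 'd f x xi| <= e.
Proof.
move=> df e0.
pose K1 := `|K| + 1.
have K10 : 0 < K1 by rewrite ltr_wpDl.
have eta0 : 0 < e / K1 by rewrite divr_gt0.
have /eqaddoP/(_ _ eta0)/nbhs_ballP[r /= r0 rf] := diff_locally df.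
near=> N.
have sN0 : 0 < Num.sqrt N%:R :> R by near: N; exact: sqrtn_gt0.
have sNr : K1 / r < Num.sqrt N%:R by near: N; exact: sqrtn_large.
move: sN0 sNr; set sN := Num.sqrt N%:R => sN0 sNr xi xiK.
have xiK1 : `|xi| <= K1.
  by rewrite (le_trans xiK)// (le_trans (ler_norm K))// lerDl.
pose h := sN^-1 *: xi.
have hn : `|h| = `|xi| / sN by rewrite normrZ gtr0_norm ?invr_gt0// mulrC.
have hr : ball (0 : V) r h.
  rewrite -ball_normE /ball_/= sub0r normrN hn ltr_pdivrMr//.
  by rewrite (le_lt_trans xiK1)// mulrC -ltr_pdivrMr.
have := rf _ hr; rewrite !fctE /= => H.
have -> : sN *: (f (x + h) - f x) - 'd f x xi =
    sN *: (f (h + x) - (f x + 'd f x h)).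
  have -> : 'd f x xi = sN *: 'd f x h.
    by rewrite -linearZ/= /h scalerA mulfV ?scale1r// gt_eqF.
  by rewrite -scalerBr opprD addrA [h + x]addrC.
rewrite normrZ gtr0_norm// mulrC -ler_pdivlMr//.
apply: (le_trans H); rewrite hn mulrA ler_pM2r ?invr_gt0//.
by rewrite mulrAC ler_pdivrMr// ler_pM2l.
Unshelve. all: by end_near. Qed.

End delta_method.

Section linear_maps.
Context (R : realType).

Lemma mulmx_norm_le p n (z : 'rV[R]_p) (D : 'M[R]_(p, n)) :
  `|z *m D| <= p%:R * `|D| * `|z|.
Proof.
apply: mx_norm_le => [|i j]; first by rewrite !mulr_ge0.
rewrite mxE (le_trans (ler_norm_sum _ _ _))//.
apply: (@le_trans _ _ (\sum_(k < p) `|D| * `|z|)).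
  by apply: ler_sum => k _; rewrite normrM mulrC ler_pM ?mx_entry_le.
by rewrite sumr_const card_ord -[leLHS]mulr_natl mulrA.
Qed.

Lemma row_mx_norm_le n1 n2 (x : 'rV[R]_n1) (y : 'rV[R]_n2) K :
  `|x| <= K -> `|y| <= K -> `|row_mx x y| <= K.
Proof.
move=> xK yK; apply: mx_norm_le => [|i j]; first exact: le_trans xK.
rewrite mxE; case: (fintype.split j) => l; first exact: le_trans (mx_entry_le x i l) xK.
exact: le_trans (mx_entry_le y i l) yK.
Qed.

Lemma lsubmx_norm_le n1 n2 (z : 'rV[R]_(n1 + n2)) : `|lsubmx z| <= `|z|.
Proof. by apply: mx_norm_le => // i j; rewrite mxE mx_entry_le. Qed.

Lemma rsubmx_norm_le n1 n2 (z : 'rV[R]_(n1 + n2)) : `|rsubmx z| <= `|z|.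
Proof. by apply: mx_norm_le => // i j; rewrite mxE mx_entry_le. Qed.

Lemma pair_norm_le (V W : normedModType R) (x : V) (y : W) K :
  `|x| <= K -> `|y| <= K -> `|(x, y)| <= K.
Proof. by move=> xK yK; rewrite prod_normE ge_max xK. Qed.

(** Writes a differential on a product space as a matrix acting on concatenated rows, so that it can
    be composed and transposed. *)
Lemma linear_pair_mx n1 n2 n3
  (f : 'rV[R]_n1 * 'rV[R]_n2 -> 'rV[R]_n3) : linear f ->
  exists D : 'M[R]_(n1 + n2, n3), forall x y, f (x, y) = row_mx x y *m D.
Proof.
move=> flin.
have fD x y : f (x + y) = f x + f y by rewrite -[x]scale1r flin !scale1r.
have f0 : f 0 = 0 by apply: (addrI (f 0)); rewrite -fD !addr0.
have fZ (a : R) x : f (a *: x) = a *: f x by rewrite -[a *: x]addr0 flin f0 addr0.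
pose h (z : 'rV[R]_(n1 + n2)) := f (lsubmx z, rsubmx z).
exists (\matrix_(k, j) h (delta_mx 0 k) 0 j) => x y.
have hD z1 z2 : h (z1 + z2) = h z1 + h z2.
  rewrite /h -fD; congr (f _).
  rewrite -[RHS]/(lsubmx z1 + lsubmx z2, rsubmx z1 + rsubmx z2).
  by congr (_, _); apply/matrixP => i j; rewrite !mxE.
have hZ (a : R) z : h (a *: z) = a *: h z.
  rewrite /h -fZ; congr (f _).
  rewrite -[RHS]/(a *: lsubmx z, a *: rsubmx z).
  by congr (_, _); apply/matrixP => i j; rewrite !mxE.
have hsum (I : Type) (r : seq I) (F : I -> 'rV[R]_(n1 + n2)) :
    h (\sum_(i <- r) F i) = \sum_(i <- r) h (F i).
  elim: r => [|i r IH]; last by rewrite !big_cons hD IH.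
  by rewrite !big_nil -[0 in LHS](scale0r 0) hZ scale0r.
have -> : f (x, y) = h (row_mx x y) by rewrite /h row_mxKl row_mxKr.
rewrite [in LHS](row_sum_delta (row_mx x y)) hsum.
apply/rowP => j; rewrite summxE mxE; apply: eq_bigr => k _.
by rewrite hZ !mxE.
Qed.

End linear_maps.

Section one_step.
Context (R : realType) (S d : nat).
Context (K : 'rV[R]_d -> 'M[R]_S) (g : 'rV[R]_d -> 'rV[R]_S -> 'rV[R]_d).
Context (m m' : 'rV[R]_S) (c c' : 'rV[R]_d).
Hypothesis m_step : m' = m *m K c.
Hypothesis c_step : c' = g c m'.
Hypothesis dK : forall i j, differentiable (fun x => K x i j) c.
Hypothesis dg : differentiable (fun z : 'rV[R]_d * 'rV[R]_S => g z.1 z.2) (c, m').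

Let F (z : 'rV[R]_S * 'rV[R]_d) : 'rV[R]_S := z.1 *m K z.2.

Lemma differentiable_mean_step : differentiable F (m, c).
Proof.
have -> : F = (\sum_(j < S) (fun z => (\sum_(i < S) (fun z : 'rV[R]_S * 'rV[R]_d =>
    z.1 0 i * K z.2 i j)) z *: (delta_mx 0 j : 'rV[R]_S))).
  apply/funext => z; apply/rowP => j; rewrite fct_sumE summxE /F mxE.
  rewrite [RHS](bigD1 j)//= [X in _ = _ + X]big1 ?addr0 => [|l lj].
    by rewrite !mxE !eqxx mulr1 fct_sumE.
  by rewrite !mxE [j == l]eq_sym (negbTE lj) andbF mulr0.
apply: differentiable_sum => j; apply: differentiableZl.
apply: differentiable_sum => i; apply: differentiableM.
  apply: (differentiable_comp (f := fst) (g := fun x : 'rV[R]_S => x 0 i)).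
    by apply: linear_differentiable => z; exact: cvg_fst.
  exact: differentiable_coord.
apply: (differentiable_comp (f := snd) (g := fun x => K x i j)); last exact: dK.
by apply: linear_differentiable => z; exact: cvg_snd.
Qed.

(** The new measure deviates by [Z *m D + W] up to a small [rho]; the new context depends on this
    deviation and on the old context through the differential of [g]. The estimate is deterministic
    and uniform over bounded deviations, ready for use outcome by outcome. *)
Lemma linearized_step : exists (A : 'M[R]_(S + d)) (B : 'M[R]_(S, S + d)),
  forall kappa e : R, 0 < e ->
  \forall N \near \oo, forall (M M' W : 'rV[R]_S) (C C' : 'rV[R]_d),
    M' = M *m K C + (Num.sqrt N%:R)^-1 *: W -> C' = g C M' ->
    `|fluctuation N M m C c| <= kappa -> `|W| <= kappa ->
    `|fluctuation N M' m' C' c' -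
      (fluctuation N M m C c *m A + W *m B)| <= e.
Proof.
have dF := differentiable_mean_step.
pose G (z : 'rV[R]_d * 'rV[R]_S) := g z.1 z.2.
have [D HD] := linear_pair_mx (linearP ('d F (m, c))).
have [E HE] := linear_pair_mx (linearP ('d G (c, m'))).
pose E1 := usubmx E; pose E2 := dsubmx E.
(* Right multiplication by [J] extracts the context block of a deviation. *)
pose J : 'M[R]_(S + d, d) := col_mx 0 1%:M.
exists (row_mx D (J *m E1 + D *m E2)), (row_mx 1%:M E2).
move=> kappa e e0.
have E21 : 0 < S%:R * `|E2| + 1 by rewrite ltr_wpDl// mulr_ge0.
(* The bound 1 on [rho] fixes the radius [kappa'] in advance; the other bound keeps [rho *m E2]
   below [e / 2]. *)
pose e1 := Num.min 1 (e / 2 / (S%:R * `|E2| + 1)).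
have e10 : 0 < e1 by rewrite lt_min ltr01 !divr_gt0.
have e1e : e1 <= e / 2.
  rewrite ge_min; apply/orP; right; rewrite ler_pdivrMr// ler_peMr ?divr_ge0 ?(ltW e0)//.
  by rewrite lerDr mulr_ge0.
have e20 : 0 < e / 2 by rewrite divr_gt0.
(* A radius valid both for the old context deviation and for the new measure deviation
   [rho + (Z *m D + W)]. *)
pose kappa' := Num.max `|kappa| (`|kappa| + (S + d)%:R * `|D| * `|kappa| + 1).
have e40 : 0 < e / 4 by rewrite divr_gt0.
have H1 := delta_method `|kappa| dF e10.
have H2 := delta_method kappa' dg e40.
near=> N.
have sN0 : 0 < Num.sqrt N%:R :> R by near: N; exact: sqrtn_gt0.
have h1 : forall xi, `|xi| <= `|kappa| ->
    `|Num.sqrt N%:R *: (F ((m, c) + (Num.sqrt N%:R)^-1 *: xi) - F (m, c)) - 'd F (m, c) xi| <= e1.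
  by near: N.
have h2 : forall xi, `|xi| <= kappa' ->
    `|Num.sqrt N%:R *: (G ((c, m') + (Num.sqrt N%:R)^-1 *: xi) - G (c, m')) - 'd G (c, m') xi| <= e / 4.
  by near: N.
rewrite /fluctuation; move: sN0 h1 h2; set sN := Num.sqrt N%:R => sN0 h1 h2.
move=> M M' W C C' M'E C'E Zk Wk.
have ZE (n1 n2 : nat) (a1 a2 : 'rV[R]_n1) (b1 b2 : 'rV[R]_n2) :
    sN *: (row_mx a1 b1 - row_mx a2 b2) = row_mx (sN *: (a1 - a2)) (sN *: (b1 - b2)).
  by rewrite opp_row_mx add_row_mx scale_row_mx.
rewrite !ZE in Zk *.
set zeta := sN *: (M - m) in Zk *; set gam := sN *: (C - c) in Zk *.
set zeta' := sN *: (M' - m'); set gam' := sN *: (C' - c').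
set Z := row_mx zeta gam in Zk *.
have Zk' : `|Z| <= `|kappa| by rewrite (le_trans Zk)// ler_norm.
have Wk' : `|W| <= `|kappa| by rewrite (le_trans Wk)// ler_norm.
have zk : `|zeta| <= `|kappa|.
  by rewrite (le_trans _ Zk')// -[zeta](row_mxKl _ gam) lsubmx_norm_le.
have gk : `|gam| <= `|kappa|.
  by rewrite (le_trans _ Zk')// -[gam](row_mxKr zeta) rsubmx_norm_le.
have unscale n1 (a1 a2 : 'rV[R]_n1) : a2 + sN^-1 *: (sN *: (a1 - a2)) = a1.
  by rewrite scalerA mulVf ?gt_eqF// scale1r addrC subrK.
have := h1 (zeta, gam) (pair_norm_le zk gk).
rewrite HD -/Z.
have -> : (m, c) + sN^-1 *: (zeta, gam) = (M, C).
  rewrite -[LHS]/(m + sN^-1 *: zeta, c + sN^-1 *: gam).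
  by rewrite /zeta /gam !unscale.
rewrite [F (m, c)]/F/= -m_step.
have -> : sN *: (F (M, C) - m') - Z *m D = zeta' - (Z *m D + W).
  have -> : zeta' = sN *: (F (M, C) - m') + W.
    by rewrite /zeta' M'E addrAC scalerDr scalerA mulfV ?gt_eqF// scale1r.
  by rewrite opprD addrACA subrr addr0.
set rho := zeta' - _ => rho_le.
have rho1 : `|rho| <= 1 by rewrite (le_trans rho_le)// ge_min lexx.
have zetaE : zeta' = rho + (Z *m D + W) by rewrite /rho subrK.
have ZD : `|Z *m D| <= (S + d)%:R * `|D| * `|kappa|.
  by rewrite (le_trans (mulmx_norm_le _ _))// ler_wpM2l ?mulr_ge0.
have zk' : `|zeta'| <= kappa'.
  rewrite le_max; apply/orP; right; rewrite zetaE.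
  rewrite (le_trans (ler_normD _ _))// addrC lerD//.
  by rewrite (le_trans (ler_normD _ _))// addrC lerD.
have gk' : `|gam| <= kappa' by rewrite le_max gk.
have := h2 (gam, zeta') (pair_norm_le gk' zk').
rewrite HE.
have -> : (c, m') + sN^-1 *: (gam, zeta') = (C, M').
  rewrite -[LHS]/(c + sN^-1 *: gam, m' + sN^-1 *: zeta').
  by rewrite /zeta' /gam !unscale.
rewrite /G/= -C'E -c_step -/gam' -[E]vsubmxK mul_row_col -/E1 -/E2 => h3.
have ZJ : Z *m J = gam by rewrite mul_row_col mulmx0 add0r mulmx1.
rewrite mul_mx_row [W *m _]mul_mx_row mulmx1 mulmxDr !mulmxA ZJ add_row_mx.
rewrite opp_row_mx add_row_mx -/rho.
apply: row_mx_norm_le; first by rewrite (le_trans rho_le)// (le_trans e1e)//; lra.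
have -> : gam' - (gam *m E1 + Z *m D *m E2 + W *m E2) =
   (gam' - (gam *m E1 + zeta' *m E2)) + rho *m E2.
  have reassoc (V : zmodType) (x a b w r : V) :
      x - (a + b + w) = (x - (a + (r + (b + w)))) + r.
    by rewrite [r + _]addrC !addrA [in RHS]opprD [in RHS]addrA subrK.
  by rewrite zetaE !mulmxDl -reassoc.
rewrite (le_trans (ler_normD _ _))//.
have : `|rho *m E2| <= e / 2.
  rewrite (le_trans (mulmx_norm_le _ _))//.
  apply: (@le_trans _ _ (S%:R * `|E2| * (e / 2 / (S%:R * `|E2| + 1)))).
    by rewrite ler_wpM2l ?mulr_ge0// (le_trans rho_le)// ge_min lexx orbT.
  by rewrite mulrCA ler_piMr ?(ltW e20)// ler_pdivrMr// mul1r lerDl.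
lra.
Unshelve. all: by end_near. Qed.

End one_step.

(** * Gaussian vectors and tightness criteria *)

Section more_pairing.
Context (R : realType).

Lemma pairingDr m n (U x y : 'M[R]_(m, n)) :
  pairing U (x + y) = pairing U x + pairing U y.
Proof. by rewrite !(pairingC U) pairingDl. Qed.

Lemma pairingZr m n (a : R) (U x : 'M[R]_(m, n)) : pairing U (a *: x) = a * pairing U x.
Proof. by rewrite !(pairingC U) pairingZl. Qed.

Lemma pairing_sumr m n (I : Type) (r : seq I) (U : 'M[R]_(m, n)) (F : I -> 'M[R]_(m, n)) :
  pairing U (\sum_(i <- r) F i) = \sum_(i <- r) pairing U (F i).
Proof.
elim: r => [|i r IH]; last by rewrite !big_cons pairingDr IH.
by rewrite !big_nil pairingC pairing0l.
Qed.

Lemma pairing_mulmx p n (U : 'rV[R]_n) (z : 'rV[R]_p) (A : 'M[R]_(p, n)) :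
  pairing U (z *m A) = pairing (U *m A^T) z.
Proof.
rewrite /pairing !big_ord1.
under eq_bigr do rewrite mxE mulr_sumr.
rewrite exchange_big; apply: eq_bigr => k _; rewrite mxE mulr_suml.
by apply: eq_bigr => j _; rewrite mxE; ring.
Qed.

Lemma pairing_norm_le n (U x : 'rV[R]_n) : `|pairing U x| <= n%:R * `|U| * `|x|.
Proof.
rewrite /pairing big_ord1 (le_trans (ler_norm_sum _ _ _))//.
apply: (@le_trans _ _ (\sum_(k < n) `|U| * `|x|)).
  by apply: ler_sum => k _; rewrite normrM ler_pM ?mx_entry_le.
by rewrite sumr_const card_ord -[leLHS]mulr_natl mulrA.
Qed.

Lemma measurable_pairing (d : measure_display) (O : measurableType d) m n
  (U : 'M[R]_(m, n)) (Y : O -> 'M[R]_(m, n)) :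
  random_mx Y -> measurable_fun setT (fun w => pairing U (Y w)).
Proof.
move=> mY; apply: measurable_sum => i; apply: measurable_sum => j.
by apply: measurable_funM => //; exact: mY.
Qed.

Lemma random_mulmx (d : measure_display) (O : measurableType d) m n p
  (Y : O -> 'M[R]_(m, n)) (A : 'M[R]_(n, p)) :
  random_mx Y -> random_mx (fun w => Y w *m A).
Proof.
move=> mY i j; rewrite (_ : (fun w => _) = fun w => \sum_k Y w i k * A k j).
  by apply: measurable_sum => k; apply: measurable_funM => //; exact: mY.
by apply/funext => w; rewrite mxE.
Qed.

Lemma random_mxD (d : measure_display) (O : measurableType d) m n
  (Y Y' : O -> 'M[R]_(m, n)) :
  random_mx Y -> random_mx Y' -> random_mx (fun w => Y w + Y' w).
Proof.
move=> mY mY' i j; rewrite (_ : (fun w => _) = fun w => Y w i j + Y' w i j).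
  by apply: measurable_funD; [exact: mY|exact: mY'].
by apply/funext => w; rewrite mxE.
Qed.

Lemma random_lincomb (d : measure_display) (O : measurableType d) m n
  (I : Type) (r : seq I) (xi : I -> O -> R) (V : I -> 'M[R]_(m, n)) :
  (forall k, measurable_fun setT (xi k)) ->
  random_mx (fun w => \sum_(k <- r) xi k w *: V k).
Proof.
move=> mxi i j; rewrite (_ : (fun w => _) = fun w => \sum_(k <- r) xi k w * V k i j).
  by apply: measurable_sum => k; apply: measurable_funM.
by apply/funext => w; rewrite summxE; apply: eq_bigr => k _; rewrite mxE.
Qed.

End more_pairing.

Section gaussian_mean.
Context (d : measure_display) (O : measurableType d) (R : realType)
  (P : probability O R) (m n : nat) (Y : O -> 'M[R]_(m, n)).

(** The law of a linear form determines its mean [mu]; linearity and [mean_zero] force [mu = 0]. *)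
Lemma gaussian_mx_cos : gaussian_mx P Y -> mean_zero P Y ->
  forall U, exists sigma : R, forall s u,
    \int[P]_w cos (s + u * pairing U (Y w)) = cos s * expR (- (sigma * u) ^+ 2 / 2).
Proof.
move=> [mY gY] zY U.
have law V : exists mu sigma, P.-integrable setT (EFin \o (fun w => pairing V (Y w))) /\
    \int[P]_w pairing V (Y w) = mu /\
    forall s u, \int[P]_w cos (s + u * pairing V (Y w)) =
      cos (s + u * mu) * expR (- (sigma * u) ^+ 2 / 2).
  have [mu [sigma lawV]] := gY V; exists mu, sigma.
  have [Q [QE Qi Qm Qc]] := gaussian_lawP mu sigma.
  have mV := measurable_pairing V mY.
  have lawQ B : measurable B -> P ((fun w => pairing V (Y w)) @^-1` B) = Q B.
    by move=> mB; rewrite -QE//; exact: lawV.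
  split; first exact: (integrable_law mV lawQ Qi).
  split; first by rewrite -Qm; exact: (integral_law mV lawQ Qi).
  move=> s u; rewrite -Qc; apply: (integral_law mV lawQ (f := fun x => cos (s + u * x))).
  apply: integrable_cos; apply: measurable_funD => //; exact: measurable_funM.
have [mu [sigma [_ [Um Uc]]]] := law U; exists sigma => s u.
suff mu0 : mu = 0 by rewrite Uc mu0 mulr0 addr0.
rewrite -Um.
(* An entry is the linear form of [delta_mx i j], hence integrable because its law is; only with
   this can the mean be split over entries. *)
have iE i j : P.-integrable setT (EFin \o (fun w => U i j * Y w i j)).
  have [_ [_ [id _]]] := law (delta_mx i j).
  have := integrableZl measurableT (U i j) id.
  by apply: eq_integrable => // w _; rewrite /= pairing_delta.
rewrite /pairing Rintegral_sum => [|i]; last exact: integrable_sumR.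
apply: big1 => i _; rewrite Rintegral_sum//; apply: big1 => j _.
have iY : P.-integrable setT (EFin \o (fun w => Y w i j)).
  have [_ [_ [id _]]] := law (delta_mx i j).
  by apply: eq_integrable id => // w _; rewrite /= pairing_delta.
rewrite RintegralZl//.
have := zY i j; rewrite unlock /Rintegral => ->.
by rewrite mulr0.
Qed.

(** By [law_unique] each linear form has the centred Gaussian law with standard deviation
    [Num.sqrt q], degenerate when [q] is 0; the means of the entries follow. *)
Lemma centered_gaussian_mx : random_mx Y ->
  (forall U, exists q : R, 0 <= q /\ forall s u,
    \int[P]_w cos (s + u * pairing U (Y w)) = cos s * expR (- (u ^+ 2 * q) / 2)) ->
  gaussian_mx P Y /\ mean_zero P Y.
Proof.
move=> mY Ycos.
have law U : exists sigma : R, exists Q : probability (measurableTypeR R) R,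
    [/\ forall B, measurable B -> gaussian_law 0 sigma B = Q B,
      Q.-integrable setT (fun x : R => x%:E), \int[Q]_x x = 0 &
      forall B : set R, measurable B -> P ((fun w => pairing U (Y w)) @^-1` B) = Q B].
  have [q [q0 Uq]] := Ycos U.
  have [Q [QE Qi Qm Qc]] := gaussian_lawP 0 (Num.sqrt q).
  exists (Num.sqrt q), Q; split => // B mB.
  apply: (@law_unique _ _ _ _ _ P Q _ id (measurable_pairing U mY)) => // s u.
  by rewrite Uq Qc mulr0 addr0 exprMn sqr_sqrtr// [q * _]mulrC.
split.
  split => // U; have [sigma [Q [QE _ _ lawU]]] := law U.
  by exists 0, sigma => B mB; rewrite QE// -lawU.
move=> i j; have [sigma [Q [_ Qi Qm lawU]]] := law (delta_mx i j).
have mU := measurable_pairing (delta_mx i j) mY.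
have YE : (fun w => Y w i j) = (fun w => pairing (delta_mx i j) (Y w)).
  by apply/funext => w; rewrite pairing_delta.
rewrite YE; have := integral_law mU lawU (f := id) Qi; rewrite Qm.
rewrite unlock /Rintegral => E0.
have := integrable_fin_num measurableT (integrable_law mU lawU (f := id) Qi).
by move=> /fineK <-; rewrite E0.
Qed.

End gaussian_mean.

Section tightness_criteria.
Context (d : measure_display) (O : measurableType d) (R : realType)
  (P : probability O R).

(** Levels are combined by their maximum, whence the monotonicity in the level, and the allowed
    probability is halved at each element. *)
Lemma whp_family (I : eqType) (r : seq I) (Q : R -> I -> nat -> set O) :
  (forall a b i N, a <= b -> Q a i N `<=` Q b i N) ->
  (forall i e, 0 < e -> exists a, whp P e (Q a i)) ->
  forall e, 0 < e -> exists a, whp P e (fun N w => forall i, i \in r -> Q a i N w).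
Proof.
move=> Q_mono QP; elim: r => [|i r IH] e e0.
  by exists 0; apply: whpT; [exact: ltW|near=> N].
have e2 : 0 < e / 2 by rewrite divr_gt0.
have [a1 H1] := IH _ e2; have [a2 H2] := QP i _ e2.
exists (Num.max a1 a2); rewrite [e]splitr; apply: whpS (whpI H1 H2).
near=> N => w [q1 q2] j; rewrite inE => /orP[/eqP->|/q1].
  by apply: Q_mono q2; rewrite le_max lexx orbT.
by apply: Q_mono; rewrite le_max lexx.
Unshelve. all: by end_near. Qed.

Lemma tight_entries m n (Z : nat -> O -> 'M[R]_(m, n)) :
  (forall i j e, 0 < e -> exists a, whp P e (fun N w => `|Z N w i j| <= a)) ->
  tight P Z.
Proof.
move=> H e e0.
have [a Ha] := @whp_family _ (enum {: 'I_m * 'I_n})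
  (fun a ij N w => `|Z N w ij.1 ij.2| <= a)
  (fun a b ij N ab w h => le_trans h ab) (fun ij => H ij.1 ij.2) _ e0.
exists `|a|; apply: whpS Ha; near=> N => w q; apply: mx_norm_le => // i j.
by rewrite (le_trans (q (i, j) _))// ?mem_enum// ler_norm.
Unshelve. all: by end_near. Qed.

(** The test function [f] vanishes on the ball of radius [K] and equals 1 outside that of radius
    [K + 1]: its mean dominates the tail of [Z N] and converges to at most the tail of [G]. *)
Lemma tight_cvg_in_law (d' : measure_display) (O' : measurableType d')
    (P' : probability O' R) m n (Z : nat -> O -> 'M[R]_(m, n))
    (G : O' -> 'M[R]_(m, n)) :
  (\forall N \near \oo, random_mx (Z N)) -> random_mx G ->
  cvg_in_law P P' Z G -> tight P Z.
Proof.
move=> mZ mG /(cvg_in_law_mxP _ _ mZ mG) ZG e e0.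
have e2 : 0 < e / 2 by rewrite divr_gt0.
have [K [K0 [E [mE PE EK]]]] := tight_random_mx P' mG e2.
pose f (x : 'M[R]_(m, n)) := Num.min 1 (Num.max 0 (`|x| - K)).
have cf : continuous f.
  move=> x.
  have hc (a : R) : {for x, continuous (fun _ : 'M[R]_(m, n) => a)} by exact: cst_continuous.
  have h1 : {for x, continuous (fun x : 'M[R]_(m, n) => `|x| - K)}.
    have hn : {for x, continuous (fun x : 'M[R]_(m, n) => `|x|)} by apply: norm_continuous.
    exact: (continuousB hn (hc K)).
  have h2 : {for x, continuous ((fun=> 0) \max (fun x : 'M[R]_(m, n) => `|x| - K))}.
    by apply: (@continuous_max R _ (fun=> 0) _ x (hc 0) h1).
  exact: (@continuous_min R _ (fun=> 1) _ x (hc 1) h2).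
have f01 x : 0 <= f x <= 1 by rewrite le_min ler01 le_max lexx ge_min lexx.
have f1 x : `|f x| <= 1 by have /andP[a b] := f01 x; rewrite ger0_norm.
have fG : \int[P']_w f (G w) <= e / 2.
  have m1 : measurable_fun setT (\1_E : O' -> R) by exact: measurable_indic.
  have i1 : P'.-integrable setT (EFin \o (\1_E : O' -> R)).
    apply: (@bounded_integrable _ _ _ _ _ 1) => // w.
    by rewrite indicE; case: (_ \in _); rewrite ?normr1 ?normr0.
  apply: (@le_trans _ _ (\int[P']_w \1_E w)).
    apply: le_Rintegral => //.
      apply: (@bounded_integrable _ _ _ _ _ 1) => //.
      exact: measurable_comp_continuous.
    move=> w _; rewrite indicE; case: (boolP (w \in E)) => [_|].
      by case/andP: (f01 (G w)).
    rewrite notin_setE => /EK GK.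
    by rewrite ge_min ge_max lexx subr_le0 GK orbT.
  by rewrite /Rintegral integral_indic// setIT -lee_fin fineK// fin_num_measure.
have := ZG f 1 cf f1 => /cvgrPdist_le/(_ _ e2) near_f.
exists (K + 1); near=> N.
have mZN : random_mx (Z N) by near: N.
have fZ : `|\int[P']_w f (G w) - \int[P]_w f (Z N w)| <= e / 2 by near: N.
pose E' := [set w | K + 1 < `|Z N w|].
have mE' : measurable E'.
  have := measurable_normr_mx mZN measurableT (measurable_itv `]K + 1, +oo[).
  by rewrite setTI; congr measurable; apply/seteqP; split => w /=; rewrite in_itv/= andbT.
exists E'; split => //; last by move=> w /negP; rewrite -leNgt.
have -> : (P E' = (\int[P]_w \1_E' w)%:E)%E.
  by rewrite /Rintegral integral_indic// setIT fineK// fin_num_measure.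
rewrite lee_fin.
apply: (@le_trans _ _ (\int[P]_w f (Z N w))); last first.
  by move: fZ fG; rewrite ler_norml => /andP[h1 h2]; lra.
apply: le_Rintegral => //.
- apply: (@bounded_integrable _ _ _ _ _ 1) => // w.
  by rewrite indicE; case: (_ \in _); rewrite ?normr1 ?normr0.
- apply: (@bounded_integrable _ _ _ _ _ 1) => //; exact: measurable_comp_continuous.
- move=> w _; rewrite indicE; case: (boolP (w \in E')) => [|_].
    rewrite inE /E'/= => h; rewrite le_min lexx/= le_max; apply/orP; right; lra.
  by case/andP: (f01 (Z N w)).
Unshelve. all: by end_near. Qed.

Lemma vanishing_sum (I : Type) (r : seq I) (Q : pred I) (F : I -> nat -> O -> R) :
  (forall i, Q i -> vanishing P (F i)) ->
  vanishing P (fun N w => \sum_(i <- r | Q i) F i N w).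
Proof.
move=> FQ; elim: r => [|i r IH] e delta e0 delta0.
  by apply: whpT; [exact: ltW|near=> N => w; rewrite big_nil normr0 ltW].
have [Qi|Qi] := boolP (Q i); last first.
  apply: whpS (IH _ _ e0 delta0); near=> N => w /=.
  by rewrite big_cons (negbTE Qi).
have e2 : 0 < e / 2 by rewrite divr_gt0.
have delta2 : 0 < delta / 2 by rewrite divr_gt0.
rewrite [e]splitr; apply: whpS (whpI (FQ _ Qi _ _ e2 delta2) (IH _ _ e2 delta2)).
near=> N => w [h1 h2]; rewrite big_cons Qi.
by rewrite [delta]splitr (le_trans (ler_normD _ _))// lerD.
Unshelve. all: by end_near. Qed.

(** A continuous [f] is uniformly continuous only near bounded sets, hence the boundedness in
    probability of [Y]. *)
Lemma vanishing_comp (f : R -> R) (X Y : nat -> O -> R) : continuous f ->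
  (forall e, 0 < e -> exists a, whp P e (fun N w => `|Y N w| <= a)) ->
  vanishing P (fun N w => X N w - Y N w) ->
  vanishing P (fun N w => f (X N w) - f (Y N w)).
Proof.
move=> cf tY XY e delta e0 delta0.
have e2 : 0 < e / 2 by rewrite divr_gt0.
have [a Ha] := tY _ e2.
have cg : continuous (fun x : 'M[R]_(1, 1) => f (x 0 0)).
  move=> x; apply: (continuous_comp (f := fun x : 'M[R]_(1, 1) => x 0 0) (g := f)).
    exact: coord_continuous.
  exact: cf.
have [eta eta0 feta] := unif_continuous_bounded (Num.max 0 a) cg delta0.
rewrite [e]splitr; apply: whpS (whpI Ha (XY _ _ e2 eta0)).
near=> N => w [Ya XYeta]; rewrite distrC.
have := feta (const_mx (Y N w)) (const_mx (X N w)); rewrite !mxE => h; apply: h.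
  by apply: mx_norm_le => [|i j]; rewrite ?mxE le_max ?lexx ?Ya ?orbT.
apply: mx_norm_le => [|i j]; first exact: ltW.
by rewrite !mxE distrC.
Unshelve. all: by end_near. Qed.

End tightness_criteria.

(** * Fluctuations of the particle system *)

Lemma simplex_step (R : realType) (S : nat) (p : 'rV[R]_S) (Q : 'M[R]_S) :
  simplex p -> stochastic Q -> simplex (p *m Q).
Proof.
move=> [p0 p1] Qst; split=> [j|].
  rewrite mxE sumr_ge0// => i _; rewrite mulr_ge0//.
  by have [/(_ j)] := Qst i; rewrite mxE.
under eq_bigr do rewrite mxE.
rewrite exchange_big -[RHS]p1; apply: eq_bigr => i _ /=.
rewrite -mulr_sumr -[RHS]mulr1; congr (_ * _).
by have [_ <-] := Qst i; apply: eq_bigr => j _; rewrite mxE.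
Qed.

Lemma eq_empirical (R : realType) (N S : nat) (x y : 'I_N -> 'I_S) :
  x =1 y -> empirical R x = empirical R y.
Proof.
move=> xy; apply/rowP => i; rewrite !mxE; congr (_ * _).
by apply: eq_bigr => n _; rewrite xy.
Qed.

Section particle_system.
Context (R : realType) (S d T : nat).
Context (K : nat -> 'rV[R]_d -> 'M[R]_S)
  (g : nat -> 'rV[R]_d -> 'rV[R]_S -> 'rV[R]_d).
Hypothesis K_stochastic : forall t c, stochastic (K t c).
Hypothesis K_continuous : forall t i j, continuous (fun c => K t c i j).
Hypothesis g_continuous : forall t p, simplex p -> continuous (g t ^~ p).
Context (m : nat -> 'rV[R]_S) (c : nat -> 'rV[R]_d).
Hypothesis m0_simplex : simplex (m 0%N).
Hypothesis m_step : forall t, (t < T)%N -> m t.+1 = m t *m K t (c t).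
Hypothesis c_step : forall t, (t < T)%N -> c t.+1 = g t (c t) (m t.+1).
Context (dO : measure_display) (O : measurableType dO) (P : probability O R).
Context (X : forall N : nat, 'I_N -> nat -> O -> 'I_S)
  (C : nat -> nat -> O -> 'rV[R]_d) (M : nat -> nat -> O -> 'rV[R]_S).
Hypothesis M_def : forall N t w, M N t w = empirical R (fun n : 'I_N => X n t w).
Hypothesis X_measurable : forall (N : nat) (n : 'I_N) (t : nat) (i : 'I_S),
  (t <= T)%N -> measurable (X n t @^-1` [set i]).
Hypothesis C0_measurable : forall N, (1 <= N)%N -> random_mx (C N 0%N).
Hypothesis C_step : forall N t w, (1 <= N)%N -> (t < T)%N ->
  C N t.+1 w = g t (C N t w) (M N t.+1 w).
Hypothesis kernel_step : forall (N t : nat) (y : 'I_N -> 'I_S), (1 <= N)%N -> (t < T)%N ->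
  cond_prob_version P (history (@X N) (C N) t)
    [set w | forall n, X n t.+1 w = y n]
    (fun w => \prod_(n < N) K t (C N t w) (X n t w) (y n)).
Hypothesis K_differentiable : forall t i j, (t < T)%N ->
  differentiable (fun x => K t x i j) (c t).
Hypothesis g_differentiable : forall t, (t < T)%N ->
  differentiable (fun z : 'rV[R]_d * 'rV[R]_S => g t z.1 z.2) (c t, m t.+1).

Lemma limit_simplex t : (t <= T)%N -> simplex (m t).
Proof.
elim: t => [//|t IH tT]; rewrite m_step//; apply: simplex_step => //.
exact/IH/ltnW.
Qed.

(** The empirical measure takes finitely many values, all in the simplex, so continuity in the
    context at each fixed measure of the simplex suffices. *)
Lemma measurable_reward (h : 'rV[R]_S -> 'rV[R]_d -> R) N t : (1 <= N)%N -> (t <= T)%N ->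
  (forall p, simplex p -> continuous (h p)) ->
  random_mx (C N t) -> measurable_fun setT (fun w => h (M N t w) (C N t w)).
Proof.
move=> N1 tT ch mC.
pose H (z : {ffun 'I_N -> 'I_S}) w := h (empirical R z) (C N t w).
have -> : (fun w => h (M N t w) (C N t w)) = fun w => H [ffun n => X n t w] w.
  apply/funext => w; rewrite M_def; rewrite /H; congr (h _ _).
  by apply: eq_empirical => n; rewrite ffunE.
have mX (n : 'I_N) i : measurable (X n t @^-1` [set i]) by exact: X_measurable.
apply: (measurable_fun_state mX (h := H)) => z.
apply: (measurable_comp_continuous mC); apply: ch; exact: empirical_simplex.
Qed.

Lemma C_random N t : (1 <= N)%N -> (t <= T)%N -> random_mx (C N t).
Proof.
move=> N1; elim: t => [_|t IH tT]; first exact: C0_measurable.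
move=> i j; under eq_fun do rewrite C_step//.
pose H (z : {ffun 'I_N -> 'I_S}) w := g t (C N t w) (empirical R z) i j.
have -> : (fun w => g t (C N t w) (M N t.+1 w) i j) = fun w => H [ffun n => X n t.+1 w] w.
  apply/funext => w; rewrite M_def; rewrite /H; congr (g t _ _ _ _).
  by apply: eq_empirical => n; rewrite ffunE.
have mX (n : 'I_N) l : measurable (X n t.+1 @^-1` [set l]) by exact: X_measurable.
apply: (measurable_fun_state mX (h := H)) => z.
apply: (measurable_comp_continuous (f := fun x => g t x (empirical R z) i j) (IH (ltnW tT))).
move=> x; apply: (continuous_comp (f := g t ^~ (empirical R z)) (g := fun x : 'rV_d => x i j)).
  apply: g_continuous; exact: empirical_simplex.
exact: coord_continuous.
Qed.

(** The generating family of [history], named apart so that [OF N t] can turn it into a measurable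
    type on the same set. *)
Definition history_events N t : set (set O) :=
  [set E | exists2 s, (s <= t)%N &
    (exists n i, E = X (N := N) n s @^-1` [set i]) \/
    (exists j (B : set R), measurable B /\ E = (fun w => C N s w 0 j) @^-1` B)].

Lemma history_measurable N t : (1 <= N)%N -> (t <= T)%N ->
  history_events N t `<=` measurable.
Proof.
move=> N1 tT E [s st [[n [i ->]]|[j [B [mB ->]]]]].
  by apply: X_measurable; exact: leq_trans tT.
by rewrite -[_ @^-1` _]setTI; apply: C_random => //; exact: leq_trans tT.
Qed.

Local Notation OF N t := (g_sigma_algebraType (history_events N t)).

Definition deviation N t w := fluctuation N (M N t w) (m t) (C N t w) (c t).

Lemma deviation_history_random N s t : (1 <= N)%N -> (s <= t)%N ->
  @random_mx _ (OF N t) R _ _ (deviation N s).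
Proof.
move=> N1 st i j.
have -> : (fun w => deviation N s w i j) =
    fun w => Num.sqrt N%:R * (row_mx (M N s w) (C N s w) i j - row_mx (m s) (c s) i j).
  by apply/funext => w; rewrite /deviation /fluctuation !mxE.
apply: measurable_funM => //; apply: measurable_funB => //.
rewrite [i]ord1.
case: (fintype.splitP j) => l jl.
- rewrite (_ : j = lshift d l); last exact: val_inj.
  under eq_fun do rewrite row_mxEl M_def mxE.
  have hX (n : 'I_N) i' : <<s history_events N t >> (X n s @^-1` [set i']).
    by apply: sub_sigma_algebra; exists s => //; left; exists n, i'.
  apply: measurable_funM => //; apply: measurable_sum => n.
  exact: (state_indicator_measurable hX n l).
- rewrite (_ : j = rshift S l); last exact: val_inj.
  under eq_fun do rewrite row_mxEr.
  move=> _ B mB; rewrite setTI; apply: sub_sigma_algebra.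
  by exists s => //; right; exists l, B.
Qed.

Lemma deviation_random N t : (1 <= N)%N -> (t <= T)%N -> random_mx (deviation N t).
Proof.
move=> N1 tT i j; apply: (sigma_measurable_fun (history_measurable N1 tT)).
exact: deviation_history_random.
Qed.

Definition transition_noise N t w : 'rV[R]_S :=
  Num.sqrt N%:R *: (M N t.+1 w - M N t w *m K t (C N t w)).

Lemma pairing_transition_noise N t v w : pairing v (transition_noise N t w) =
  noise (K t) (fun n w => X (N := N) n t w) (fun n w => X n t.+1 w) (C N t) v w.
Proof.
rewrite /pairing big_ord1 /noise mulr_sumr; apply: eq_bigr => j _.
by rewrite /transition_noise !M_def !mxE mulrCA.
Qed.

Lemma state_history N s t (n : 'I_N) i : (s <= t)%N ->
  <<s history_events N t >> (X n s @^-1` [set i]).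
Proof. by move=> st; apply: sub_sigma_algebra; exists s => //; left; exists n, i. Qed.

Lemma context_history N s t : (s <= t)%N -> @random_mx _ (OF N t) R _ _ (C N s).
Proof.
move=> st i j _ B mB; rewrite setTI; apply: sub_sigma_algebra.
by exists s => //; right; exists j, B; rewrite [i]ord1.
Qed.

Lemma transition_noise_random N t : (1 <= N)%N -> (t < T)%N -> random_mx (transition_noise N t).
Proof.
move=> N1 tT i j.
have -> : (fun w => transition_noise N t w i j) = noise (K t) (fun n w => X (N := N) n t w)
    (fun n w => X n t.+1 w) (C N t) (delta_mx 0 j).
  by apply/funext => w; rewrite -pairing_transition_noise pairing_delta [i]ord1.
have hx (n : 'I_N) l : <<s history_events N t >> (X n t @^-1` [set l]).
  exact: state_history.
have my (n : 'I_N) l : measurable (X n t.+1 @^-1` [set l]) by exact: X_measurable.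
exact: (noise_measurable N1 (@K_continuous t)
  (history_measurable N1 (ltnW tT)) hx (@context_history N t t (leqnn t)) my (delta_mx 0 j)).
Qed.

Lemma transition_noise_tight t : (t < T)%N -> tight P (fun N => transition_noise N t).
Proof.
move=> tT; apply: tight_entries => i j e e0.
(* A bound on the square gives one on the absolute value through |x| <= x^2 + 1. *)
exists ((4 * `|delta_mx 0 j : 'rV[R]_S| ^+ 2 + 1) / e + 1); near=> N.
have N1 : (1 <= N)%N by near: N; exact: nbhs_infty_ge.
have hx (n : 'I_N) l : <<s history_events N t >> (X n t @^-1` [set l]).
  exact: state_history.
have my (n : 'I_N) l : measurable (X n t.+1 @^-1` [set l]) by exact: X_measurable.
have [E [mE PE HE]] := noise_tail N1 (K_stochastic t) (@K_continuous t)
  (history_measurable N1 (ltnW tT)) hx (@context_history N t t (leqnn t)) my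
  (fun y => @kernel_step N t y N1 tT) (delta_mx 0 j) e0.
exists E; split => // w /HE.
rewrite -(pairing_transition_noise N t) pairing_delta [i]ord1.
set x := transition_noise N t w 0 j => hxe.
apply: le_trans (lerD hxe (lexx 1)).
by rewrite -(real_normK (num_real x)); nra.
Unshelve. all: by end_near. Qed.

Lemma deviation_step t : (t < T)%N ->
  exists (A : 'M[R]_(S + d)) (B : 'M[R]_(S, S + d)),
  forall kappa e, 0 < e -> \forall N \near \oo, forall w,
    `|deviation N t w| <= kappa -> `|transition_noise N t w| <= kappa ->
    `|deviation N t.+1 w - (deviation N t w *m A + transition_noise N t w *m B)| <= e.
Proof.
move=> tT.
have [A [B H]] := linearized_step (m_step tT) (c_step tT)
  (fun i j => K_differentiable i j tT) (g_differentiable tT).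
exists A, B => kappa e e0; near=> N => w.
have N1 : (1 <= N)%N by near: N; exact: nbhs_infty_ge.
have sN0 : 0 < Num.sqrt N%:R :> R by near: N; exact: sqrtn_gt0.
move: w.
suff : forall (M M' transition_noise : 'rV[R]_S) (C C' : 'rV[R]_d),
    M' = M *m K t C + (Num.sqrt N%:R)^-1 *: transition_noise -> C' = g t C M' ->
    `|fluctuation N M (m t) C (c t)| <= kappa -> `|transition_noise| <= kappa ->
    `|fluctuation N M' (m t.+1) C' (c t.+1) -
      (fluctuation N M (m t) C (c t) *m A + transition_noise *m B)| <= e.
  move=> h w; apply: h; last exact: C_step.
  by rewrite /transition_noise scalerA mulVf ?gt_eqF// scale1r addrC subrK.
by near: N; exact: H.
Unshelve. all: by end_near. Qed.

Hypothesis deviation0_tight : tight P (fun N => deviation N 0%N).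

(** On the event where the deviation and the noise are bounded, the linearisation error is at most
    1, so the next deviation is bounded by a linear expression in these bounds. *)
Lemma deviation_tight t : (t <= T)%N -> tight P (fun N => deviation N t).
Proof.
elim: t => [//|t IH tT] e e0.
have e2 : 0 < e / 2 by rewrite divr_gt0.
have [A [B H]] := deviation_step tT.
have [a Ha] := IH (ltnW tT) _ e2; have [b Hb] := transition_noise_tight tT e2.
have Hr := H (Num.max a b) 1 ltr01.
exists (1 + ((S + d)%:R * `|A| * a + S%:R * `|B| * b)).
rewrite [e]splitr; apply: whpS (whpI Ha Hb); near=> N => w [Za Wb].
rewrite -[deviation N t.+1 w](subrK (deviation N t w *m A + transition_noise N t w *m B)).
rewrite (le_trans (ler_normD _ _))// lerD//.
  have : forall w, `|deviation N t w| <= Num.max a b -> `|transition_noise N t w| <= Num.max a b ->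
    `|deviation N t.+1 w - (deviation N t w *m A + transition_noise N t w *m B)| <= 1 by near: N.
  by apply; rewrite le_max ?Za ?Wb ?orbT.
rewrite (le_trans (ler_normD _ _))// lerD// (le_trans (mulmx_norm_le _ _))//.
  by rewrite ler_wpM2l ?mulr_ge0.
by rewrite ler_wpM2l ?mulr_ge0.
Unshelve. all: by end_near. Qed.

Lemma deviation_step_vanishing t : (t < T)%N ->
  exists (A : 'M[R]_(S + d)) (B : 'M[R]_(S, S + d)),
  vanishing P (fun N w => deviation N t.+1 w -
    (deviation N t w *m A + transition_noise N t w *m B)).
Proof.
move=> tT; have [A [B H]] := deviation_step tT; exists A, B => e delta e0 delta0.
have e2 : 0 < e / 2 by rewrite divr_gt0.
have [a Ha] := deviation_tight (ltnW tT) e2; have [b Hb] := transition_noise_tight tT e2.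
have Hr := H (Num.max a b) delta delta0.
rewrite [e]splitr; apply: whpS (whpI Ha Hb); near=> N => w [Za Wb].
have : forall w, `|deviation N t w| <= Num.max a b -> `|transition_noise N t w| <= Num.max a b ->
  `|deviation N t.+1 w - (deviation N t w *m A + transition_noise N t w *m B)| <= delta by near: N.
by apply; rewrite le_max ?Za ?Wb ?orbT.
Unshelve. all: by end_near. Qed.

(** A tight deviation divided by sqrt N tends to 0 in probability: a law of large numbers at time
    [t], passed through a function continuous at the limit point. *)
Lemma state_vanishing t (h : 'rV[R]_S * 'rV[R]_d -> R) : (t <= T)%N ->
  {for (m t, c t), continuous h} ->
  vanishing P (fun N w => h (M N t w, C N t w) - h (m t, c t)).
Proof.
move=> tT ch e delta e0 delta0.
have /cvgrPdist_le/(_ _ delta0)/nbhs_ballP[r /= r0 rh] := ch.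
have [a Ha] := deviation_tight tT e0.
apply: whpS Ha; near=> N => w Za.
have sN0 : 0 < Num.sqrt N%:R :> R by near: N; exact: sqrtn_gt0.
have sNr : a / r < Num.sqrt N%:R by near: N; exact: sqrtn_large.
have small n (x y : 'rV[R]_n) : `|Num.sqrt N%:R *: (x - y)| <= a ->
    `|y - x| <= a / Num.sqrt N%:R.
  by rewrite normrZ gtr0_norm// distrC mulrC ler_pdivlMr.
rewrite distrC; apply: rh; rewrite -ball_normE /ball_/=.
apply: (@le_lt_trans _ _ (a / Num.sqrt N%:R)).
  rewrite -[X in `|X|]/(m t - M N t w, c t - C N t w).
  have ZE : deviation N t w = row_mx (Num.sqrt N%:R *: (M N t w - m t))
                             (Num.sqrt N%:R *: (C N t w - c t)).
    by rewrite /deviation /fluctuation opp_row_mx add_row_mx scale_row_mx.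
  apply: pair_norm_le; apply: small; apply: le_trans Za; rewrite ZE.
    by rewrite -[X in `|X| <= _](row_mxKl _ (Num.sqrt N%:R *: (C N t w - c t))) lsubmx_norm_le.
  by rewrite -[X in `|X| <= _](row_mxKr (Num.sqrt N%:R *: (M N t w - m t))) rsubmx_norm_le.
by rewrite ltr_pdivrMr// mulrC -ltr_pdivrMr.
Unshelve. all: by end_near. Qed.

Lemma kernel_varZ t u v M' c' :
  kernel_var (K t) (u *: v) M' c' = u ^+ 2 * kernel_var (K t) v M' c'.
Proof.
rewrite /kernel_var mulr_sumr; apply: eq_bigr => i _.
rewrite [RHS]mulrCA; congr (_ * _); rewrite mulr_sumr; apply: eq_bigr => j _.
rewrite [RHS]mulrCA; congr (_ * _); rewrite -exprMn mulrBr mulr_sumr mxE; congr ((_ - _) ^+ 2).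
by apply: eq_bigr => l _; rewrite mxE mulrCA.
Qed.

Lemma kernel_var_continuous t v :
  continuous (fun z : 'rV[R]_S * 'rV[R]_d => kernel_var (K t) v z.1 z.2).
Proof.
have cK i j : continuous (fun z : 'rV[R]_S * 'rV[R]_d => K t z.2 i j).
  move=> z; apply: (continuous_comp (f := snd) (g := fun x => K t x i j)).
    exact: cvg_snd.
  exact: K_continuous.
have cM i : continuous (fun z : 'rV[R]_S * 'rV[R]_d => z.1 0 i).
  move=> z; apply: (continuous_comp (f := fst) (g := fun x : 'rV_S => x 0 i)).
    exact: cvg_fst.
  exact: coord_continuous.
apply: continuous_finsum => i; apply: continuousM_fun; first exact: cM.
apply: continuous_finsum => j; apply: continuousM_fun; first exact: cK.
rewrite (_ : (fun _ => _ ^+ 2) = (fun z : 'rV[R]_S * 'rV[R]_d =>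
   (v 0 j + \sum_l - v 0 l * K t z.2 i l) * (v 0 j + \sum_l - v 0 l * K t z.2 i l))).
  by apply: continuousM_fun; apply: continuousD_fun; (try by move=> ?; exact: cvg_cst);
     apply: continuous_finsum => l; apply: continuousM_fun => // ?; exact: cvg_cst.
apply/funext => z; rewrite expr2 -sumrN.
by congr ((_ + _) * (_ + _)); apply: eq_bigr => l _; rewrite mulNr mulrC.
Qed.

(** Sequences indexed by [nat], rather than matrices with t + 1 rows, let [t] vary in the
    induction. *)
Definition partial_pairing t (U z : nat -> 'rV[R]_(S + d)) : R :=
  \sum_(k < t.+1) pairing (U k) (z k).

(** The adjoint of the recursion moves the last coefficient onto row [t] and onto the noise. Stated
    for arbitrary sequences, it serves both the deviations and their Gaussian limit. *)
Lemma partial_pairing_step t U (A : 'M[R]_(S + d)) (B : 'M[R]_(S, S + d)) z z' h :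
  (forall k, (k <= t)%N -> z' k = z k) -> z' t.+1 = z t *m A + h *m B ->
  partial_pairing t.+1 U z' =
  partial_pairing t (fun k => if (k == t)%N then U t + U t.+1 *m A^T else U k) z +
  pairing (U t.+1 *m B^T) h.
Proof.
move=> zz zt; rewrite /partial_pairing big_ord_recr/= zt pairingDr !pairing_mulmx addrA.
congr (_ + _); rewrite !big_ord_recr/= eqxx pairingDl addrA zz//; congr (_ + _ + _).
by apply: eq_bigr => k _; rewrite zz 1?ltnW// ltn_eqF.
Qed.

(** The conditional Gaussian approximation leaves a factor with random variance [kv];
    [state_vanishing] replaces it by its value at the limit point, which comes out of the mean. *)
Lemma noise_cos_cvg t (A : nat -> O -> R) v : (t < T)%N ->
  (forall N, (1 <= N)%N -> @measurable_fun _ _ (OF N t) R setT (A N)) ->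
  \int[P]_w cos (A N w + pairing v (transition_noise N t w)) -
  expR (- kernel_var (K t) v (m t) (c t) / 2) * \int[P]_w cos (A N w)
    @[N --> \oo] --> 0.
Proof.
move=> tT mA.
pose kv N w := kernel_var (K t) v (M N t w) (C N t w).
pose q := kernel_var (K t) v (m t) (c t).
have mAO N : (1 <= N)%N -> measurable_fun setT (A N).
  by move=> N1; apply: (sigma_measurable_fun (history_measurable N1 (ltnW tT))); exact: mA.
have hx N (n : 'I_N) l : <<s history_events N t >> (X n t @^-1` [set l]).
  exact: state_history.
have my N (n : 'I_N) l : measurable (X n t.+1 @^-1` [set l]) by exact: X_measurable.
have kv0 N w : (1 <= N)%N -> 0 <= kv N w.
  move=> N1; rewrite /kv M_def.
  exact: (kernel_var_ge0 N1 (K_stochastic t) (fun n w => X n t w)).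
pose Y N w := cos (A N w) * expR (- kv N w / 2).
have gauss : \int[P]_w cos (A N w + pairing v (transition_noise N t w)) - \int[P]_w Y N w
    @[N --> \oo] --> 0.
  apply/cvgr0Pnorm_le => e e0.
  have H1 := sqrtn_large (2 * `|v|); have H2 := sqrtn_large (24 * `|v| ^+ 3 / e).
  near=> N.
  have N1 : (1 <= N)%N by near: N; exact: nbhs_infty_ge.
  have sN0 : 0 < Num.sqrt N%:R :> R by near: N; exact: sqrtn_gt0.
  have b1 : 2 * `|v| / Num.sqrt N%:R <= 1.
    by rewrite ler_pdivrMr// mul1r ltW//; near: N.
  have := noise_cos N1 (K_stochastic t) (@K_continuous t)
    (history_measurable N1 (ltnW tT)) (hx N) (@context_history N t t (leqnn t)) (my N)
    (fun y => @kernel_step N t y N1 tT) (mA N N1) b1.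
  have -> : \int[P]_w cos (A N w + noise (K t) (fun n w => X (N := N) n t w)
      (fun n w => X n t.+1 w) (C N t) v w) =
      \int[P]_w cos (A N w + pairing v (transition_noise N t w)).
    by apply: eq_Rintegral => w _; rewrite pairing_transition_noise.
  have -> : \int[P]_w (cos (A N w) * expR (- kernel_var (K t) v
      (empirical R (fun n : 'I_N => X n t w)) (C N t w) / 2)) = \int[P]_w Y N w.
    by apply: eq_Rintegral => w _; rewrite /Y /kv M_def.
  move=> h; apply: (le_trans h).
  have -> : N%:R * (3 * (2 * `|v| / Num.sqrt N%:R) ^+ 3) =
      24 * `|v| ^+ 3 / Num.sqrt N%:R.
    have gen (n s b : R) : 0 < s -> n = s ^+ 2 -> n * (3 * (2 * b / s) ^+ 3) = 24 * b ^+ 3 / s.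
      by move=> s0 ->; field; rewrite gt_eqF.
    by apply: gen; rewrite ?sqr_sqrtr.
  by rewrite ler_pdivrMr// [leRHS]mulrC -ler_pdivrMr// ltW//; near: N.
have var_cvg : \int[P]_w Y N w - \int[P]_w (cos (A N w) * expR (- q / 2))
    @[N --> \oo] --> 0.
  (* [mean_vanishing] asks for a bound at every [N], whereas [kv0] speaks of [N >= 1]; the value at
     0 is a default. *)
  pose Y' N w := if (1 <= N)%N then Y N w else 0.
  have YY' : \forall N \near \oo, Y N = Y' N.
    near=> N; have N1 : (1 <= N)%N by near: N; exact: nbhs_infty_ge.
    by apply/funext => w; rewrite /Y' N1.
  have expR1 x : 0 <= x -> `|expR (- x / 2)| <= 1 :> R.
    move=> x0; rewrite ger0_norm ?expR_ge0// -[leRHS]expR0 ler_expR; lra.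
  have q0 : 0 <= q.
    rewrite /q /kernel_var; have [m0 _] := limit_simplex (ltnW tT).
    apply: sumr_ge0 => i _; rewrite mulr_ge0//; apply: sumr_ge0 => j _.
    by rewrite mulr_ge0 ?sqr_ge0//; have [/(_ j)] := K_stochastic t (c t) i; rewrite mxE.
  have := @mean_vanishing _ _ _ P Y' (fun N w => cos (A N w) * expR (- q / 2)) 1.
  move=> mv; apply: cvg_trans (mv _ _ _ _ _).
  - apply: near_eq_cvg; near=> N; congr (_ - _); apply: eq_Rintegral => w _.
    by have -> : Y N = Y' N by near: N.
  - near=> N; have N1 : (1 <= N)%N by near: N; exact: nbhs_infty_ge.
    have -> : Y' N = Y N by apply/esym; near: N.
    apply: measurable_funM; first exact/measurable_cos_comp/mAO.
    apply: measurableT_comp => //; apply: measurable_funM => //.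
    apply: measurableT_comp => //.
    have -> : kv N = (fun w => kernel_var (K t) v (empirical R (fun n : 'I_N => X n t w)) (C N t w)).
      by apply/funext => w; rewrite /kv M_def.
    exact: (kernel_var_measurable N1 (@K_continuous t)
      (history_measurable N1 (ltnW tT)) (hx N) (@context_history N t t (leqnn t))).
  - near=> N; have N1 : (1 <= N)%N by near: N; exact: nbhs_infty_ge.
    by apply: measurable_funM => //; exact/measurable_cos_comp/mAO.
  - move=> N w; rewrite /Y'; case: ifP => N1; last by rewrite normr0.
    by rewrite normrM mulr_ile1// ?normr_cos_le// expR1// kv0.
  - by move=> N w; rewrite normrM mulr_ile1// ?normr_cos_le// expR1.
  - move=> e delta e0 delta0.
    have ch : {for (m t, c t), continuous
        (fun z : 'rV[R]_S * 'rV[R]_d => expR (- kernel_var (K t) v z.1 z.2 / 2))}.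
      apply: (continuous_comp (f := fun z : 'rV[R]_S * 'rV[R]_d =>
        - kernel_var (K t) v z.1 z.2 / 2) (g := expR)); last exact: continuous_expR.
      have hk := @kernel_var_continuous t v (m t, c t).
      have hc : {for (m t, c t), continuous (fun=> 2^-1 : R)} by exact: cst_continuous.
      exact: (continuousM (continuousN hk) hc).
    have := state_vanishing (ltnW tT) ch e0 delta0; apply: whpS.
    near=> N => w /=.
    have -> : Y' N = Y N by apply/esym; near: N.
    move=> h; rewrite /Y -mulrBr normrM (le_trans _ h)//.
    by rewrite ler_piMl// normr_cos_le.
rewrite -[X in _ --> X](addr0 0); apply: cvg_trans; last exact: cvgD gauss var_cvg.
apply: near_eq_cvg; near=> N; have N1 : (1 <= N)%N by near: N; exact: nbhs_infty_ge.
rewrite /= addrA subrK.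
congr (_ - _); rewrite [RHS]mulrC -/q; apply: RintegralZr => //.
exact/integrable_cos/mAO.
Unshelve. all: by end_near. Qed.

(* Characteristic functions are handled through E cos (s + .): letting the
   phase s vary recovers the real and imaginary parts. *)
Definition gaussian_up_to t :=
  exists (d' : measure_display) (O' : measurableType d') (P' : probability O' R)
    (G : nat -> O' -> 'rV[R]_(S + d)),
  (forall k, (k <= t)%N -> random_mx (G k)) /\
  forall U, exists q, 0 <= q /\ forall s u,
    \int[P']_w cos (s + u * partial_pairing t U (G ^~ w)) =
      cos s * expR (- (u ^+ 2 * q) / 2) /\
    \int[P]_w cos (s + u * partial_pairing t U (fun k => deviation N k w)) @[N --> \oo] -->
      cos s * expR (- (u ^+ 2 * q) / 2).

(** The form with coefficients [U] is reduced to the one with coefficients [U'] at level [t], on the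
    limit side and on the particle side. The new noise contributes the same factor to both, with
    variance [kernel_var] in direction [v]. *)
Lemma gaussian_up_to_step t : (t < T)%N -> gaussian_up_to t -> gaussian_up_to t.+1.
Proof.
move=> tT [e0 [OG [P' [G [mG GU]]]]].
have [A [B rho0]] := deviation_step_vanishing tT.
have [e [Q [P'' [p [xi [mp mxi H]]]]]] := normal_extension_fin ('I_S * 'I_S)%type P'.
(* [h] below is Gaussian with the covariance
   sum_i m_i (diag K_i - K_i^T K_i) of the limiting transition noise, K_i
   being the i-th row of the kernel. *)
pose V (ij : 'I_S * 'I_S) : 'rV[R]_S := Num.sqrt (m t 0 ij.1 * K t (c t) ij.1 ij.2) *:
  (delta_mx 0 ij.2 - row ij.1 (K t (c t))).
pose h w := \sum_ij xi ij w *: V ij.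
(* The past is pulled back along [p], so the joint law with the earlier coordinates is kept. *)
pose G' k w := if (k <= t)%N then G k (p w) else G t (p w) *m A + h w *m B.
have varE v : \sum_ij pairing v (V ij) ^+ 2 = kernel_var (K t) v (m t) (c t).
  rewrite -(pair_bigA _ (fun i j => pairing v (V (i, j)) ^+ 2)) /kernel_var /=.
  apply: eq_bigr => i _; rewrite mulr_sumr; apply: eq_bigr => j _.
  have mK : 0 <= m t 0 i * K t (c t) i j.
    have [m0 _] := limit_simplex (ltnW tT); rewrite mulr_ge0//.
    by have [/(_ j)] := K_stochastic t (c t) i; rewrite mxE.
  rewrite /V pairingZr pairingC pairingBl pairing_delta exprMn sqr_sqrtr// mulrA.
  congr (_ * (_ - _) ^+ 2); rewrite /pairing big_ord1.
  by apply: eq_bigr => l _; rewrite mxE.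
exists e, Q, P'', G'; split.
  move=> k kt1; rewrite /G'; case: leqP => kt.
    by move=> i j; exact: (measurableT_comp (mG k kt i j) mp).
  apply: random_mxD; apply: random_mulmx.
    by move=> i j; exact: (measurableT_comp (mG t (leqnn t) i j) mp).
  exact: random_lincomb.
move=> U; pose U' k := if (k == t)%N then U t + U t.+1 *m A^T else U k.
pose v := U t.+1 *m B^T.
have [q [q0 Hq]] := GU U'.
exists (q + kernel_var (K t) v (m t) (c t)); split.
  by rewrite addr_ge0// -varE sumr_ge0// => ij _; rewrite sqr_ge0.
move=> s u.
have lawE : cos s * expR (- (u ^+ 2 * (q + kernel_var (K t) v (m t) (c t))) / 2) =
    expR (- (u ^+ 2 * kernel_var (K t) v (m t) (c t)) / 2) *
    (cos s * expR (- (u ^+ 2 * q) / 2)).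
  by rewrite mulrCA -expRD; congr (_ * expR _); ring.
have [Hq1 Hq2] := Hq s u; rewrite lawE; split.
  rewrite -Hq1.
  have -> : u ^+ 2 * kernel_var (K t) v (m t) (c t) = \sum_ij (u * pairing v (V ij)) ^+ 2.
    by rewrite -varE mulr_sumr; apply: eq_bigr => ij _; rewrite exprMn.
  rewrite -H; last first.
    apply: measurable_funD => //; apply: measurable_funM => //.
    apply: measurable_sum => k; apply: measurable_pairing; apply: mG.
    by rewrite -ltnS ltn_ord.
  apply: eq_Rintegral => w _; congr (cos _).
  rewrite (@partial_pairing_step t U A B (G ^~ (p w)) (G' ^~ w) (h w)).
  - rewrite mulrDr addrA; congr (_ + _); rewrite /h pairing_sumr mulr_sumr.
    by apply: eq_bigr => ij _; rewrite pairingZr -/v mulrCA mulrC.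
  - by move=> k kt; rewrite /G' kt.
  - by rewrite /G' ltnn.
pose L N w := s + u * partial_pairing t U' (fun k => deviation N k w).
have mL N : (1 <= N)%N -> @measurable_fun _ _ (OF N t) R setT (L N).
  move=> N1; apply: measurable_funD => //; apply: measurable_funM => //.
  apply: measurable_sum => k.
  apply: (@measurable_pairing _ _ (OF N t)); apply: deviation_history_random => //.
  by rewrite -ltnS ltn_ord.
have lim1 : \int[P]_w cos (s + u * partial_pairing t.+1 U (fun k => deviation N k w)) -
    \int[P]_w cos (L N w + pairing (u *: v) (transition_noise N t w)) @[N --> \oo] --> 0.
  apply: (@mean_vanishing _ _ _ P
    (fun N w => cos (s + u * partial_pairing t.+1 U (fun k => deviation N k w)))
    (fun N w => cos (L N w + pairing (u *: v) (transition_noise N t w))) 1).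
  - near=> N; have N1 : (1 <= N)%N by near: N; exact: nbhs_infty_ge.
    apply: measurable_cos_comp; apply: measurable_funD => //; apply: measurable_funM => //.
    apply: measurable_sum => k; apply: measurable_pairing; apply: deviation_random => //.
    by apply: leq_trans tT; rewrite -ltnS ltn_ord.
  - near=> N; have N1 : (1 <= N)%N by near: N; exact: nbhs_infty_ge.
    apply: measurable_cos_comp; apply: measurable_funD.
      apply: (sigma_measurable_fun (history_measurable N1 (ltnW tT))); exact: mL.
    by apply: measurable_pairing; exact: transition_noise_random.
  - by move=> N w; exact: normr_cos_le.
  - by move=> N w; exact: normr_cos_le.
  - move=> eps delta eps0 delta0.
    (* A Lipschitz constant for the cosine as a function of the error [rho]; the summand 1 makes it
       positive. *)
    pose D := `|u| * ((S + d)%:R * `|U t.+1|) + 1.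
    have D0 : 0 < D by rewrite ltr_wpDl// !mulr_ge0.
    have dD : 0 < delta / D by rewrite divr_gt0.
    have := rho0 eps (delta / D) eps0 dD; apply: whpS; near=> N => w /=.
    set rho := deviation N t.+1 w - _ => rho_le.
    rewrite (le_trans (normr_cosB _ _))//.
    (* The deviations with the last one replaced by its exact linear recursion, to which
       [partial_pairing_step] applies. *)
    pose z' k := if (k <= t)%N then deviation N k w
      else deviation N t w *m A + transition_noise N t w *m B.
    have pE : partial_pairing t.+1 U (fun k => deviation N k w) =
        partial_pairing t.+1 U z' + pairing (U t.+1) rho.
      rewrite /partial_pairing !big_ord_recr/= /z' ltnn -!addrA -!pairingDr.
      rewrite leqnn /rho [_ + (_ - _)]addrC subrK; congr (_ + _).
      by apply: eq_bigr => k _; rewrite ltnW.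
    rewrite pE (@partial_pairing_step t U A B (fun k => deviation N k w) z'
      (transition_noise N t w)); last 2 first.
    - by move=> k kt; rewrite /z' kt.
    - by rewrite /z' ltnn.
    rewrite /L -/U' -/v pairingZl.
    have -> (x y r : R) : s + u * (x + y + r) - (s + u * x + u * y) = u * r by ring.
    rewrite normrM; apply: (@le_trans _ _ (`|u| * ((S + d)%:R * `|U t.+1| * (delta / D)))).
      rewrite ler_wpM2l// (le_trans (pairing_norm_le _ _))// ler_wpM2l// mulr_ge0//.
    rewrite mulrA mulrCA -[leRHS]mulr1 ler_wpM2l ?(ltW delta0)//.
    by rewrite ler_pdivrMr// mul1r lerDl.
have lim2 := noise_cos_cvg (u *: v) tT mL.
rewrite kernel_varZ in lim2.
have lim3 : expR (- (u ^+ 2 * kernel_var (K t) v (m t) (c t)) / 2) *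
    \int[P]_w cos (L N w) @[N --> \oo] -->
    expR (- (u ^+ 2 * kernel_var (K t) v (m t) (c t)) / 2) *
    (cos s * expR (- (u ^+ 2 * q) / 2)) by apply: cvgM => //; exact: cvg_cst.
(* The three limits telescope: linearisation, replacement of the noise by its Gaussian factor,
   induction hypothesis. *)
rewrite -[X in _ --> X](add0r (expR _ * _)) -[X in _ --> X + _](addr0 0).
apply: cvg_trans; last exact: cvgD (cvgD lim1 lim2) lim3.
by apply: near_eq_cvg; near=> N; rewrite /= addrA subrK subrK.
Unshelve. all: by end_near. Qed.

Lemma gaussian_up_to0 (d0 : measure_display) (O0 : measurableType d0)
    (P0 : probability O0 R) (G0 : O0 -> 'rV[R]_(S + d)) :
  gaussian_mx P0 G0 -> mean_zero P0 G0 -> cvg_in_law P P0 (fun N => deviation N 0) G0 ->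
  gaussian_up_to 0.
Proof.
move=> gG zG ZG; exists d0, O0, P0, (fun=> G0); split; first by move=> _ _; case: gG.
move=> U; have [sigma Usig] := gaussian_mx_cos gG zG (U 0%N).
exists (sigma ^+ 2); split=> [|s u]; first exact: sqr_ge0.
have -> : u ^+ 2 * sigma ^+ 2 = (sigma * u) ^+ 2 by rewrite -exprMn mulrC.
have pE x : partial_pairing 0 U x = pairing (U 0%N) (x 0%N).
  by rewrite /partial_pairing big_ord_recl big_ord0 addr0.
rewrite -Usig; split; first by apply: eq_Rintegral => w _; rewrite pE.
have mZ : \forall N \near \oo, random_mx (deviation N 0%N).
  by near=> N; apply: deviation_random => //; near: N; exact: nbhs_infty_ge.
have /(cvg_in_law_mxP _ _ mZ gG.1)/(_ (fun x => cos (s + u * pairing (U 0%N) x)) 1) := ZG.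
move=> lim; apply: cvg_trans (lim _ _).
- by apply: near_eq_cvg; near=> N; apply: eq_Rintegral => w _; rewrite pE.
- move=> x; apply: (continuous_comp (f := fun x => s + u * pairing (U 0%N) x));
    last exact: continuous_cos.
  apply: (continuousD_fun (f := cst s)); first exact: cst_continuous.
  apply: (continuousM_fun (f := cst u)); first exact: cst_continuous.
  exact: pairing_continuous.
- by move=> x; exact: normr_cos_le.
Unshelve. all: by end_near. Qed.

Definition trajectory N w : 'M[R]_(T.+1, S + d) := \matrix_(t < T.+1) deviation N t w.

Lemma trajectory_random N : (1 <= N)%N -> random_mx (trajectory N).
Proof.
move=> N1 i j; rewrite (_ : (fun w => _) = fun w => deviation N i w 0 j).
  by apply: deviation_random => //; rewrite -ltnS ltn_ord.
by apply/funext => w; rewrite mxE.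
Qed.

Lemma trajectory_tight : tight P trajectory.
Proof.
apply: tight_entries => i j e e0.
have iT : (i <= T)%N by rewrite -ltnS ltn_ord.
have [a Ha] := deviation_tight iT e0; exists a; apply: whpS Ha; near=> N => w h.
by rewrite mxE (le_trans (mx_entry_le _ _ _)).
Unshelve. all: by end_near. Qed.

Lemma pairing_trajectory (U : 'M[R]_(T.+1, S + d)) (z : nat -> 'rV[R]_(S + d)) :
  pairing U (\matrix_(t < T.+1) z t) = partial_pairing T (fun k => row (inord k) U) z.
Proof.
rewrite /partial_pairing /pairing; apply: eq_bigr => i _.
by rewrite inord_val big_ord1; apply: eq_bigr => j _; rewrite !mxE.
Qed.

(** The scale [u] in [gaussian_up_to] identifies the law of each linear form of the limit; the value
    [u = 1] with all phases provides the convergence required by [levy_continuity]. *)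
Lemma gaussian_limit_exists : gaussian_up_to 0 ->
  exists (d' : measure_display) (O' : measurableType d') (P' : probability O' R)
    (G : O' -> 'M[R]_(T.+1, S + d)),
  [/\ gaussian_mx P' G, mean_zero P' G & cvg_in_law P P' trajectory G].
Proof.
move=> base.
have gT t : (t <= T)%N -> gaussian_up_to t.
  by elim: t => [//|t IH tT]; apply: gaussian_up_to_step => //; exact/IH/ltnW.
have [d' [OG [P' [G [mG GU]]]]] := gT T (leqnn T).
pose H w : 'M[R]_(T.+1, S + d) := \matrix_(t < T.+1) G t w.
have mH : random_mx H.
  move=> i j; rewrite (_ : (fun w => _) = fun w => G i w 0 j).
    by apply: mG; rewrite -ltnS ltn_ord.
  by apply/funext => w; rewrite mxE.
have [] := centered_gaussian_mx (P := P') mH.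
  move=> U; have [q [q0 Uq]] := GU (fun k => row (inord k) U).
  exists q; split => // s u; have [<- _] := Uq s u.
  by apply: eq_Rintegral => w _; rewrite -(pairing_trajectory U (G ^~ w)).
move=> gH zH; exists d', OG, P', H; split => //.
apply: levy_continuity => //.
- by near=> N; apply: trajectory_random; near: N; exact: nbhs_infty_ge.
- exact: trajectory_tight.
- move=> s U; have [q [q0 Uq]] := GU (fun k => row (inord k) U).
  have [hG hZ] := Uq s 1.
  have -> : \int[P']_w cos (s + pairing U (H w)) =
      cos s * expR (- (1 ^+ 2 * q) / 2).
    by rewrite -hG; apply: eq_Rintegral => w _; rewrite mul1r -(pairing_trajectory U (G ^~ w)).
  apply: cvg_trans hZ; apply: near_eq_cvg; near=> N.
  by apply: eq_Rintegral => w _; rewrite mul1r -(pairing_trajectory U (fun k => deviation N k w)).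
Unshelve. all: by end_near. Qed.

(** * From the trajectory to the total reward *)

Context (r : nat -> 'rV[R]_S -> 'rV[R]_d -> R).
Hypothesis r_continuous : forall t p, (1 <= t <= T)%N -> simplex p -> continuous (r t p).
Hypothesis r_differentiable : forall t, (1 <= t <= T)%N ->
  differentiable (fun z : 'rV[R]_S * 'rV[R]_d => r t z.1 z.2) (m t, c t).

Lemma reward_differential_pairing t : (1 <= t <= T)%N -> exists U : 'rV[R]_(S + d),
  forall v, reward_differential (r t) (m t) (c t) v = pairing U v.
Proof.
move=> tT; pose D := 'd (fun z : 'rV[R]_S * 'rV[R]_d => r t z.1 z.2) (m t, c t).
(* The scalar differential is read as a 1 x 1 matrix so that [linear_pair_mx] applies. *)
pose D1 (z : 'rV[R]_S * 'rV[R]_d) : 'rV[R]_1 := const_mx (D z).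
have D1lin : linear D1.
  by move=> a x y; apply/matrixP => i j; rewrite /D1 !mxE linearP.
have [E HE] := linear_pair_mx D1lin.
exists E^T => v; rewrite /reward_differential -/D.
have -> : D (lsubmx v, rsubmx v) = D1 (lsubmx v, rsubmx v) 0 0 by rewrite mxE.
rewrite HE hsubmxK mxE /pairing big_ord1; apply: eq_bigr => k _.
by rewrite mxE mulrC.
Qed.

Lemma reward_fluctuation_vanishing t : (1 <= t <= T)%N ->
  vanishing P (fun N w => Num.sqrt N%:R * (r t (M N t w) (C N t w) - r t (m t) (c t)) -
    reward_differential (r t) (m t) (c t) (deviation N t w)).
Proof.
move=> /[dup] tT /andP[_ tT1] e delta e0 delta0.
have [a Ha] := deviation_tight tT1 e0.
have H := delta_method a (r_differentiable tT) delta0.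
apply: whpS Ha; near=> N => w Za.
have sN0 : 0 < Num.sqrt N%:R :> R by near: N; exact: sqrtn_gt0.
have h : forall xi : 'rV[R]_S * 'rV[R]_d, `|xi| <= a ->
  `|Num.sqrt N%:R *: (r t ((m t, c t) + (Num.sqrt N%:R)^-1 *: xi).1
     ((m t, c t) + (Num.sqrt N%:R)^-1 *: xi).2 - r t (m t) (c t)) -
   'd (fun z : 'rV[R]_S * 'rV[R]_d => r t z.1 z.2) (m t, c t) xi| <= delta.
  by near: N.
have ZE : deviation N t w = row_mx (Num.sqrt N%:R *: (M N t w - m t))
                           (Num.sqrt N%:R *: (C N t w - c t)).
  by rewrite /deviation /fluctuation opp_row_mx add_row_mx scale_row_mx.
have unscale n (x y : 'rV[R]_n) : y + (Num.sqrt N%:R)^-1 *: (Num.sqrt N%:R *: (x - y)) = x.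
  by rewrite scalerA mulVf ?gt_eqF// scale1r addrC subrK.
have := h (lsubmx (deviation N t w), rsubmx (deviation N t w)).
rewrite /reward_differential.
have -> : (m t, c t) + (Num.sqrt N%:R)^-1 *: (lsubmx (deviation N t w), rsubmx (deviation N t w)) =
    (M N t w, C N t w).
  rewrite -[LHS]/(m t + (Num.sqrt N%:R)^-1 *: lsubmx (deviation N t w),
    c t + (Num.sqrt N%:R)^-1 *: rsubmx (deviation N t w)).
  by rewrite ZE row_mxKl row_mxKr !unscale.
apply; apply: pair_norm_le; apply: le_trans Za.
  exact: lsubmx_norm_le.
exact: rsubmx_norm_le.
Unshelve. all: by end_near. Qed.

Lemma total_rewardE (z : nat -> 'rV[R]_S) (x : nat -> 'rV[R]_d) :
  total_reward r T z x = \sum_(t < T.+1 | (1 <= t)%N) r t (z t) (x t).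
Proof. by rewrite /total_reward big_geq_mkord. Qed.

(** The convergence in law of the trajectory is tested against [f \o D]; the gap between the scaled
    reward and [D] vanishes in probability, which does not change the limit of bounded continuous
    means. *)
Lemma reward_limit (d' : measure_display) (O' : measurableType d')
    (P' : probability O' R) (G : O' -> 'M[R]_(T.+1, S + d)) :
  random_mx G -> cvg_in_law P P' trajectory G ->
  @cvg_in_law _ _ O O' R P P' R
    (fun N w => Num.sqrt N%:R *
       (total_reward r T (fun t => M N t w) (fun t => C N t w) - total_reward r T m c))
    (fun w => \sum_(t < T.+1 | (1 <= t)%N)
       reward_differential (r t) (m t) (c t) (row t (G w))).
Proof.
move=> mG ZG.
pose D (z : 'M[R]_(T.+1, S + d)) := \sum_(t < T.+1 | (1 <= t)%N)
  reward_differential (r t) (m t) (c t) (row t z).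
have oT (t : 'I_T.+1) : (1 <= t)%N -> (1 <= t <= T)%N.
  by move=> ->; rewrite -ltnS ltn_ord.
have [U DE] : exists U, forall z, D z = pairing U z.
  have Ut (t : 'I_T.+1) : exists V : 'rV[R]_(S + d), (1 <= t)%N ->
      forall v, reward_differential (r t) (m t) (c t) v = pairing V v.
    case: (boolP (1 <= t)%N) => [/oT/reward_differential_pairing[V VE]|_]; last by exists 0.
    by exists V.
  have [V VE] := boolp.choice Ut.
  (* Rewards start at time 1, so row 0 of the coefficients is 0. *)
  exists (\matrix_(t < T.+1) (if (1 <= t)%N then V t else 0)) => z.
  rewrite /D /pairing [LHS]big_mkcond; apply: eq_bigr => t _.
  case: ifPn => t1.
    rewrite VE// /pairing big_ord1; apply: eq_bigr => j _; by rewrite !mxE t1.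
  by rewrite big1// => j _; rewrite !mxE (negbTE t1) mxE mul0r.
have cD : continuous D.
  by rewrite (_ : D = pairing U); [exact: pairing_continuous|exact/funext].
have mr N t : (1 <= N)%N -> (1 <= t <= T)%N ->
    measurable_fun setT (fun w => r t (M N t w) (C N t w)).
  move=> N1 /[dup] tT /andP[_ tT1]; apply: measurable_reward => //.
    by move=> p; exact: r_continuous.
  exact: C_random.
have mtr N : (1 <= N)%N -> measurable_fun setT
    (fun w => total_reward r T (fun t => M N t w) (fun t => C N t w)).
  move=> N1; rewrite (_ : (fun w => _) = fun w => \sum_(t < T.+1)
      if (1 <= t)%N then r t (M N t w) (C N t w) else 0).
    apply: measurable_sum => t; case: (boolP (1 <= t)%N) => [/oT|_]; last exact: measurable_cst.
    exact: mr.
  by apply/funext => w; rewrite total_rewardE big_mkcond.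
set rew := fun N (w : O) => _.
have mrew N : (1 <= N)%N -> measurable_fun setT (rew N).
  by move=> N1; apply: measurable_funM => //; apply: measurable_funB => //; exact: mtr.
have mtraj : \forall N \near \oo, random_mx (trajectory N).
  by near=> N; apply: trajectory_random; near: N; exact: nbhs_infty_ge.
apply/cvg_in_lawP.
- move=> f cf; near=> N; apply: measurableT_comp.
    exact: continuous_measurable_fun.
  by apply: mrew; near: N; exact: nbhs_infty_ge.
- move=> f cf; apply: (measurable_comp_continuous (f := f \o D) mG).
  by move=> x; apply: continuous_comp; [exact: cD|exact: cf].
move=> f B cf fB.
have cfD : continuous (f \o D).
  by move=> x; apply: continuous_comp; [exact: cD|exact: cf].
have limD : \int[P]_w f (D (trajectory N w)) @[N --> \oo] --> \int[P']_w f (D (G w)).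
  have /(cvg_in_law_mxP _ _ mtraj mG)/(_ (f \o D) B) := ZG.
  by apply => // x; exact: fB.
have rewD : vanishing P (fun N w => rew N w - D (trajectory N w)).
  rewrite (_ : (fun N w => _) = fun N w => \sum_(t < T.+1 | (1 <= t)%N)
      (Num.sqrt N%:R * (r t (M N t w) (C N t w) - r t (m t) (c t)) -
       reward_differential (r t) (m t) (c t) (deviation N t w))).
    by apply: vanishing_sum => t /oT; exact: reward_fluctuation_vanishing.
  apply/funext => N; apply/funext => w.
  rewrite /rew !total_rewardE -sumrB mulr_sumr /D -sumrB; apply: eq_bigr => t _.
  by rewrite /trajectory rowK.
have Dtight e : 0 < e -> exists a, whp P e (fun N w => `|D (trajectory N w)| <= a).
  move=> e0; have [a Ha] := trajectory_tight e0.
  pose F := \sum_i \sum_j `|U i j| * a.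
  exists F; apply: whpS Ha; near=> N => w h.
  rewrite DE (le_trans (ler_norm_sum _ _ _))//; apply: ler_sum => i _.
  rewrite (le_trans (ler_norm_sum _ _ _))//; apply: ler_sum => j _.
  by rewrite normrM ler_wpM2l// (le_trans (mx_entry_le _ _ _)).
have lim_diff := mean_vanishing (P := P) (X := fun N w => f (rew N w))
  (Y := fun N w => f (D (trajectory N w))) (B := B).
have {}lim_diff : \int[P]_w f (rew N w) - \int[P]_w f (D (trajectory N w))
    @[N --> \oo] --> 0.
  apply: lim_diff.
  - near=> N; apply: measurableT_comp; first exact: continuous_measurable_fun.
    by apply: mrew; near: N; exact: nbhs_infty_ge.
  - near=> N; apply: (measurable_comp_continuous (f := f \o D)) => //.
    by near: N.
  - by move=> N w; exact: fB.
  - by move=> N w; exact: fB.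
  - exact: vanishing_comp.
rewrite -[X in _ --> X](add0r (\int[P']_w f (D (G w)))).
apply: cvg_trans; last exact: cvgD lim_diff limD.
by apply: near_eq_cvg; near=> N; rewrite /= subrK.
Unshelve. all: by end_near. Qed.

End particle_system.

(** * The controlled system with fixed actions *)

Lemma continuous_slice (U V : topologicalType) (W : topologicalType) (D : set V)
    (f : V -> W) (i : U -> V) :
  {within D, continuous f} -> (forall x, D (i x)) -> continuous i -> continuous (f \o i).
Proof.
move=> /subspace_continuousP cf Di ci x B fB.
(* The whole slice lies in [D], so the restriction to [D] is satisfied at every [y] and plain
   continuity results. *)
have H : nbhs x (fun y => D (i y) -> B (f (i y))) := ci x _ (cf (i x) (Di x) B fB).
change (nbhs x (fun y => B (f (i y)))).
by apply: filterS H => y; apply.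
Qed.

Lemma continuous_pair (U V W : topologicalType) (f : U -> V) (g : U -> W) :
  continuous f -> continuous g -> continuous (fun x => (f x, g x)).
Proof. by move=> cf cg x; exact: (cvg_pair (cf x) (cg x)). Qed.

Lemma continuous_entry (R : realType) (U : topologicalType) (m n : nat)
  (f : U -> 'M[R]_(m, n)) i j : continuous f -> continuous (fun x => f x i j).
Proof.
move=> cf x; apply: (continuous_comp (f := f) (g := fun y : 'M[R]_(m, n) => y i j)).
  exact: cf.
exact: coord_continuous.
Qed.

Theorem corollary7
  (R : realType) (S d T : nat) (hS : (1 <= S)%N) (hd : (1 <= d)%N)
  (hT : (1 <= T)%N)
  (A : metricType R)
  (K : A -> 'rV[R]_d -> 'M[R]_S)
  (g : 'rV[R]_d -> 'rV[R]_S -> A -> 'rV[R]_d)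
  (r : nat -> 'rV[R]_S -> 'rV[R]_d -> R)
  (K_stochastic : forall a C, stochastic (K a C))
  (* the fixed actions a_0, ..., a_{T-1} *)
  (a : nat -> A)
  (* the deterministic limit trajectory *)
  (m : nat -> 'rV[R]_S) (c : nat -> 'rV[R]_d)
  (m0_simplex : simplex (m 0%N))
  (m_step : forall t, (t < T)%N -> m t.+1 = m t *m K (a t) (c t))
  (c_step : forall t, (t < T)%N -> c t.+1 = g (c t) (m t.+1) (a t))
  (* the particle systems, N >= 1 *)
  (dO : measure_display) (O : measurableType dO) (P : probability O R)
  (X : forall N : nat, 'I_N -> nat -> O -> 'I_S)
  (C : nat -> nat -> O -> 'rV[R]_d)
  (M : nat -> nat -> O -> 'rV[R]_S)
  (M_def : forall N t w, M N t w = empirical R (fun n : 'I_N => X N n t w))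
  (X_measurable : forall (N : nat) (n : 'I_N) (t : nat) (i : 'I_S),
     (t <= T)%N -> measurable (X N n t @^-1` [set i]))
  (C0_measurable : forall N, (1 <= N)%N -> random_mx (C N 0%N))
  (C_step : forall N t w, (1 <= N)%N -> (t < T)%N ->
     C N t.+1 w = g (C N t w) (M N t.+1 w) (a t))
  (A1 : forall (N t : nat) (y : 'I_N -> 'I_S), (1 <= N)%N -> (t < T)%N ->
     cond_prob_version P (history (X N) (C N) t)
       [set w | forall n, X N n t.+1 w = y n]
       (fun w => \prod_(n < N) K (a t) (C N t w) (X N n t w) (y n)))
  (A2 : compact [set: A])
  (A3_K : continuous (fun z : A * 'rV[R]_d => K z.1 z.2))
  (A3_g : {within [set z : ('rV[R]_d * 'rV[R]_S) * A | simplex z.1.2],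
     continuous (fun z => g z.1.1 z.1.2 z.2)})
  (A3_r : forall t, (1 <= t <= T)%N ->
     {within [set z : 'rV[R]_S * 'rV[R]_d | simplex z.1],
       continuous (fun z => r t z.1 z.2)})
  (A3_K_unif : forall x, unif_continuous (fun b => K b x))
  (A3_g_unif : forall x p, simplex p -> unif_continuous (fun b => g x p b))
  (A4_as : {ae P, forall w,
     (M N 0%N w, C N 0%N w) @[N --> \oo] --> (m 0%N, c 0%N)})
  (A4_bounded : exists B : R, {ae P, forall w,
     forall N, (1 <= N)%N -> `|C N 0%N w| <= B})
  (d0 : measure_display) (O0 : measurableType d0) (P0 : probability O0 R)
  (G0 : O0 -> 'rV[R]_(S + d)) (Gamma0 : 'M[R]_(S + d))
  (A4_gaussian : gaussian_mx P0 G0)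
  (A4_mean : mean_zero P0 G0)
  (A4_covariance : has_covariance P0 G0 Gamma0)
  (A4_cvg : cvg_in_law P P0
     (fun N w => fluctuation N (M N 0%N w) (m 0%N) (C N 0%N w) (c 0%N)) G0)
  (A5_K : forall t i j, (t < T)%N ->
     differentiable (fun x => K (a t) x i j) (c t))
  (A5_g : forall t, (t < T)%N ->
     differentiable (fun z : 'rV[R]_d * 'rV[R]_S => g z.1 z.2 (a t))
       (c t, m t.+1))
  (A5_r : forall t, (1 <= t <= T)%N ->
     differentiable (fun z : 'rV[R]_S * 'rV[R]_d => r t z.1 z.2)
       (m t, c t)) :
  let gaussian_limit (d' : measure_display) (O' : measurableType d')
      (P' : probability O' R) (G : O' -> 'M[R]_(T.+1, S + d)) : Prop :=
    [/\ gaussian_mx P' G, mean_zero P' G &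
      cvg_in_law P P'
        (fun N w => \matrix_(t < T.+1)
           fluctuation N (M N t w) (m t) (C N t w) (c t)) G] in
  (exists (d' : measure_display) (O' : measurableType d')
     (P' : probability O' R) (G : O' -> 'M[R]_(T.+1, S + d)),
     gaussian_limit d' O' P' G) /\
  (forall (d' : measure_display) (O' : measurableType d')
     (P' : probability O' R) (G : O' -> 'M[R]_(T.+1, S + d)),
     gaussian_limit d' O' P' G ->
     @cvg_in_law dO d' O O' R P P' R
       (fun N w => Num.sqrt N%:R *
          (total_reward r T (fun t => M N t w) (fun t => C N t w) -
           total_reward r T m c))
       (fun w => \sum_(t < T.+1 | (1 <= t)%N)
          reward_differential (r t) (m t) (c t) (row t (G w)))).
Proof.
move=> gaussian_limit.
(* With the actions fixed, kernels and context maps become functions of time and state only;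
   continuity is taken along the slice at the action [a t]. *)
have cK t i j : continuous (fun x => K (a t) x i j).
  apply: continuous_entry => x.
  apply: (continuous_comp (f := fun x => (a t, x)) (g := fun z : A * 'rV[R]_d => K z.1 z.2)).
    exact: (continuous_pair (@cst_continuous _ _ (a t)) (fun x => cvg_id)).
  exact: A3_K.
have cg t p : simplex p -> continuous ((fun x p => g x p (a t)) ^~ p).
  move=> sp.
  apply: (continuous_slice (i := fun x => ((x, p), a t)) A3_g) => //.
  apply: continuous_pair (@cst_continuous _ _ (a t)).
  exact: (continuous_pair (fun x => cvg_id) (@cst_continuous _ _ p)).
have cr t p : (1 <= t <= T)%N -> simplex p -> continuous (r t p).
  move=> tT sp; apply: (continuous_slice (i := fun x => (p, x)) (A3_r t tT)) => //.
  exact: (continuous_pair (@cst_continuous _ _ p) (fun x => cvg_id)).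
have Z0_random : \forall N \near \oo, random_mx
    (fun w => fluctuation N (M N 0%N w) (m 0%N) (C N 0%N w) (c 0%N)).
  near=> N.
  have N1 : (1 <= N)%N by near: N; exact: nbhs_infty_ge.
  exact: (deviation_random (g := fun t x p => g x p (a t)) cg m c M_def X_measurable
    C0_measurable C_step N1 (leq0n T)).
have Z0_tight := tight_cvg_in_law Z0_random A4_gaussian.1 A4_cvg.
split.
  apply: (gaussian_limit_exists (K := fun t => K (a t)) (g := fun t x p => g x p (a t))
    (fun t => K_stochastic (a t)) cK cg m0_simplex m_step c_step M_def X_measurable
    C0_measurable C_step A1 A5_K A5_g Z0_tight).
  exact: (gaussian_up_to0 (g := fun t x p => g x p (a t)) cg M_def X_measurable
    C0_measurable C_step A4_gaussian A4_mean A4_cvg).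
move=> d' O' P' G [[mG _] _ ZG].
exact: (reward_limit (K := fun t => K (a t)) (g := fun t x p => g x p (a t))
  (fun t => K_stochastic (a t)) cK cg m_step c_step M_def X_measurable
  C0_measurable C_step A1 A5_K A5_g Z0_tight cr A5_r mG ZG).
Unshelve. all: by end_near. Qed.
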